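(* Let $F:\mathbb{T}^2\to\mathbb{T}^2$ be a $C^1$ map of the torus, written as $F(z)=(Mz+G(z))\bmod 1$ as in the context, such that $DF(z)$ is invertible for every $z$. Assume: ($E_M$) the $2\times 2$ integer matrix $M$ has the two integer eigenvalues $1$ and $m$, with $|m|>1$; ($E_{\mathcal{P}\mathcal{R}}$) $F$ has a (hyperbolic) periodic saddle $\mathcal{P}$ and a (hyperbolic) periodic repeller $\mathcal{R}$; ($E_{cone}$) $F$ has a $(K,\alpha)$-cone system with respect to $w=v_m^R/|v_m^R|$ and $W=(v_m^L)^\perp$, where $v_m^R$ and $v_m^L$ are right and left eigenvectors of $M$ for the eigenvalue $m$; ($E_{QuasiP}$) there is a curve $\Gamma\subset\mathbb{T}^2$ and an integer $p\ge 1$ such that $F^p(\Gamma)=\Gamma$ and $F^p|_\Gamma$ is quasiperiodic. Then $\mathbb{T}^2$ is multi-chaotic for $F$.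
   Context: $\mathbb{T}^d=\mathbb{R}^d/\mathbb{Z}^d$, and $\bmod 1$ is applied coordinatewise. Every continuous $F:\mathbb{T}^d\to\mathbb{T}^d$ can be written uniquely as $F(z)=(Mz+G(z))\bmod 1$ with $M$ a $d\times d$ integer matrix and $G:\mathbb{R}^d\to\mathbb{R}^d$ continuous and $\mathbb{Z}^d$-periodic. A map on a circle or on a closed curve is quasiperiodic if it is topologically conjugate to a rotation $\theta\mapsto\theta+\rho\bmod 1$ with $\rho$ irrational. Cone system: let $w\in\mathbb{R}^d$ with $|w|=1$ and let $W$ be a $(d-1)$-dimensional subspace with $\mathbb{R}^d=\mathbb{R}w\oplus W$. Write each tangent vector as $v=aw+b=(a,b)$ with $b\in W$, and set $(a',b')=DF(z)v$. $F$ has a $(K,\alpha)$-cone system with respect to $w$ and $W$, with constants $K>1$ and $\alpha>0$, if for every $z$ and every $v=(a,b)$ with $|b|\le\alpha|a|$ one has (i) $|b'|<\alpha|a'|$ and (ii) $|a'|>K|a|$; and (iii) for every vector $u$ outside the cone, $\|DF(z)u\|<K\|u\|$. The cone at $z$ is the set $\{(a,b):|b|<\alpha|a|\}$. A saddle is a hyperbolic periodic point of period $n$ for which $DF^n$ has one eigenvalue of modulus $>1$ and one of modulus $<1$. A repeller is a hyperbolic periodic point all of whose eigenvalues for $DF^n$ have modulus $>1$. A set $X$ is transitive if it is uncountable, closed, satisfies $F(X)=X$, and contains a point whose forward orbit is dense in $X$. $X$ is chaotic if it is transitive and periodic points of $F$ are dense in $X$. $X$ is $k$-chaotic if it is chaotic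 and there is a dense subset of $X$ consisting of periodic points whose unstable manifolds intersected with $X$ have topological dimension $k$. $X$ is multi-chaotic if it is $k$-chaotic for at least two values of $k$. For $X=\mathbb{T}^2$ this means there is a dense orbit, periodic saddles are dense, and periodic repellers are dense. *)

(* Defs.v *)
From Stdlib Require Import Reals ZArith.
Open Scope R_scope.

Definition vec : Type := (R * R)%type.
Record mat : Type := Mat { m11 : R; m12 : R; m21 : R; m22 : R }.

Definition vadd (u v : vec) : vec := (fst u + fst v, snd u + snd v).
Definition vsub (u v : vec) : vec := (fst u - fst v, snd u - snd v).
Definition vscale (c : R) (v : vec) : vec := (c * fst v, c * snd v).
Definition dot (u v : vec) : R := fst u * fst v + snd u * snd v.
Definition vnorm (v : vec) : R := sqrt (fst v ^ 2 + snd v ^ 2).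

Definition mv (A : mat) (v : vec) : vec :=
  (m11 A * fst v + m12 A * snd v, m21 A * fst v + m22 A * snd v).
Definition madd (A B : mat) : mat :=
  Mat (m11 A + m11 B) (m12 A + m12 B) (m21 A + m21 B) (m22 A + m22 B).
Definition mmul (A B : mat) : mat :=
  Mat (m11 A * m11 B + m12 A * m21 B) (m11 A * m12 B + m12 A * m22 B)
      (m21 A * m11 B + m22 A * m21 B) (m21 A * m12 B + m22 A * m22 B).
Definition mid : mat := Mat 1 0 0 1.
Definition mtrans (A : mat) : mat := Mat (m11 A) (m21 A) (m12 A) (m22 A).
Definition mdet (A : mat) : R := m11 A * m22 A - m12 A * m21 A.
Definition mtr (A : mat) : R := m11 A + m22 A.

Definition is_int_mat (M : mat) : Prop :=
  exists a b c d : Z, M = Mat (IZR a) (IZR b) (IZR c) (IZR d).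

Definition is_eigenvalue (A : mat) (l : R) : Prop :=
  exists v : vec, v <> (0, 0) /\ mv A v = vscale l v.

(** x + i y is a (complex) eigenvalue of A, i.e. a root of the characteristic
    polynomial  det(lambda I - A) = lambda^2 - tr A lambda + det A;
    real and imaginary parts written out. *)
Definition cplx_eigenvalue (A : mat) (x y : R) : Prop :=
  x ^ 2 - y ^ 2 - mtr A * x + mdet A = 0 /\ 2 * x * y - mtr A * y = 0.

Definition has_derivative (G : vec -> vec) (DG : vec -> mat) : Prop :=
  forall z eps, 0 < eps -> exists delta, 0 < delta /\
    forall h, vnorm h < delta ->
      vnorm (vsub (vsub (G (vadd z h)) (G z)) (mv (DG z) h)) <= eps * vnorm h.

Definition mat_continuous (DG : vec -> mat) : Prop :=
  forall z eps, 0 < eps -> exists delta, 0 < delta /\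
    forall y, vnorm (vsub y z) < delta ->
      Rabs (m11 (DG y) - m11 (DG z)) < eps /\ Rabs (m12 (DG y) - m12 (DG z)) < eps /\
      Rabs (m21 (DG y) - m21 (DG z)) < eps /\ Rabs (m22 (DG y) - m22 (DG z)) < eps.

(** * The torus T^2 = R^2 / Z^2, handled through lifts *)
Definition lattice (v : vec) : Prop := exists k1 k2 : Z, v = (IZR k1, IZR k2).
Definition eqT (x y : vec) : Prop := lattice (vsub x y).
Definition nearT (x y : vec) (eps : R) : Prop :=
  exists k1 k2 : Z, vnorm (vsub (vsub x y) (IZR k1, IZR k2)) < eps.

Definition Zperiodic (G : vec -> vec) : Prop :=
  forall z k1 k2, G (vadd z (IZR k1, IZR k2)) = G z.

Definition liftF (M : mat) (G : vec -> vec) (z : vec) : vec := vadd (mv M z) (G z).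
Definition DF (M : mat) (DG : vec -> mat) (z : vec) : mat := madd M (DG z).
(** DF^n(z), by the chain rule along the orbit *)
Fixpoint DFn (M : mat) (G : vec -> vec) (DG : vec -> mat) (n : nat) (z : vec) : mat :=
  match n with
  | O => mid
  | S k => mmul (DF M DG (Nat.iter k (liftF M G) z)) (DFn M G DG k z)
  end.

Definition is_periodic (M : mat) (G : vec -> vec) (z : vec) : Prop :=
  exists n : nat, (0 < n)%nat /\ eqT (Nat.iter n (liftF M G) z) z.

Definition is_saddle (M : mat) (G : vec -> vec) (DG : vec -> mat) (z : vec) : Prop :=
  exists n : nat, (0 < n)%nat /\ eqT (Nat.iter n (liftF M G) z) z /\
    exists x1 y1 x2 y2,
      cplx_eigenvalue (DFn M G DG n z) x1 y1 /\ x1 ^ 2 + y1 ^ 2 > 1 /\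
      cplx_eigenvalue (DFn M G DG n z) x2 y2 /\ x2 ^ 2 + y2 ^ 2 < 1.

Definition is_repeller (M : mat) (G : vec -> vec) (DG : vec -> mat) (z : vec) : Prop :=
  exists n : nat, (0 < n)%nat /\ eqT (Nat.iter n (liftF M G) z) z /\
    forall x y, cplx_eigenvalue (DFn M G DG n z) x y -> x ^ 2 + y ^ 2 > 1.

(** * Cone system (d = 2) w.r.t. w and W = vL^perp.
    v = a w + b with b in W:  a = (v.vL)/(w.vL), b = v - a w. *)
Definition cone_a (w vL v : vec) : R := dot v vL / dot w vL.
Definition cone_b (w vL v : vec) : vec := vsub v (vscale (cone_a w vL v) w).

Definition cone_system (M : mat) (DG : vec -> mat) (w vL : vec) (K alpha : R) : Prop :=
  1 < K /\ 0 < alpha /\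
  forall z : vec,
    (forall v : vec, v <> (0, 0) ->
       vnorm (cone_b w vL v) <= alpha * Rabs (cone_a w vL v) ->
       let v' := mv (DF M DG z) v in
       vnorm (cone_b w vL v') < alpha * Rabs (cone_a w vL v') /\
       Rabs (cone_a w vL v') > K * Rabs (cone_a w vL v)) /\
    (forall u : vec, u <> (0, 0) ->
       ~ (vnorm (cone_b w vL u) < alpha * Rabs (cone_a w vL u)) ->
       vnorm (mv (DF M DG z) u) < K * vnorm u).

(** * Quasiperiodic invariant curve.
    gamma : R -> R^2 is a (lift of a) continuous closed curve in T^2,
    s |-> gamma(s) injective from R/Z to T^2 (hence a homeomorphism onto its
    image Gamma), and F^p o gamma = gamma o (rotation by rho), rho irrational. *)
Definition irrational (rho : R) : Prop :=
  forall p q : Z, q <> 0%Z -> rho * IZR q <> IZR p.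

Definition vcontinuous (g : R -> vec) : Prop :=
  forall s eps, 0 < eps -> exists delta, 0 < delta /\
    forall t, Rabs (t - s) < delta -> vnorm (vsub (g t) (g s)) < eps.

Definition quasiperiodic_curve (M : mat) (G : vec -> vec) (p : nat)
    (gamma : R -> vec) (rho : R) : Prop :=
  vcontinuous gamma /\
  (forall s, eqT (gamma (s + 1)) (gamma s)) /\
  (forall s t, eqT (gamma s) (gamma t) -> exists k : Z, s - t = IZR k) /\
  irrational rho /\
  (forall s, eqT (Nat.iter p (liftF M G) (gamma s)) (gamma (s + rho))).

Definition dense_orbit (M : mat) (G : vec -> vec) : Prop :=
  exists z0, forall x eps, 0 < eps ->
    exists n : nat, nearT (Nat.iter n (liftF M G) z0) x eps.

Definition dense_set (P : vec -> Prop) : Prop :=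
  forall x eps, 0 < eps -> exists z, P z /\ nearT z x eps.

(** T^2 transitive: uncountable, closed (trivial), F(T^2) = T^2, dense orbit *)
Definition transitive_T2 (M : mat) (G : vec -> vec) : Prop :=
  (forall y, exists x, eqT (liftF M G x) y) /\ dense_orbit M G.

Definition chaotic_T2 (M : mat) (G : vec -> vec) : Prop :=
  transitive_T2 M G /\ dense_set (is_periodic M G).

(** T^2 is 1-chaotic (dense saddles, unstable manifolds of dimension 1) and
    2-chaotic (dense repellers, unstable manifolds open, dimension 2). *)
Definition multi_chaotic_T2 (M : mat) (G : vec -> vec) (DG : vec -> mat) : Prop :=
  chaotic_T2 M G /\
  dense_set (is_saddle M G DG) /\
  dense_set (is_repeller M G DG).

(* Main.v *)
(** Write [A] for the coordinate along [w] and work with lifts to the plane. The coordinate [A] is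
    semiconjugated to multiplication by [m]: [h = lim m^-n A (F^n)] satisfies [h (F z) = m (h z)]
    and stays at bounded distance from [A]. Differences lying in the cone stay in it and expand, so
    [h] is injective along cone directions, and its level sets are graphs over [W], permuted
    by [F]; with surjectivity (by minimising [|F z - y|]) this makes the lift a homeomorphism.
    The level of the quasiperiodic curve is constant, so the curve fills a periodic level set.

    Through every point there is an unstable set meeting every level once: its points approach
    each other backwards faster than, by condition (iii), points of a common level can. Hence
    backward orbits follow the rotation on the curve, and forward images of every open set cover
    the torus. An orbit leaving and reaching again a repeller gives a contracting inverse branch
    near any given point, hence repellers are dense. For a saddle, rotation along the curve lets the
    unstable set of the saddle cross any arc of a level set whose image contains the saddle; near
    the resulting homoclinic orbit a return map contracts an arc of an invariant level set. *)
Require Import Defs.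
From Stdlib Require Import Reals ZArith Lra Lia Classical ClassicalEpsilon FunctionalExtensionality Cantor.
Open Scope R_scope.

Local Notation iter := Nat.iter.

(** * Vectors and the sum norm *)

(** Condition (iii) bounds growth across the cone only by [K], so nothing contracts a priori and the
    transverse direction may even expand. What is available is domination: by compactness the factor
    across the cone is some [K1 < K] at small scales, against at least [K] for the coordinate [A]
    inside it. A second obstacle is regularity: the level sets of the expanding coordinate are only
    Lipschitz graphs, so there is no derivative along them. At a periodic point the derivative has
    an eigenvector in the cone; the linear functional [B - s A] vanishing on it is a left
    eigenvector for the other eigenvalue and measures distances on a level up to constants.
    Contraction along levels is read off from this functional, with derivatives taken in the strict,
    two-point sense. Torus identities hold only modulo the lattice, so the maps used are powers of
    the lift followed by a lattice translation. Each acts affinely on levels with multiplier [mu^n];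
    for [n >= 1] it therefore has exactly one invariant level. The sum norm serves for most
    estimates, the Euclidean norm where (iii) is used. *)

Definition n1 (v : vec) : R := Rabs (fst v) + Rabs (snd v).
Definition dist (a b : vec) : R := n1 (vsub a b).
Definition zero : vec := (0, 0).

Ltac vring :=
  unfold vadd, vsub, vscale, dot, mv, zero in *;
  first [apply injective_projections; simpl; ring | simpl; ring].

Ltac rpos x := pose proof (Rabs_pos x).

Lemma n1_pos v : 0 <= n1 v.
Proof. unfold n1. rpos (fst v). rpos (snd v). lra. Qed.

Ltac npos v := pose proof (n1_pos v).

Lemma n1_zero : n1 zero = 0.
Proof. unfold n1, zero; simpl. rewrite Rabs_R0. lra. Qed.

Lemma n1_eq0 v : n1 v = 0 -> v = zero.
Proof.
  unfold n1, zero. intros H. rpos (fst v). rpos (snd v).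
  destruct v as [a b]; simpl in *.
  f_equal; apply NNPP; intros E; [pose proof (Rabs_pos_lt a E) | pose proof (Rabs_pos_lt b E)]; lra.
Qed.

Lemma n1_gt0 v : v <> zero -> 0 < n1 v.
Proof.
  intros H. destruct (Rle_lt_or_eq_dec _ _ (n1_pos v)) as [|E]; auto.
  elim H. apply n1_eq0; auto.
Qed.

Lemma n1_add u v : n1 (vadd u v) <= n1 u + n1 v.
Proof.
  unfold n1, vadd; simpl.
  pose proof (Rabs_triang (fst u) (fst v)). pose proof (Rabs_triang (snd u) (snd v)). lra.
Qed.

Lemma n1_scale c v : n1 (vscale c v) = Rabs c * n1 v.
Proof. unfold n1, vscale; simpl. rewrite !Rabs_mult. ring. Qed.

Lemma n1_opp v : n1 (vscale (-1) v) = n1 v.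
Proof. rewrite n1_scale, Rabs_left by lra. ring. Qed.

Lemma dist_pos a b : 0 <= dist a b.
Proof. apply n1_pos. Qed.

Lemma dist_refl a : dist a a = 0.
Proof. unfold dist. replace (vsub a a) with zero by vring. apply n1_zero. Qed.

Lemma dist_eq a b : dist a b = 0 -> a = b.
Proof.
  intros H. apply n1_eq0 in H. unfold vsub, zero in H. injection H; intros.
  apply injective_projections; lra.
Qed.

Lemma dist_sym a b : dist a b = dist b a.
Proof.
  unfold dist, n1, vsub; simpl. rewrite (Rabs_minus_sym (fst a)), (Rabs_minus_sym (snd a)). auto.
Qed.

Lemma dist_tri a b c : dist a c <= dist a b + dist b c.
Proof. unfold dist. replace (vsub a c) with (vadd (vsub a b) (vsub b c)) by vring. apply n1_add. Qed.

Lemma dist_addr a b k : dist (vadd a k) (vadd b k) = dist a b.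
Proof. unfold dist. f_equal. vring. Qed.

Lemma dist_subr a b k : dist (vsub a k) (vsub b k) = dist a b.
Proof. unfold dist. f_equal. vring. Qed.

Lemma dist_small_eq a b : (forall eps, 0 < eps -> dist a b < eps) -> a = b.
Proof.
  intros H. apply dist_eq. destruct (Rle_lt_or_eq_dec _ _ (dist_pos a b)) as [L|E]; auto.
  specialize (H _ L). lra.
Qed.

Lemma dot_sub p u v : dot p (vsub u v) = dot p u - dot p v.
Proof. vring. Qed.

Lemma dot_add p u v : dot p (vadd u v) = dot p u + dot p v.
Proof. vring. Qed.

Lemma dot_scale p c v : dot p (vscale c v) = c * dot p v.
Proof. vring. Qed.

Lemma dot_le p v : Rabs (dot p v) <= n1 p * n1 v.
Proof.
  unfold dot, n1. pose proof (Rabs_triang (fst p * fst v) (snd p * snd v)) as H.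
  rewrite !Rabs_mult in H.
  rpos (fst p); rpos (snd p);
  rpos (fst v); rpos (snd v). nra.
Qed.

Lemma dot_dist p u v : Rabs (dot p u - dot p v) <= n1 p * dist u v.
Proof. rewrite <- dot_sub. apply dot_le. Qed.

Lemma mv_add A u v : mv A (vadd u v) = vadd (mv A u) (mv A v).
Proof. vring. Qed.

Lemma mv_scale A c v : mv A (vscale c v) = vscale c (mv A v).
Proof. vring. Qed.

Lemma mv_mmul A B v : mv (mmul A B) v = mv A (mv B v).
Proof. unfold mmul. vring. Qed.

(** * Matrix norm and comparison with the Euclidean norm *)

Definition mnorm (A : mat) : R := Rabs (m11 A) + Rabs (m12 A) + Rabs (m21 A) + Rabs (m22 A).

Lemma mnorm_pos A : 0 <= mnorm A.
Proof.
  unfold mnorm. rpos (m11 A); rpos (m12 A);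
  rpos (m21 A); rpos (m22 A). lra.
Qed.

Lemma mv_le A v : n1 (mv A v) <= mnorm A * n1 v.
Proof.
  unfold mv, n1, mnorm; simpl.
  pose proof (Rabs_triang (m11 A * fst v) (m12 A * snd v)) as H1.
  pose proof (Rabs_triang (m21 A * fst v) (m22 A * snd v)) as H2.
  rewrite !Rabs_mult in H1, H2.
  rpos (m11 A); rpos (m12 A);
  rpos (m21 A); rpos (m22 A);
  rpos (fst v); rpos (snd v). nra.
Qed.

Lemma Rabs_le_sqrt a b : Rabs a <= sqrt (a ^ 2 + b ^ 2).
Proof.
  rewrite <- sqrt_Rsqr_abs. apply sqrt_le_1_alt. unfold Rsqr. nra.
Qed.

Lemma vnorm_le_n1 v : vnorm v <= n1 v.
Proof.
  unfold vnorm, n1. rewrite <- (sqrt_Rsqr (Rabs (fst v) + Rabs (snd v))).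
  - apply sqrt_le_1_alt. unfold Rsqr.
    rewrite <- (pow2_abs (fst v)), <- (pow2_abs (snd v)).
    rpos (fst v); rpos (snd v). nra.
  - apply n1_pos.
Qed.

Lemma n1_le_vnorm v : n1 v <= 2 * vnorm v.
Proof.
  unfold n1, vnorm. pose proof (Rabs_le_sqrt (fst v) (snd v)).
  pose proof (Rabs_le_sqrt (snd v) (fst v)) as H1.
  rewrite (Rplus_comm (snd v ^ 2)) in H1. lra.
Qed.

Lemma vnorm_pos v : 0 <= vnorm v.
Proof. apply sqrt_pos. Qed.

Lemma vnorm_scale c v : vnorm (vscale c v) = Rabs c * vnorm v.
Proof.
  unfold vnorm, vscale; simpl fst; simpl snd. rewrite <- sqrt_Rsqr_abs, <- sqrt_mult_alt.
  - f_equal. unfold Rsqr. ring.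
  - apply Rle_0_sqr.
Qed.

Lemma vnorm_add u v : vnorm (vadd u v) <= vnorm u + vnorm v.
Proof.
  pose proof (triangle (fst u) (snd u) (- fst v) (- snd v) 0 0) as H.
  unfold dist_euc, Rsqr in H. unfold vnorm, vadd; simpl fst; simpl snd.
  replace ((fst u + fst v) ^ 2 + (snd u + snd v) ^ 2) with
    ((fst u - - fst v) * (fst u - - fst v) + (snd u - - snd v) * (snd u - - snd v)) by ring.
  replace (fst u ^ 2 + snd u ^ 2) with ((fst u - 0) * (fst u - 0) + (snd u - 0) * (snd u - 0)) by ring.
  replace (fst v ^ 2 + snd v ^ 2) with
    ((0 - - fst v) * (0 - - fst v) + (0 - - snd v) * (0 - - snd v)) by ring. auto.
Qed.

(** * Sequences, compactness, fixed points *)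

Lemma subseq_mono (phi : nat -> nat) :
  (forall n, (phi n < phi (S n))%nat) -> forall n, (n <= phi n)%nat.
Proof. intros H n. induction n; [lia|]. specialize (H n). lia. Qed.

Lemma subseq_lt (phi : nat -> nat) :
  (forall n, (phi n < phi (S n))%nat) -> forall n k, (n < k)%nat -> (phi n < phi k)%nat.
Proof. intros H n k L. induction L; [apply H|]. specialize (H m). lia. Qed.

Lemma nat_choice {X : Type} (P : nat -> X -> Prop) :
  (forall n, exists x, P n x) -> exists u, forall n, P n (u n).
Proof.
  intros H. exists (fun n => proj1_sig (constructive_indefinite_description _ (H n))).
  intros n. exact (proj2_sig (constructive_indefinite_description _ (H n))).
Qed.

Lemma mul_lt_of_lt_div c x y : x < y / c -> 0 < c -> c * x < y.
Proof.
  intros H Hc. apply Rmult_lt_compat_l with (r := c) in H; auto.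
  replace (c * (y / c)) with y in H by (field; lra). auto.
Qed.

Lemma pos_min2 a b : 0 < a -> 0 < b -> exists e, 0 < e /\ e <= a /\ e <= b.
Proof. intros Ha Hb. exists (Rmin a b). repeat split; [apply Rmin_pos; auto|apply Rmin_l|apply Rmin_r]. Qed.

Lemma pos_min3 a b c : 0 < a -> 0 < b -> 0 < c -> exists e, 0 < e /\ e <= a /\ e <= b /\ e <= c.
Proof.
  intros Ha Hb Hc. destruct (pos_min2 b c Hb Hc) as [e [He [H1 H2]]].
  destruct (pos_min2 a e Ha He) as [e' [He' H']]. exists e'. lra.
Qed.

Lemma Rabs_bounds x C : Rabs x <= C -> - C <= x <= C.
Proof. intros H. pose proof (Rle_abs x). pose proof (Rle_abs (- x)). rewrite Rabs_Ropp in *. lra. Qed.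

Lemma bounded_subseq (u : nat -> R) C :
  (forall n, Rabs (u n) <= C) ->
  exists l phi, (forall n, (phi n < phi (S n))%nat) /\
    forall n, Rabs (u (phi n) - l) < / INR (S n).
Proof.
  intros Hu.
  destruct (Bolzano_Weierstrass u (fun x => - C <= x <= C)) as [l Hl].
  { apply compact_P3. }
  { intros n. specialize (Hu n). apply Rabs_bounds in Hu. lra. }
  exists l.
  assert (Hex : forall n N : nat, exists p, (N < p)%nat /\ Rabs (u p - l) < / INR (S n)).
  { intros n N. assert (P : 0 < / INR (S n)) by (apply Rinv_0_lt_compat, lt_0_INR; lia).
    destruct (Hl (fun x => Rabs (x - l) < / INR (S n)) (S N)) as [p [Hp Hup]].
    - exists (mkposreal _ P). intros y Hy. exact Hy.
    - exists p. split; [lia|auto]. }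
  pose (step := fun n N => proj1_sig (constructive_indefinite_description _ (Hex n N))).
  pose (phi := fix phi n := match n with O => step O O | S k => step (S k) (phi k) end).
  assert (Hs : forall n N, (N < step n N)%nat /\ Rabs (u (step n N) - l) < / INR (S n))
    by (intros n N; exact (proj2_sig (constructive_indefinite_description _ (Hex n N)))).
  exists phi. split.
  - intros n. apply (Hs (S n) (phi n)).
  - intros n. destruct n; [apply (Hs O O)|apply (Hs (S n) (phi n))].
Qed.

Lemma Rabs_tri_minus a b c : Rabs (a - c) <= Rabs (a - b) + Rabs (b - c).
Proof. replace (a - c) with ((a - b) + (b - c)) by ring. apply Rabs_triang. Qed.

Lemma inv_INR_pos n : 0 < / INR (S n).
Proof. apply Rinv_0_lt_compat, lt_0_INR; lia. Qed.

Lemma inv_INR_le1 n : / INR (S n) <= 1.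
Proof. rewrite <- Rinv_1. apply Rinv_le_contravar; [lra|]. apply (le_INR 1). lia. Qed.

Lemma inv_INR_small eps : 0 < eps -> exists N, forall n, (N <= n)%nat -> / INR (S n) < eps.
Proof.
  intros He. destruct (archimed_cor1 eps He) as [N [HN HN0]]. exists N. intros n Hn.
  apply Rle_lt_trans with (/ INR N); auto. apply Rinv_le_contravar; [apply lt_0_INR; lia|].
  apply le_INR. lia.
Qed.

Definition vcv (u : nat -> vec) (l : vec) : Prop :=
  forall eps, 0 < eps -> exists N, forall n, (N <= n)%nat -> dist (u n) l < eps.

Lemma bounded_vsubseq (u : nat -> vec) C :
  (forall n, n1 (u n) <= C) ->
  exists l phi, (forall n, (phi n < phi (S n))%nat) /\ vcv (fun n => u (phi n)) l.
Proof.
  intros Hu.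
  destruct (bounded_subseq (fun n => fst (u n)) C) as [l1 [p1 [M1 H1]]].
  { intros n. specialize (Hu n). unfold n1 in Hu. rpos (snd (u n)). lra. }
  destruct (bounded_subseq (fun n => snd (u (p1 n))) C) as [l2 [p2 [M2 H2]]].
  { intros n. specialize (Hu (p1 n)). unfold n1 in Hu. rpos (fst (u (p1 n))). lra. }
  exists (l1, l2), (fun n => p1 (p2 n)). split.
  { intros n. apply subseq_lt; auto. }
  intros eps He. destruct (inv_INR_small (eps / 2)) as [N HN]; [lra|].
  exists N. intros n Hn. unfold dist, n1, vsub; simpl.
  pose proof (H2 n) as E2. pose proof (H1 (p2 n)) as E1. cbv beta in *.
  pose proof (HN n Hn). pose proof (HN (p2 n)) as E3.
  pose proof (subseq_mono p2 M2 n). specialize (E3 ltac:(lia)). lra.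
Qed.

Lemma vcv_subseq u l phi :
  (forall n, (phi n < phi (S n))%nat) -> vcv u l -> vcv (fun n => u (phi n)) l.
Proof.
  intros M H eps He. destruct (H eps He) as [N HN]. exists N. intros n Hn. apply HN.
  pose proof (subseq_mono phi M n). lia.
Qed.

Lemma pow_small q C eps : 0 <= q < 1 -> 0 < eps ->
  exists N, forall n, (N <= n)%nat -> C * q ^ n < eps.
Proof.
  intros Hq He.
  destruct (pow_lt_1_zero q ltac:(rewrite Rabs_pos_eq; lra) (eps / (Rabs C + 1))) as [N HN].
  { apply Rdiv_lt_0_compat; auto. rpos C. lra. }
  exists N. intros n Hn. specialize (HN n Hn).
  pose proof (pow_le q n (proj1 Hq)) as P. rewrite Rabs_pos_eq in HN by auto.
  rpos C. pose proof (Rle_abs C).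
  apply Rle_lt_trans with ((Rabs C + 1) * q ^ n); [nra|].
  apply Rmult_lt_reg_l with (/ (Rabs C + 1)); [apply Rinv_0_lt_compat; lra|].
  replace (/ (Rabs C + 1) * ((Rabs C + 1) * q ^ n)) with (q ^ n) by (field; lra).
  unfold Rdiv in HN. lra.
Qed.

Lemma vcauchy_cv (u : nat -> vec) :
  (forall eps, 0 < eps -> exists N, forall n k, (N <= n)%nat -> (N <= k)%nat -> dist (u n) (u k) < eps) ->
  exists l, vcv u l.
Proof.
  intros H.
  destruct (R_complete (fun n => fst (u n))) as [l1 H1].
  { intros eps He. destruct (H eps He) as [N HN]. exists N. intros n k Hn Hk.
    specialize (HN n k Hn Hk). unfold dist, n1, vsub in HN; simpl in HN.
    unfold Rdist. rpos (snd (u n) - snd (u k)). lra. }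
  destruct (R_complete (fun n => snd (u n))) as [l2 H2].
  { intros eps He. destruct (H eps He) as [N HN]. exists N. intros n k Hn Hk.
    specialize (HN n k Hn Hk). unfold dist, n1, vsub in HN; simpl in HN.
    unfold Rdist. rpos (fst (u n) - fst (u k)). lra. }
  exists (l1, l2). intros eps He.
  destruct (H1 (eps / 2)) as [N1 E1]; [lra|]. destruct (H2 (eps / 2)) as [N2 E2]; [lra|].
  exists (N1 + N2)%nat. intros n Hn. specialize (E1 n ltac:(lia)). specialize (E2 n ltac:(lia)).
  unfold Rdist in *. unfold dist, n1, vsub; simpl. lra.
Qed.

Lemma geom_cauchy (u : nat -> vec) C :
  (forall n, dist (u (S n)) (u n) <= C * (/ 2) ^ n) ->
  exists l, vcv u l /\ forall n, dist l (u n) <= 2 * C * (/ 2) ^ n.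
Proof.
  intros H.
  assert (B : forall n k, dist (u (n + k)%nat) (u n) <= 2 * C * ((/ 2) ^ n - (/ 2) ^ (n + k))).
  { intros n k. induction k.
    - rewrite Nat.add_0_r, dist_refl. lra.
    - pose proof (dist_tri (u (n + S k)%nat) (u (n + k)%nat) (u n)).
      pose proof (H (n + k)%nat). rewrite Nat.add_succ_r in *. simpl in *. lra. }
  assert (C0 : 0 <= C).
  { pose proof (H 0%nat) as H0. pose proof (dist_pos (u 1%nat) (u 0%nat)). simpl in H0. lra. }
  assert (B' : forall n k, dist (u (n + k)%nat) (u n) <= 2 * C * (/ 2) ^ n).
  { intros n k. specialize (B n k). pose proof (pow_le (/ 2) (n + k) ltac:(lra)). nra. }
  destruct (vcauchy_cv u) as [l Hl].
  { intros eps He. destruct (pow_small (/ 2) (4 * C) eps) as [N HN]; [lra|auto|].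
    exists N. intros n k Hn Hk.
    pose proof (dist_tri (u n) (u N) (u k)). rewrite (dist_sym (u N)) in H0.
    pose proof (B' N (n - N)%nat). pose proof (B' N (k - N)%nat).
    replace (N + (n - N))%nat with n in * by lia. replace (N + (k - N))%nat with k in * by lia.
    specialize (HN N (Nat.le_refl N)). lra. }
  exists l. split; auto. intros n. apply Rnot_lt_le. intros L.
  destruct (Hl (dist l (u n) - 2 * C * (/ 2) ^ n)) as [N HN]; [lra|].
  specialize (HN (n + N)%nat ltac:(lia)). specialize (B' n N).
  pose proof (dist_tri l (u (n + N)%nat) (u n)). rewrite (dist_sym l (u (n + N)%nat)) in *. lra.
Qed.

(** The closed predicate [P] stands for a complete metric space: it will be a ball of the plane for
    repellers and an arc of a level set for saddles. *)
Lemma banach (P : vec -> Prop) (f : vec -> vec) :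
  (exists z, P z) ->
  (forall z, (forall eps, 0 < eps -> exists z', P z' /\ dist z' z < eps) -> P z) ->
  (forall z, P z -> P (f z)) ->
  (forall x y, P x -> P y -> dist (f x) (f y) <= / 2 * dist x y) ->
  exists z, P z /\ f z = z.
Proof.
  intros [z0 P0] Hcl Hst Hc.
  pose (u := fun n => iter n f z0).
  assert (Pu : forall n, P (u n)) by (intros n; induction n; [exact P0|apply Hst; auto]).
  destruct (geom_cauchy u (dist (f z0) z0)) as [l [Hl _]].
  { intros n. induction n.
    - simpl. lra.
    - change (u (S (S n))) with (f (u (S n))). change (u (S n)) with (f (u n)) at 2.
      pose proof (Hc _ _ (Pu (S n)) (Pu n)). simpl pow. lra. }
  assert (Pl : P l).
  { apply Hcl. intros eps He. destruct (Hl eps He) as [N HN]. exists (u N). split; auto. }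
  exists l. split; auto. apply dist_small_eq. intros eps He.
  destruct (Hl (eps / 2)) as [N HN]; [lra|].
  pose proof (Hc _ _ Pl (Pu N)). pose proof (dist_tri (f l) (f (u N)) l).
  rewrite (dist_sym l) in *. pose proof (dist_pos (u N) l).
  pose proof (HN N (Nat.le_refl N)). pose proof (HN (S N) ltac:(lia)) as E2.
  change (u (S N)) with (f (u N)) in E2. lra.
Qed.

(** * One real variable *)

Lemma continuity_eps (f : R -> R) :
  (forall s eps, 0 < eps -> exists delta, 0 < delta /\
     forall t, Rabs (t - s) < delta -> Rabs (f t - f s) < eps) -> continuity f.
Proof.
  intros H s eps He. destruct (H s eps He) as [d [Hd Hf]]. exists d. split; auto.
  intros x [_ Hx]. apply Hf. exact Hx.
Qed.

Lemma ivt_gen (f : R -> R) a b c : continuity f -> a <= b ->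
  (f a - c) * (f b - c) <= 0 -> exists t, a <= t <= b /\ f t = c.
Proof.
  intros Hf Hab Hs. destruct (IVT_cor (fun t => f t - c) a b) as [t [Ht E]]; auto.
  { intros x. apply continuity_pt_minus; [apply Hf|apply continuity_pt_const].
    intros u v; auto. }
  exists t. split; auto. lra.
Qed.

(** If [f b] were extreme among the three values, the intermediate value theorem would make [f] take
    the nearer outer value a second time, on the other side of [b]. *)
Lemma injective_between (f : R -> R) a b c : continuity f ->
  (forall x y, f x = f y -> x = y) -> a < b < c ->
  (f a < f b < f c) \/ (f c < f b < f a).
Proof.
  intros Hf Hi H.
  assert (f a <> f b) by (intros E; apply Hi in E; lra).
  assert (f b <> f c) by (intros E; apply Hi in E; lra).
  assert (f a <> f c) by (intros E; apply Hi in E; lra).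
  destruct (Rtotal_order (f a) (f b)) as [L1|[L1|L1]]; [|tauto|];
  (destruct (Rtotal_order (f b) (f c)) as [L2|[L2|L2]]; [|tauto|]); try tauto; exfalso.
  - destruct (Rtotal_order (f a) (f c)) as [L3|[L3|L3]]; [|tauto|].
    + destruct (ivt_gen f a b (f c)) as [t [Ht E]]; auto; [lra|nra|]. apply Hi in E. lra.
    + destruct (ivt_gen f b c (f a)) as [t [Ht E]]; auto; [lra|nra|]. apply Hi in E. lra.
  - destruct (Rtotal_order (f a) (f c)) as [L3|[L3|L3]]; [|tauto|].
    + destruct (ivt_gen f b c (f a)) as [t [Ht E]]; auto; [lra|nra|]. apply Hi in E. lra.
    + destruct (ivt_gen f a b (f c)) as [t [Ht E]]; auto; [lra|nra|]. apply Hi in E. lra.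
Qed.

Lemma injective_between' (f : R -> R) a b c : continuity f ->
  (forall x y, f x = f y -> x = y) -> (a < b < c \/ c < b < a) ->
  (f a < f b < f c) \/ (f c < f b < f a).
Proof.
  intros Hf Hi [H|H]; [|apply or_comm]; apply injective_between; auto.
Qed.

Lemma floor_ex x : exists k : Z, IZR k <= x < IZR k + 1.
Proof.
  exists (up x - 1)%Z. rewrite minus_IZR. pose proof (archimed x). lra.
Qed.

(** By compactness two of the numbers [n rho] modulo 1 are within [delta]. Their difference [tau] is
    non-zero by irrationality, and its multiples form a progression of step less than [delta]. *)
Lemma irrational_dense rho : irrational rho -> forall s delta k0, 0 < delta ->
  exists (k : nat) (l : Z), (k0 <= k)%nat /\ Rabs (s - INR k * rho - IZR l) < delta.
Proof.
  intros Hirr s delta k0 Hd.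
  assert (Hfl : forall n : nat, exists z : Z, IZR z <= INR n * rho < IZR z + 1)
    by (intros; apply floor_ex).
  destruct (nat_choice _ Hfl) as [fl Hf].
  destruct (bounded_subseq (fun n => INR n * rho - IZR (fl n)) 1) as [l [phi [Mphi Hphi]]].
  { intros n. specialize (Hf n). apply Rabs_le. lra. }
  destruct (inv_INR_small (delta / 2)) as [N HN]; [lra|].
  pose proof (Hphi N) as E1. pose proof (Hphi (S N)) as E2. cbv beta in *.
  pose proof (HN N ltac:(lia)). pose proof (HN (S N) ltac:(lia)).
  specialize (Mphi N). set (k1 := phi N) in *. set (k2 := phi (S N)) in *.
  pose (tau := (INR k2 * rho - IZR (fl k2)) - (INR k1 * rho - IZR (fl k1))).
  assert (Htau : Rabs tau < delta).
  { pose proof (Rabs_tri_minus (INR k2 * rho - IZR (fl k2)) l (INR k1 * rho - IZR (fl k1))).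
    rewrite (Rabs_minus_sym l) in *. unfold tau. lra. }
  assert (Hq : tau = INR (k2 - k1) * rho - IZR (fl k2 - fl k1)).
  { unfold tau. rewrite minus_INR, minus_IZR by lia. ring. }
  assert (Htau0 : tau <> 0).
  { intros E. apply (Hirr (fl k2 - fl k1)%Z (Z.of_nat (k2 - k1))); [lia|].
    rewrite <- INR_IZR_INZ. lra. }
  set (q := (k2 - k1)%nat) in *. assert (1 <= q)%nat by lia.
  (* Adding an integer [e] to [s] does not matter modulo 1 and makes the number of steps of size
     [tau] as large as wanted, whatever the sign of [tau]. *)
  assert (He : exists e : Z, INR k0 + 1 <= (s + IZR e) / tau).
  { destruct (Rlt_or_le 0 tau) as [Hp|Hn].
    - exists (up (tau * (INR k0 + 1) - s)).
      pose proof (archimed (tau * (INR k0 + 1) - s)).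
      apply Rmult_le_reg_r with tau; auto. unfold Rdiv. rewrite Rmult_assoc, Rinv_l by lra. lra.
    - exists (- up (- tau * (INR k0 + 1) + s))%Z. rewrite opp_IZR.
      pose proof (archimed (- tau * (INR k0 + 1) + s)).
      apply Rmult_le_reg_r with (- tau); [lra|]. unfold Rdiv.
      replace ((s + - IZR (up (- tau * (INR k0 + 1) + s))) * / tau * - tau) with
        (- (s + - IZR (up (- tau * (INR k0 + 1) + s)))) by (field; lra). lra. }
  destruct He as [e He]. destruct (floor_ex ((s + IZR e) / tau)) as [j Hj].
  assert (Hj0 : (Z.of_nat k0 <= j)%Z).
  { apply le_IZR. rewrite <- INR_IZR_INZ. lra. }
  pose (jn := Z.to_nat j). assert (Ej : INR jn = IZR j).
  { unfold jn. rewrite INR_IZR_INZ, Z2Nat.id by lia. auto. }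
  exists (jn * q)%nat, (- e - j * (fl k2 - fl k1))%Z. split; [unfold jn; nia|].
  rewrite mult_INR, Ej, minus_IZR, opp_IZR, mult_IZR.
  replace (s - IZR j * INR q * rho - (- IZR e - IZR j * IZR (fl k2 - fl k1))) with
    (tau * ((s + IZR e) / tau - IZR j)) by (rewrite Hq; field; rewrite <- Hq; auto).
  rewrite Rabs_mult. rewrite (Rabs_pos_eq ((s + IZR e) / tau - IZR j)) by lra.
  pose proof (Rabs_pos_lt _ Htau0). nra.
Qed.

(** * Strong derivatives *)

(** Strict derivative: both points vary. This is what a [C^1] map provides, and it controls
    differences of two points of a level set, along which no derivative is known. *)
Definition sder (f : vec -> vec) (A : mat) (z : vec) : Prop :=
  forall eps, 0 < eps -> exists delta, 0 < delta /\
    forall x y, dist x z < delta -> dist y z < delta ->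
      n1 (vsub (vsub (f x) (f y)) (mv A (vsub x y))) <= eps * dist x y.

Lemma sder_lip f A z : sder f A z -> exists delta, 0 < delta /\
  forall x y, dist x z < delta -> dist y z < delta -> dist (f x) (f y) <= (mnorm A + 1) * dist x y.
Proof.
  intros H. destruct (H 1 ltac:(lra)) as [d [Hd H1]]. exists d. split; auto.
  intros x y Hx Hy. specialize (H1 x y Hx Hy).
  pose proof (n1_add (vsub (vsub (f x) (f y)) (mv A (vsub x y))) (mv A (vsub x y))) as T.
  replace (vadd (vsub (vsub (f x) (f y)) (mv A (vsub x y))) (mv A (vsub x y)))
    with (vsub (f x) (f y)) in T by vring.
  pose proof (mv_le A (vsub x y)). unfold dist in *. lra.
Qed.

Lemma sder_id z : sder (fun x => x) mid z.
Proof.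
  intros eps He. exists 1. split; [lra|]. intros x y _ _.
  replace (vsub (vsub x y) (mv mid (vsub x y))) with zero.
  - rewrite n1_zero. pose proof (dist_pos x y). nra.
  - unfold mid. vring.
Qed.

Lemma sder_comp f g A B z : sder f A z -> sder g B (f z) -> sder (fun x => g (f x)) (mmul B A) z.
Proof.
  intros Hf Hg eps He. pose proof (mnorm_pos A). pose proof (mnorm_pos B).
  destruct (sder_lip _ _ _ Hf) as [d1 [Hd1 L1]].
  destruct (Hg (eps / (2 * (mnorm A + 1)))) as [d2 [Hd2 G2]].
  { apply Rdiv_lt_0_compat; lra. }
  destruct (Hf (eps / (2 * (mnorm B + 1)))) as [d3 [Hd3 F3]].
  { apply Rdiv_lt_0_compat; lra. }
  assert (Hp : 0 < d2 / (mnorm A + 1)) by (apply Rdiv_lt_0_compat; lra).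
  destruct (pos_min3 d1 d3 _ Hd1 Hd3 Hp) as [e [He' He3]].
  exists e. split; auto. intros x y Hx Hy.
  assert (Hm : forall x, dist x z < e -> dist x z < d1 /\ dist x z < d3 /\ dist x z < d2 / (mnorm A + 1))
    by (intros; lra).
  apply Hm in Hx. apply Hm in Hy.
  assert (Hz : dist z z < d1) by (rewrite dist_refl; auto).
  assert (Hnear : forall t, dist t z < d1 -> dist t z < d2 / (mnorm A + 1) -> dist (f t) (f z) < d2).
  { intros t Ht Ht'. specialize (L1 t z Ht Hz).
    apply mul_lt_of_lt_div in Ht'; [|lra]. lra. }
  specialize (G2 (f x) (f y) (Hnear x (proj1 Hx) (proj2 (proj2 Hx))) (Hnear y (proj1 Hy) (proj2 (proj2 Hy)))).
  specialize (F3 x y (proj1 (proj2 Hx)) (proj1 (proj2 Hy))).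
  specialize (L1 x y (proj1 Hx) (proj1 Hy)).
  rewrite mv_mmul.
  replace (vsub (vsub (g (f x)) (g (f y))) (mv B (mv A (vsub x y)))) with
    (vadd (vsub (vsub (g (f x)) (g (f y))) (mv B (vsub (f x) (f y))))
          (mv B (vsub (vsub (f x) (f y)) (mv A (vsub x y))))) by vring.
  pose proof (n1_add (vsub (vsub (g (f x)) (g (f y))) (mv B (vsub (f x) (f y))))
          (mv B (vsub (vsub (f x) (f y)) (mv A (vsub x y))))).
  pose proof (mv_le B (vsub (vsub (f x) (f y)) (mv A (vsub x y)))).
  pose proof (dist_pos x y).
  assert (eps / (2 * (mnorm A + 1)) * dist (f x) (f y) <= eps / 2 * dist x y).
  { apply Rle_trans with (eps / (2 * (mnorm A + 1)) * ((mnorm A + 1) * dist x y)).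
    - apply Rmult_le_compat_l; auto. apply Rlt_le, Rdiv_lt_0_compat; lra.
    - right. field. lra. }
  assert (mnorm B * n1 (vsub (vsub (f x) (f y)) (mv A (vsub x y))) <= eps / 2 * dist x y).
  { apply Rle_trans with ((mnorm B + 1) * (eps / (2 * (mnorm B + 1)) * dist x y)).
    - npos (vsub (vsub (f x) (f y)) (mv A (vsub x y))). nra.
    - right. field. lra. }
  lra.
Qed.

(** * Cone coordinates and level sets *)

Lemma iter_cancel (f g : vec -> vec) : (forall z, f (g z) = z) ->
  forall n z, iter n f (iter n g z) = z.
Proof.
  intros H n. induction n; intros z; [reflexivity|].
  rewrite (Nat.iter_succ_r n _ g), Nat.iter_succ, IHn. apply H.
Qed.

Lemma iter_cancel_le (f g : vec -> vec) : (forall z, f (g z) = z) ->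
  forall n k z, (n <= k)%nat -> iter n f (iter k g z) = iter (k - n) g z.
Proof.
  intros H n k z L.
  assert (E : iter k g z = iter n g (iter (k - n) g z))
    by (rewrite <- Nat.iter_add; f_equal; lia).
  rewrite E. apply iter_cancel; auto.
Qed.

(* For the cone system, [dot pA] is [cone_a] and [Rabs (dot pB v)] is [vnorm (cone_b v)]. *)
Section Coordinates.
Variables pA pB : vec.
Variable alpha : R.
Hypothesis alpha_pos : 0 < alpha.
Hypothesis coord_indep : fst pA * snd pB - snd pA * fst pB <> 0.

Local Notation A := (dot pA).
Local Notation B := (dot pB).

Definition in_cone (v : vec) : Prop := Rabs (B v) <= alpha * Rabs (A v).

Definition of_coord (a b : R) : vec :=
  ((snd pB * a - snd pA * b) / (fst pA * snd pB - snd pA * fst pB),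
   (fst pA * b - fst pB * a) / (fst pA * snd pB - snd pA * fst pB)).

(** Bound for the inverse of the coordinate change. The extra factor in [ccst] absorbs the smaller
    coordinate: at most [alpha] times the other in the cone, at most [/ alpha] times it outside. *)
Definition ccst0 : R := (n1 pA + n1 pB) / Rabs (fst pA * snd pB - snd pA * fst pB).
Definition ccst : R := ccst0 * (1 + alpha + / alpha).

Lemma ccst0_pos : 0 < ccst0.
Proof.
  apply Rdiv_lt_0_compat; [|apply Rabs_pos_lt; auto].
  assert (H : pA <> zero) by (intros E; rewrite E in coord_indep; simpl in coord_indep; lra).
  pose proof (n1_gt0 pA H). npos pB. lra.
Qed.

Lemma coord_A a b : A (of_coord a b) = a.
Proof. unfold of_coord, dot; simpl. field. auto. Qed.

Lemma coord_B a b : B (of_coord a b) = b.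
Proof. unfold of_coord, dot; simpl. field. auto. Qed.

Lemma of_coord_AB v : of_coord (A v) (B v) = v.
Proof. unfold of_coord, dot. apply injective_projections; simpl; field; auto. Qed.

Lemma coord_ext u v : A u = A v -> B u = B v -> u = v.
Proof. intros H1 H2. rewrite <- (of_coord_AB u), <- (of_coord_AB v), H1, H2. auto. Qed.

Lemma n1_coord v :
  n1 v <= ccst0 * (Rabs (A v) + Rabs (B v)).
Proof.
  rewrite <- (of_coord_AB v) at 1. pose proof (Rabs_pos_lt _ coord_indep) as P.
  set (dt := fst pA * snd pB - snd pA * fst pB) in *.
  unfold ccst0, of_coord. fold dt. unfold n1 at 1; simpl. unfold Rdiv.
  rewrite !Rabs_mult, Rabs_inv.
  assert (E1 : Rabs (snd pB * A v - snd pA * B v) <= Rabs (snd pB) * Rabs (A v) + Rabs (snd pA) * Rabs (B v)).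
  { unfold Rminus. eapply Rle_trans; [apply Rabs_triang|]. rewrite Rabs_Ropp, !Rabs_mult. lra. }
  assert (E2 : Rabs (fst pA * B v - fst pB * A v) <= Rabs (fst pA) * Rabs (B v) + Rabs (fst pB) * Rabs (A v)).
  { unfold Rminus. eapply Rle_trans; [apply Rabs_triang|]. rewrite Rabs_Ropp, !Rabs_mult. lra. }
  pose proof (Rinv_0_lt_compat _ P) as Pi. rewrite <- Rmult_plus_distr_r.
  replace ((n1 pA + n1 pB) * / Rabs dt * (Rabs (A v) + Rabs (B v))) with
    ((n1 pA + n1 pB) * (Rabs (A v) + Rabs (B v)) * / Rabs dt) by ring.
  apply Rmult_le_compat_r; [lra|]. unfold n1.
  rpos (fst pA); rpos (snd pA); rpos (fst pB);
  rpos (snd pB); rpos (A v); rpos (B v). nra.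
Qed.

Lemma ccst_pos : 0 < ccst.
Proof. apply Rmult_lt_0_compat; [apply ccst0_pos|]. pose proof (Rinv_0_lt_compat _ alpha_pos). lra. Qed.

Lemma in_cone_bound v : in_cone v -> n1 v <= ccst * Rabs (A v).
Proof.
  unfold in_cone, ccst. intros H. pose proof (Rinv_0_lt_compat _ alpha_pos). pose proof ccst0_pos.
  eapply Rle_trans; [apply n1_coord|]. rewrite Rmult_assoc. apply Rmult_le_compat_l; [lra|].
  rpos (A v). nra.
Qed.

Lemma out_cone_bound v : alpha * Rabs (A v) <= Rabs (B v) -> n1 v <= ccst * Rabs (B v).
Proof.
  unfold ccst. intros H. pose proof (Rinv_0_lt_compat _ alpha_pos). pose proof ccst0_pos.
  eapply Rle_trans; [apply n1_coord|]. rewrite Rmult_assoc. apply Rmult_le_compat_l; [lra|].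
  rpos (B v). assert (Rabs (A v) <= / alpha * Rabs (B v)); [|nra].
  apply Rmult_le_reg_l with alpha; auto. rewrite <- Rmult_assoc, Rinv_r by lra. lra.
Qed.

Lemma in_cone_closed v :
  (forall eps, 0 < eps -> exists v', in_cone v' /\ n1 (vsub v' v) < eps) -> in_cone v.
Proof.
  intros H. unfold in_cone. apply Rnot_lt_le. intros L.
  set (gap := Rabs (B v) - alpha * Rabs (A v)).
  (* A Lipschitz constant of [|B| - alpha |A|], increased by 1 to be positive. *)
  set (q := n1 pB + alpha * n1 pA + 1).
  assert (Q : 0 < q) by (unfold q; npos pA; npos pB; nra).
  destruct (H (gap / q)) as [v' [Hv' Hd]]. { apply Rdiv_lt_0_compat; auto. unfold gap. lra. }
  unfold in_cone in Hv'. pose proof (dot_dist pA v' v) as EA. pose proof (dot_dist pB v' v) as EB.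
  unfold dist in *. npos (vsub v' v).
  assert (q * n1 (vsub v' v) < gap).
  { apply mul_lt_of_lt_div in Hd; [|lra]. auto. }
  pose proof (Rabs_triang_inv (B v) (B v')). pose proof (Rabs_triang_inv (A v') (A v)).
  rewrite (Rabs_minus_sym (B v)) in *. unfold q, gap in *. nra.
Qed.

(* [h] is the expanding coordinate; its level sets are graphs over [B]. *)
Section Leaves.
Variable h : vec -> R.
Variable Ch : R.
Hypothesis h_cont : forall z eps, 0 < eps ->
  exists delta, 0 < delta /\ forall x, dist x z < delta -> Rabs (h x - h z) < eps.
Hypothesis h_near : forall z, Rabs (h z - A z) <= Ch.
Hypothesis h_inj : forall x y, in_cone (vsub x y) -> h x = h y -> x = y.

(** [h_inj] excludes a non-zero difference in the cone; for equal points both sides vanish. *)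
Lemma leaf_out x y : h x = h y -> alpha * Rabs (A (vsub x y)) <= Rabs (B (vsub x y)).
Proof.
  intros E. destruct (Rle_or_lt (alpha * Rabs (A (vsub x y))) (Rabs (B (vsub x y)))); auto.
  assert (x = y) as -> by (apply h_inj; auto; unfold in_cone; lra).
  replace (vsub y y) with zero by vring. unfold dot, zero; simpl.
  rewrite !Rmult_0_r, Rplus_0_l, Rabs_R0. lra.
Qed.

Lemma leaf_dist x y : h x = h y -> dist x y <= ccst * Rabs (B x - B y).
Proof. intros E. rewrite <- dot_sub. apply out_cone_bound, leaf_out; auto. Qed.

Lemma leaf_eq x y : h x = h y -> B x = B y -> x = y.
Proof.
  intros E1 E2. apply h_inj; auto. unfold in_cone. rewrite dot_sub, E2, Rminus_diag, Rabs_R0.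
  rpos (A (vsub x y)). nra.
Qed.

Lemma of_coord_dist a b a' b' :
  dist (of_coord a b) (of_coord a' b') <=
  ccst0 * (Rabs (a - a') + Rabs (b - b')).
Proof.
  unfold dist. eapply Rle_trans; [apply n1_coord|].
  rewrite !dot_sub, !coord_A, !coord_B. lra.
Qed.

(** On the line [B = b] the function [h] stays within [Ch] of the coordinate [A], so it passes
    through [c] between [A = c - Ch] and [A = c + Ch]. *)
Lemma leafpt_ex c b : exists z, h z = c /\ B z = b.
Proof.
  set (q := ccst0). assert (Q : 0 < q) by apply ccst0_pos.
  assert (Ch0 : 0 <= Ch) by (pose proof (h_near zero); rpos (h zero - A zero); lra).
  destruct (ivt_gen (fun t => h (of_coord t b)) (c - Ch) (c + Ch) c) as [t [_ Ht]].
  - apply continuity_eps. intros s eps He. destruct (h_cont (of_coord s b) eps He) as [d [Hd Hh]].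
    exists (d / (q + 1)). split. { apply Rdiv_lt_0_compat; lra. }
    intros t Ht. apply Hh. eapply Rle_lt_trans; [apply of_coord_dist|]. fold q.
    rewrite Rminus_diag, Rabs_R0, Rplus_0_r. rpos (t - s).
    apply mul_lt_of_lt_div in Ht; [|lra]. nra.
  - lra.
  - pose proof (h_near (of_coord (c - Ch) b)) as E1. pose proof (h_near (of_coord (c + Ch) b)) as E2.
    rewrite coord_A in *. apply Rabs_bounds in E1, E2. nra.
  - exists (of_coord t b). rewrite coord_B. auto.
Qed.

(** Chart of the level [c] by the coordinate [B]; [h_inj] makes the chosen point unique. *)
Definition leafpt (c b : R) : vec := epsilon (inhabits zero) (fun z => h z = c /\ B z = b).

Lemma leafpt_h c b : h (leafpt c b) = c.
Proof. exact (proj1 (epsilon_spec (inhabits zero) _ (leafpt_ex c b))). Qed.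

Lemma leafpt_B c b : B (leafpt c b) = b.
Proof. exact (proj2 (epsilon_spec (inhabits zero) _ (leafpt_ex c b))). Qed.

Lemma leafpt_of z : leafpt (h z) (B z) = z.
Proof. apply leaf_eq; [apply leafpt_h|apply leafpt_B]. Qed.

Lemma leafpt_dist c b b' : dist (leafpt c b) (leafpt c b') <= ccst * Rabs (b - b').
Proof.
  eapply Rle_trans; [apply leaf_dist; rewrite !leafpt_h; auto|]. rewrite !leafpt_B. lra.
Qed.

Lemma h_vcv u l : vcv u l -> Un_cv (fun n => h (u n)) (h l).
Proof.
  intros H eps He. destruct (h_cont l eps He) as [d [Hd Hh]]. destruct (H d Hd) as [N HN].
  exists N. intros n Hn. apply Hh, HN. lia.
Qed.

Lemma cone_level_bound x q : in_cone (vsub x q) -> dist x q <= ccst * (Rabs (h x - h q) + 2 * Ch).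
Proof.
  intros H. apply in_cone_bound in H. unfold dist. rewrite dot_sub in H.
  eapply Rle_trans; [apply H|]. apply Rmult_le_compat_l; [apply Rlt_le, ccst_pos|].
  pose proof (h_near x) as E1. pose proof (h_near q) as E2.
  pose proof (Rabs_tri_minus (A x) (h x) (A q)). pose proof (Rabs_tri_minus (h x) (h q) (A q)).
  rewrite (Rabs_minus_sym (A x) (h x)) in *. lra.
Qed.

(** Compactness makes [h_inj] quantitative: counterexamples with levels tending to that of [q] are
    bounded, and a limit lies in the cone of [q] at the same level, so it is [q]. *)
Lemma cone_level_close q eps : 0 < eps -> exists delta, 0 < delta /\
  forall x, in_cone (vsub x q) -> Rabs (h x - h q) < delta -> dist x q < eps.
Proof.
  intros He. apply NNPP. intros Hno.
  assert (Hex : forall n : nat, exists x, in_cone (vsub x q) /\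
            Rabs (h x - h q) < / INR (S n) /\ eps <= dist x q).
  { intros n. apply NNPP. intros Hn. apply Hno. exists (/ INR (S n)). split; [apply inv_INR_pos|].
    intros x Hx Hhx. apply Rnot_le_lt. intros L. apply Hn. exists x; auto. }
  destruct (nat_choice _ Hex) as [u Hu].
  destruct (bounded_vsubseq u (ccst * (1 + 2 * Ch) + n1 q)) as [l [phi [Hphi Hl]]].
  { intros n. destruct (Hu n) as [H1 [H2 _]]. apply cone_level_bound in H1.
    pose proof (n1_add (vsub (u n) q) q) as T. replace (vadd (vsub (u n) q) q) with (u n) in T by vring.
    pose proof (inv_INR_le1 n).
    pose proof ccst_pos. unfold dist in *. nra. }
  assert (El : l = q).
  { apply h_inj.
    - apply in_cone_closed. intros e Hep. destruct (Hl e Hep) as [N HN].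
      exists (vsub (u (phi N)) q). split; [apply Hu|].
      specialize (HN N (Nat.le_refl N)). unfold dist in HN.
      replace (vsub (vsub (u (phi N)) q) (vsub l q)) with (vsub (u (phi N)) l) by vring. auto.
    - apply h_vcv in Hl. apply (UL_sequence _ _ _ Hl). intros e Hep.
      destruct (inv_INR_small e Hep) as [N HN]. exists N. intros n Hn.
      eapply Rlt_trans; [apply Hu|]. apply HN. pose proof (subseq_mono phi Hphi n). lia. }
  destruct (Hl eps He) as [N HN]. specialize (HN N (Nat.le_refl N)).
  rewrite El in HN. destruct (Hu (phi N)) as [_ [_ H3]]. lra.
Qed.

(** * Backward orbits of a cone-expanding homeomorphism *)

Section Backward.
(** To be instantiated with [F^n] followed by a lattice translation, its inverse, the rates [K^n]
    and [mu^n], and the level [h0] invariant under [T]. *)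
Variables T Tinv : vec -> vec.
Variables kappa mu h0 : R.
Hypothesis TTinv : forall z, T (Tinv z) = z.
Hypothesis TinvT : forall z, Tinv (T z) = z.
Hypothesis Tinv_cont : forall z eps, 0 < eps ->
  exists delta, 0 < delta /\ forall x, dist x z < delta -> dist (Tinv x) (Tinv z) < eps.
Hypothesis kappa_gt1 : 1 < kappa.
Hypothesis mu_gt1 : 1 < Rabs mu.
Hypothesis T_cone : forall x y, in_cone (vsub x y) ->
  in_cone (vsub (T x) (T y)) /\ kappa * Rabs (A (vsub x y)) <= Rabs (A (vsub (T x) (T y))).
Hypothesis T_level : forall z, h (T z) - h0 = mu * (h z - h0).
Hypothesis T_center : exists kappa1 delta, kappa1 < kappa /\ 0 < delta /\
  forall x y, dist x y < delta -> h x = h y -> vnorm (vsub (T x) (T y)) <= kappa1 * vnorm (vsub x y).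

Lemma Tn_cone n x y : in_cone (vsub x y) ->
  in_cone (vsub (iter n T x) (iter n T y)) /\
  kappa ^ n * Rabs (A (vsub x y)) <= Rabs (A (vsub (iter n T x) (iter n T y))).
Proof.
  intros H. induction n as [|n [IH1 IH2]]; simpl; [split; auto; lra|].
  destruct (T_cone _ _ IH1) as [H1 H2]. split; auto. nra.
Qed.

Lemma Tn_level n z : h (iter n T z) - h0 = mu ^ n * (h z - h0).
Proof. induction n; simpl; [ring|]. rewrite T_level, IHn. ring. Qed.

Lemma Tinvn_level n z : mu ^ n * (h (iter n Tinv z) - h0) = h z - h0.
Proof. rewrite <- Tn_level, iter_cancel; auto. Qed.

Lemma Tinvn_cont n z eps : 0 < eps -> exists delta, 0 < delta /\
  forall x, dist x z < delta -> dist (iter n Tinv x) (iter n Tinv z) < eps.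
Proof.
  revert eps. induction n; intros eps He; simpl.
  - exists eps; auto.
  - destruct (Tinv_cont (iter n Tinv z) eps He) as [d [Hd H1]].
    destruct (IHn d Hd) as [d' [Hd' H2]]. exists d'. split; auto.
Qed.

(* The point is a limit of [T^k y_k], where [y_k] has the transverse coordinate of [Tinv^k x]
   and lies on the [k]-th preimage of the level [c]. *)
Lemma unstable_ex x c :
  exists y, h y = c /\ forall n, in_cone (vsub (iter n Tinv x) (iter n Tinv y)).
Proof.
  assert (Hmu : mu <> 0) by (intros E; rewrite E, Rabs_R0 in mu_gt1; lra).
  pose (eta := fun k => leafpt (h0 + (c - h0) / mu ^ k) (B (iter k Tinv x))).
  pose (y := fun k => iter k T (eta k)).
  assert (Hy : forall k, h (y k) = c).
  { intros k. pose proof (Tn_level k (eta k)) as E. unfold eta in E at 2. rewrite leafpt_h in E.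
    replace (mu ^ k * (h0 + (c - h0) / mu ^ k - h0)) with (c - h0) in E
      by (field; apply pow_nonzero; auto). unfold y. lra. }
  assert (Hc : forall k n, (n <= k)%nat ->
            in_cone (vsub (iter n Tinv x) (iter n Tinv (y k)))).
  { intros k n L. unfold y. rewrite (iter_cancel_le Tinv T) by auto.
    replace (iter n Tinv x) with (iter (k - n) T (iter k Tinv x)).
    (* At time [-k] both points have the same [B], so their difference is trivially in the cone;
       [k - n] forward steps keep it there. *)
    - apply Tn_cone. unfold in_cone, eta. rewrite dot_sub, leafpt_B, Rminus_diag, Rabs_R0.
      rpos (A (vsub (iter k Tinv x) (eta k))). unfold eta in *. nra.
    - rewrite (iter_cancel_le T Tinv) by (auto; lia). f_equal. lia. }
  destruct (bounded_vsubseq y (ccst * (Rabs (h x - c) + 2 * Ch) + n1 x)) as [l [phi [Hphi Hl]]].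
  { intros k. pose proof (Hc k 0%nat (Nat.le_0_l k)) as H0. simpl in H0.
    apply cone_level_bound in H0. rewrite Hy in H0.
    pose proof (dist_sym x (y k)). pose proof (n1_add (vsub (y k) x) x) as T1.
    replace (vadd (vsub (y k) x) x) with (y k) in T1 by vring. unfold dist in *. lra. }
  exists l. split.
  - apply (UL_sequence (fun n => h (y (phi n)))).
    + apply (h_vcv (fun n => y (phi n))); auto.
    + intros e He. exists 0%nat. intros n _. rewrite Hy. unfold Rdist.
      rewrite Rminus_diag, Rabs_R0. auto.
  - intros n. apply in_cone_closed. intros e He.
    destruct (Tinvn_cont n l e He) as [d [Hd H1]]. destruct (Hl d Hd) as [N HN].
    exists (vsub (iter n Tinv x) (iter n Tinv (y (phi (N + n)%nat)))). split.
    + apply Hc. pose proof (subseq_mono phi Hphi (N + n)). lia.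
    + specialize (H1 _ (HN (N + n)%nat ltac:(lia))). rewrite dist_sym in H1. unfold dist in H1.
      match goal with |- n1 ?a < _ => replace a with
        (vsub (iter n Tinv l) (iter n Tinv (y (phi (N + n)%nat)))) by vring end. auto.
Qed.

(** The difference at time [-n] lies in the cone, so coming back to time 0 expands its [A]
    coordinate by at least [kappa^n]. *)
Lemma unstable_asym x y n :
  (forall n, in_cone (vsub (iter n Tinv x) (iter n Tinv y))) ->
  kappa ^ n * dist (iter n Tinv x) (iter n Tinv y) <= ccst * n1 pA * dist x y.
Proof.
  intros H. pose proof (Tn_cone n _ _ (H n)) as [_ H2]. rewrite !iter_cancel in H2 by auto.
  pose proof (in_cone_bound _ (H n)) as H3. pose proof (dot_le pA (vsub x y)).
  pose proof ccst_pos. assert (0 < kappa ^ n) by (apply pow_lt; lra). unfold dist.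
  apply Rle_trans with (kappa ^ n * (ccst * Rabs (A (vsub (iter n Tinv x) (iter n Tinv y))))).
  { apply Rmult_le_compat_l; auto; lra. }
  apply Rle_trans with (ccst * Rabs (A (vsub x y))); [nra|].
  rewrite Rmult_assoc. apply Rmult_le_compat_l; lra.
Qed.

Lemma asym_tendsto x y Cst eps : 0 < eps ->
  (forall n, kappa ^ n * dist (iter n Tinv x) (iter n Tinv y) <= Cst) ->
  exists N, forall n, (N <= n)%nat -> dist (iter n Tinv x) (iter n Tinv y) < eps.
Proof.
  intros He H. assert (Hk : 0 < / kappa < 1).
  { split; [apply Rinv_0_lt_compat; lra|]. rewrite <- Rinv_1. apply Rinv_lt_contravar; lra. }
  destruct (pow_small (/ kappa) Cst eps) as [N HN]; auto; [lra|].
  exists N. intros n Hn. specialize (HN n Hn). specialize (H n).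
  assert (P : 0 < kappa ^ n) by (apply pow_lt; lra). rewrite pow_inv in HN.
  eapply Rle_lt_trans; [|apply HN]. apply Rmult_le_reg_l with (kappa ^ n); auto.
  replace (kappa ^ n * (Cst * / kappa ^ n)) with Cst by (field; lra). auto.
Qed.

(* Along level sets [T] expands strictly less than [kappa]. *)
Lemma asym_level_eq x y Cst : h x = h y ->
  (forall n, kappa ^ n * dist (iter n Tinv x) (iter n Tinv y) <= Cst) -> x = y.
Proof.
  intros E H. destruct T_center as [k1 [d [Hk [Hd Hc]]]].
  destruct (asym_tendsto x y Cst d Hd H) as [N HN].
  (* [k1] carries no lower bound; raising it to at least [/ 2] makes its powers positive and keeps
     it below [kappa]. *)
  set (kp := Rmax k1 (/ 2)).
  assert (Hkp : / 2 <= kp < kappa /\ k1 <= kp).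
  { unfold kp. pose proof (Rmax_l k1 (/ 2)); pose proof (Rmax_r k1 (/ 2)).
    split; auto. split; auto. apply Rmax_lub_lt; lra. }
  set (xn := fun n => iter n Tinv x) in *. set (yn := fun n => iter n Tinv y) in *.
  assert (Hl : forall n, h (xn n) = h (yn n)).
  { intros n. pose proof (Tinvn_level n x) as E1. pose proof (Tinvn_level n y) as E2.
    fold (xn n) in E1. fold (yn n) in E2.
    assert (mu ^ n <> 0) by (apply pow_nonzero; intros E0; rewrite E0, Rabs_R0 in mu_gt1; lra).
    apply Rplus_eq_reg_r with (- h0). apply Rmult_eq_reg_l with (mu ^ n); auto.
    unfold Rminus in *. lra. }
  assert (Hstep : forall k, vnorm (vsub (xn N) (yn N)) <= kp ^ k * vnorm (vsub (xn (N + k)%nat) (yn (N + k)%nat))).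
  { induction k; [rewrite Nat.add_0_r; simpl; lra|].
    eapply Rle_trans; [apply IHk|].
    assert (T1 : forall z, T (iter (N + S k) Tinv z) = iter (N + k) Tinv z)
      by (intros z; rewrite Nat.add_succ_r; simpl; apply TTinv).
    pose proof (Hc (xn (N + S k)%nat) (yn (N + S k)%nat) (HN (N + S k)%nat ltac:(lia)) (Hl _)) as SS.
    unfold xn at 1, yn at 1 in SS. rewrite !T1 in SS. fold (xn (N + k)%nat) (yn (N + k)%nat) in SS.
    pose proof (vnorm_pos (vsub (xn (N + S k)%nat) (yn (N + S k)%nat))).
    assert (0 < kp ^ k) by (apply pow_lt; lra). simpl.
    apply Rle_trans with (kp ^ k * (k1 * vnorm (vsub (xn (N + S k)%nat) (yn (N + S k)%nat)))).
    - apply Rmult_le_compat_l; lra.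
    - replace (kp * kp ^ k * vnorm (vsub (xn (N + S k)%nat) (yn (N + S k)%nat))) with
        (kp ^ k * (kp * vnorm (vsub (xn (N + S k)%nat) (yn (N + S k)%nat)))) by ring.
      apply Rmult_le_compat_l; [lra|]. apply Rmult_le_compat_r; lra. }
  (* The distance at time [-N] is at most a constant times [kp^k] times the distance at time
     [-(N+k)], which is at most [Cst / kappa^k]; the product tends to 0. *)
  assert (EN : xn N = yn N).
  { apply dist_small_eq. intros eps He.
    assert (Hq : 0 <= kp / kappa < 1).
    { split; [apply Rmult_le_pos; [lra|apply Rlt_le, Rinv_0_lt_compat; lra]|].
      apply Rmult_lt_reg_r with kappa; [lra|]. unfold Rdiv. rewrite Rmult_assoc, Rinv_l; lra. }
    destruct (pow_small (kp / kappa) (2 * Cst) eps Hq He) as [k Hk'].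
    specialize (Hk' k (Nat.le_refl k)). specialize (Hstep k). specialize (H (N + k)%nat).
    fold (xn (N + k)%nat) (yn (N + k)%nat) in H.
    pose proof (vnorm_le_n1 (vsub (xn (N + k)%nat) (yn (N + k)%nat))) as V1.
    pose proof (n1_le_vnorm (vsub (xn N) (yn N))) as V2.
    fold (dist (xn (N + k)%nat) (yn (N + k)%nat)) in V1. fold (dist (xn N) (yn N)) in V2.
    assert (P : 0 < kappa ^ k) by (apply pow_lt; lra).
    assert (PN : 1 <= kappa ^ N) by (apply pow_R1_Rle; lra).
    assert (Pk : 0 < kp ^ k) by (apply pow_lt; lra).
    rewrite pow_add in H. pose proof (dist_pos (xn (N + k)%nat) (yn (N + k)%nat)) as D0.
    assert (D : dist (xn (N + k)%nat) (yn (N + k)%nat) <= Cst / kappa ^ k).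
    { apply Rmult_le_reg_l with (kappa ^ k); auto.
      replace (kappa ^ k * (Cst / kappa ^ k)) with Cst by (field; lra).
      pose proof (Rmult_le_pos _ _ (Rlt_le _ _ P) D0). nra. }
    unfold Rdiv in Hk'. rewrite Rpow_mult_distr, pow_inv in Hk'.
    eapply Rle_lt_trans; [|apply Hk'].
    apply Rle_trans with (2 * (kp ^ k * dist (xn (N + k)%nat) (yn (N + k)%nat))); [nra|].
    replace (2 * Cst * (kp ^ k * / kappa ^ k)) with (2 * (kp ^ k * (Cst / kappa ^ k))) by (unfold Rdiv; ring).
    apply Rmult_le_compat_l; [lra|]. apply Rmult_le_compat_l; lra. }
  rewrite <- (iter_cancel T Tinv TTinv N x), <- (iter_cancel T Tinv TTinv N y).
  fold (xn N) (yn N). rewrite EN. auto.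
Qed.

End Backward.
End Leaves.
End Coordinates.

(** * Lattice translations *)

Lemma lattice_add u v : lattice u -> lattice v -> lattice (vadd u v).
Proof.
  intros [a [b ->]] [c [d ->]]. exists (a + c)%Z, (b + d)%Z. unfold vadd; simpl.
  rewrite !plus_IZR. auto.
Qed.

Lemma lattice_scale_Z j u : lattice u -> lattice (vscale (IZR j) u).
Proof.
  intros [a [b ->]]. exists (j * a)%Z, (j * b)%Z. unfold vscale; simpl. rewrite !mult_IZR. auto.
Qed.

Lemma lattice_opp u : lattice u -> lattice (vscale (-1) u).
Proof. apply (lattice_scale_Z (-1)). Qed.

Lemma lattice_sub u v : lattice u -> lattice v -> lattice (vsub u v).
Proof.
  intros Hu Hv. replace (vsub u v) with (vadd u (vscale (-1) v)) by vring.
  apply lattice_add; auto. apply lattice_opp; auto.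
Qed.

Lemma eqT_add_lattice x k : lattice k -> eqT (vadd x k) x.
Proof. unfold eqT. intros H. replace (vsub (vadd x k) x) with k by vring. auto. Qed.

Lemma eqT_sub_lattice x k : lattice k -> eqT (vsub x k) x.
Proof.
  unfold eqT. intros H. replace (vsub (vsub x k) x) with (vscale (-1) k) by vring.
  apply lattice_opp; auto.
Qed.

Lemma eqT_refl x : eqT x x.
Proof. exists 0%Z, 0%Z. vring. Qed.

Lemma eqT_sym x y : eqT x y -> eqT y x.
Proof.
  unfold eqT. intros H. apply lattice_opp in H.
  replace (vscale (-1) (vsub x y)) with (vsub y x) in H by vring. auto.
Qed.

Lemma eqT_trans x y z : eqT x y -> eqT y z -> eqT x z.
Proof.
  unfold eqT. intros H1 H2. replace (vsub x z) with (vadd (vsub x y) (vsub y z)) by vring.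
  apply lattice_add; auto.
Qed.

Lemma eqT_ex x y : eqT x y -> exists k, lattice k /\ x = vadd y k.
Proof. intros H. exists (vsub x y). split; auto. vring. Qed.

Lemma lattice_reduce z : exists k, lattice k /\ n1 (vsub z k) <= 2.
Proof.
  destruct (floor_ex (fst z)) as [a Ha]. destruct (floor_ex (snd z)) as [b Hb].
  exists (IZR a, IZR b). split; [exists a, b; auto|].
  unfold n1, vsub; simpl. rewrite !Rabs_pos_eq by lra. lra.
Qed.

(** Multiplying [Q] by its adjugate gives the determinant, and the adjugate has the same norm as
    [Q]. *)
Lemma mat_lower Q : mdet Q <> 0 -> exists c, 0 < c /\ forall v, c * n1 v <= n1 (mv Q v).
Proof.
  intros H. pose proof (Rabs_pos_lt _ H) as P. pose proof (mnorm_pos Q) as N.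
  exists (Rabs (mdet Q) / (mnorm Q + 1)). split; [apply Rdiv_lt_0_compat; lra|].
  intros v.
  assert (E : vscale (mdet Q) v = mv (Mat (m22 Q) (- m12 Q) (- m21 Q) (m11 Q)) (mv Q v))
    by (unfold mdet; vring).
  pose proof (mv_le (Mat (m22 Q) (- m12 Q) (- m21 Q) (m11 Q)) (mv Q v)) as L.
  rewrite <- E, n1_scale in L. unfold mnorm in L at 1; simpl in L. rewrite !Rabs_Ropp in L.
  npos (mv Q v).
  apply Rmult_le_reg_l with (mnorm Q + 1); [lra|].
  replace ((mnorm Q + 1) * (Rabs (mdet Q) / (mnorm Q + 1) * n1 v)) with (Rabs (mdet Q) * n1 v)
    by (field; lra).
  unfold mnorm in *. nra.
Qed.

(** The inverse of [F] enters the estimates only through local Lipschitz constants: the long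
    contracting part of a loop absorbs those of its two fixed transitions. *)
Definition loclip (f : vec -> vec) (z : vec) : Prop :=
  exists L delta, 0 < L /\ 0 < delta /\
    forall x y, dist x z < delta -> dist y z < delta -> dist (f x) (f y) <= L * dist x y.

Definition cont_at (f : vec -> vec) (z : vec) : Prop :=
  forall eps, 0 < eps -> exists delta, 0 < delta /\
    forall x, dist x z < delta -> dist (f x) (f z) < eps.

Lemma loclip_cont f z : loclip f z -> cont_at f z.
Proof.
  intros [L [d [HL [Hd H]]]] eps He. exists (Rmin d (eps / L)).
  assert (0 < eps / L) by (apply Rdiv_lt_0_compat; auto).
  split; [apply Rmin_pos; auto|]. intros x Hx.
  pose proof (Rmin_l d (eps / L)); pose proof (Rmin_r d (eps / L)).
  assert (H3 : dist x z < eps / L) by lra.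
  specialize (H x z ltac:(lra) ltac:(rewrite dist_refl; auto)).
  apply mul_lt_of_lt_div in H3; [|lra]. lra.
Qed.

Lemma loclip_comp f g z : loclip f z -> loclip g (f z) -> loclip (fun x => g (f x)) z.
Proof.
  intros Hf. pose proof (loclip_cont _ _ Hf) as Cf.
  destruct Hf as [L [d [HL [Hd H]]]]. intros [L' [d' [HL' [Hd' H']]]].
  destruct (Cf d' Hd') as [e [He Hc]].
  exists (L' * L), (Rmin d e). split; [nra|]. split; [apply Rmin_pos; auto|].
  intros x y Hx Hy. pose proof (Rmin_l d e); pose proof (Rmin_r d e).
  specialize (H x y ltac:(lra) ltac:(lra)).
  specialize (H' (f x) (f y) (Hc x ltac:(lra)) (Hc y ltac:(lra))).
  rewrite Rmult_assoc. apply Rle_trans with (L' * dist (f x) (f y)); auto.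
  apply Rmult_le_compat_l; lra.
Qed.

Lemma loclip_shift k z : loclip (fun x => vadd x k) z.
Proof.
  exists 1, 1. repeat split; try lra. intros x y _ _. rewrite dist_addr. lra.
Qed.

Lemma loclip_iter f : (forall z, loclip f z) -> forall n z, loclip (iter n f) z.
Proof.
  intros H n. induction n; intros z.
  - exists 1, 1. repeat split; try lra. intros x y _ _. simpl. lra.
  - apply (loclip_comp (iter n f) f); auto.
Qed.

Lemma sder_loclip f Q z : sder f Q z -> loclip f z.
Proof.
  intros H. destruct (sder_lip _ _ _ H) as [d [Hd H1]]. exists (mnorm Q + 1), d.
  pose proof (mnorm_pos Q). repeat split; auto; lra.
Qed.

Lemma cont_at_vcv f u l : cont_at f l -> vcv u l -> vcv (fun n => f (u n)) (f l).
Proof.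
  intros Hf Hu eps He. destruct (Hf eps He) as [d [Hd H]]. destruct (Hu d Hd) as [N HN].
  exists N. intros n Hn. apply H; auto.
Qed.

Lemma vcv_unique u a b : vcv u a -> vcv u b -> a = b.
Proof.
  intros H1 H2. apply dist_small_eq. intros eps He.
  destruct (H1 (eps / 2)) as [N1 E1]; [lra|]. destruct (H2 (eps / 2)) as [N2 E2]; [lra|].
  specialize (E1 (N1 + N2)%nat ltac:(lia)). specialize (E2 (N1 + N2)%nat ltac:(lia)).
  pose proof (dist_tri a (u (N1 + N2)%nat) b). rewrite (dist_sym a (u (N1 + N2)%nat)) in *. lra.
Qed.

(** Equal values at two points force an interior maximum or minimum, or a constant stretch, each
    incompatible with local injectivity. *)
Lemma local_injective_real (f : R -> R) : continuity f ->
  (forall t, exists d, 0 < d /\ forall s s', Rabs (s - t) < d -> Rabs (s' - t) < d -> f s = f s' -> s = s') ->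
  forall a b, f a = f b -> a = b.
Proof.
  (* no interior extremum *)
  assert (Hext : forall g : R -> R, continuity g ->
    (forall t, exists d, 0 < d /\ forall s s', Rabs (s - t) < d -> Rabs (s' - t) < d -> g s = g s' -> s = s') ->
    forall a b t, a < t < b -> (forall s, a <= s <= b -> g s <= g t) -> False).
  { intros g Hg Hl a b t Ht Hmax. destruct (Hl t) as [d [Hd Hi]].
    destruct (pos_min3 (d / 2) (t - a) (b - t)) as [e He]; try lra.
    assert (Hn : forall s, t - e <= s <= t + e -> Rabs (s - t) < d)
      by (intros s Hs; apply Rabs_def1; lra).
    pose proof (Hmax (t - e) ltac:(lra)). pose proof (Hmax (t + e) ltac:(lra)).
    destruct (Rle_or_lt (g (t - e)) (g (t + e))) as [L|L].
    - destruct (ivt_gen g (t - e) t (g (t + e))) as [s [Hs E]]; auto; [lra|nra|].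
      apply Hi in E; try apply Hn; lra.
    - destruct (ivt_gen g t (t + e) (g (t - e))) as [s [Hs E]]; auto; [lra|nra|].
      apply Hi in E; try apply Hn; lra. }
  intros Hf Hl.
  assert (Hlt : forall a b, a < b -> f a <> f b).
  { intros a b L E.
    destruct (continuity_ab_maj f a b) as [t1 [Hm1 Ht1]]; [lra|intros; apply Hf|].
    destruct (continuity_ab_min f a b) as [t2 [Hm2 Ht2]]; [lra|intros; apply Hf|].
    destruct (Rle_or_lt (f t1) (f a)) as [Q1|Q1].
    - destruct (Rle_or_lt (f a) (f t2)) as [Q2|Q2].
      + apply (Hext f Hf Hl a b ((a + b) / 2)); [lra|]. intros s Hs.
        pose proof (Hm1 s Hs). pose proof (Hm2 ((a + b) / 2) ltac:(lra)). lra.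
      + apply (Hext (fun x => - f x)) with a b t2.
        * intros x. apply continuity_pt_opp. apply Hf.
        * intros t. destruct (Hl t) as [d [Hd Hi]]. exists d. split; auto.
          intros s s' Hs Hs' E'. apply Hi; auto; lra.
        * assert (t2 <> a) by (intros E'; subst; lra). assert (t2 <> b) by (intros E'; subst; lra). lra.
        * intros s Hs. pose proof (Hm2 s Hs). lra.
    - apply (Hext f Hf Hl a b t1); [|intros; apply Hm1; auto].
      assert (t1 <> a) by (intros E'; subst; lra). assert (t1 <> b) by (intros E'; subst; lra). lra. }
  intros a b E. destruct (Rtotal_order a b) as [L|[L|L]]; auto; exfalso; eapply Hlt; eauto.
Qed.

(** * Eigenvalues of real matrices and elementary tools *)

Lemma eigenvalue_char Q l x : x <> zero -> mv Q x = vscale l x -> l * l - mtr Q * l + mdet Q = 0.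
Proof.
  intros Hx Hv. pose proof (f_equal fst Hv) as E1. pose proof (f_equal snd Hv) as E2.
  unfold mv, vscale in E1, E2; simpl in E1, E2. unfold mtr, mdet.
  assert (X1 : fst x * (l * l - (m11 Q + m22 Q) * l + (m11 Q * m22 Q - m12 Q * m21 Q)) = 0).
  { replace (fst x * (l * l - (m11 Q + m22 Q) * l + (m11 Q * m22 Q - m12 Q * m21 Q))) with
      ((m22 Q - l) * (m11 Q * fst x + m12 Q * snd x - l * fst x) -
       m12 Q * (m21 Q * fst x + m22 Q * snd x - l * snd x)) by ring.
    rewrite E1, E2. ring. }
  assert (X2 : snd x * (l * l - (m11 Q + m22 Q) * l + (m11 Q * m22 Q - m12 Q * m21 Q)) = 0).
  { replace (snd x * (l * l - (m11 Q + m22 Q) * l + (m11 Q * m22 Q - m12 Q * m21 Q))) with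
      ((m11 Q - l) * (m21 Q * fst x + m22 Q * snd x - l * snd x) -
       m21 Q * (m11 Q * fst x + m12 Q * snd x - l * fst x)) by ring.
    rewrite E1, E2. ring. }
  apply Rmult_integral in X1, X2. destruct X1 as [X1|X1]; auto. destruct X2 as [X2|X2]; auto.
  elim Hx. apply injective_projections; auto.
Qed.

(** Both columns tried are annihilated by [Q - l] when [l] is a root of the characteristic
    polynomial; they vanish together only if [Q] is the scalar matrix [l]. *)
Lemma root_eigenvector Q l : l * l - mtr Q * l + mdet Q = 0 ->
  exists v, v <> zero /\ mv Q v = vscale l v.
Proof.
  intros H. unfold mtr, mdet in H.
  destruct (classic ((m12 Q, l - m11 Q) = zero)) as [E|E].
  - destruct (classic ((l - m22 Q, m21 Q) = zero)) as [E'|E'].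
    + injection E; injection E'; intros. exists (1, 0). split.
      * intros E0. injection E0. lra.
      * unfold mv, vscale; simpl. apply injective_projections; simpl; lra.
    + exists (l - m22 Q, m21 Q). split; auto. unfold mv, vscale; simpl.
      apply injective_projections; simpl; lra.
  - exists (m12 Q, l - m11 Q). split; auto. unfold mv, vscale; simpl.
    apply injective_projections; simpl; lra.
Qed.

Lemma sq_gt1 l : 1 < Rabs l -> l ^ 2 + 0 ^ 2 > 1.
Proof. intros H. rewrite <- (pow2_abs l). simpl. nra. Qed.

Lemma quadratic_continuity c0 c1 c2 : continuity (fun s => c0 + s * c1 + s * s * c2).
Proof. intros x. reg. Qed.

(** An interval at least as long as the step [a] meets the progression [c + j a]. The product form
    is the sign condition of the intermediate value theorem. *)
Lemma multiple_between a c l1 l2 : a <> 0 -> Rabs a <= Rabs (l1 - l2) ->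
  exists j : Z, (l1 - (c + IZR j * a)) * (l2 - (c + IZR j * a)) <= 0.
Proof.
  intros Ha H. set (q := (l1 - c) / a). set (r := (l2 - c) / a).
  assert (Eq : l1 - c = q * a) by (unfold q; field; auto).
  assert (Er : l2 - c = r * a) by (unfold r; field; auto).
  assert (Hqr : 1 <= Rabs (q - r)).
  { replace (l1 - l2) with ((q - r) * a) in H by lra. rewrite Rabs_mult in H.
    pose proof (Rabs_pos_lt _ Ha). nra. }
  assert (Hj : exists j : Z, (q - IZR j) * (r - IZR j) <= 0).
  { destruct (Rle_or_lt q r) as [L|L].
    - rewrite Rabs_left1 in Hqr by lra. destruct (floor_ex r) as [j Hj]. exists j. nra.
    - rewrite Rabs_right in Hqr by lra. destruct (floor_ex q) as [j Hj]. exists j. nra. }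
  destruct Hj as [j Hj]. exists j.
  replace (l1 - (c + IZR j * a)) with ((q - IZR j) * a) by lra.
  replace (l2 - (c + IZR j * a)) with ((r - IZR j) * a) by lra.
  replace ((q - IZR j) * a * ((r - IZR j) * a)) with ((q - IZR j) * (r - IZR j) * (a * a)) by ring.
  pose proof (Rle_0_sqr a). unfold Rsqr in *. nra.
Qed.

(** * Curves in the plane and countable targets *)

Definition rcont (f : R -> vec) : Prop := forall s eps, 0 < eps -> exists delta, 0 < delta /\
  forall t, Rabs (t - s) < delta -> dist (f t) (f s) < eps.

Lemma rcont_dot f q : rcont f -> continuity (fun s => dot q (f s)).
Proof.
  intros H. apply continuity_eps. intros s eps He. npos q.
  destruct (H s (eps / (n1 q + 1))) as [d [Hd H1]]; [apply Rdiv_lt_0_compat; lra|].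
  exists d. split; auto. intros t Ht. specialize (H1 t Ht).
  eapply Rle_lt_trans; [apply dot_dist|].
  apply mul_lt_of_lt_div in H1; [|lra].
  pose proof (dist_pos (f t) (f s)). lra.
Qed.

Lemma rcont_shift f a : rcont f -> rcont (fun s => f (s + a)).
Proof.
  intros H s eps He. destruct (H (s + a) eps He) as [d [Hd H1]]. exists d. split; auto.
  intros t Ht. apply H1. replace (t + a - (s + a)) with (t - s) by ring. auto.
Qed.

Lemma rcont_comp f g : rcont f -> (forall z, cont_at g z) -> rcont (fun s => g (f s)).
Proof.
  intros Hf Hg s eps He. destruct (Hg (f s) eps He) as [d [Hd H1]].
  destruct (Hf s d Hd) as [e [Hep H2]]. exists e. split; auto.
Qed.

Lemma integer_valued_const (f : R -> R) : continuity f ->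
  (forall s, exists j : Z, f s = IZR j) -> forall s t, f s = f t.
Proof.
  intros Hf Hz.
  assert (Hlt : forall s t, f s < f t -> False).
  { intros s t L. destruct (Hz s) as [a Ha]. destruct (Hz t) as [b Hb].
    rewrite Ha, Hb in L. apply lt_IZR in L. assert (La : (a + 1 <= b)%Z) by lia.
    apply IZR_le in La. rewrite plus_IZR in La.
    assert (Hv : exists u, f u = IZR a + 1 / 2).
    { destruct (Rle_or_lt s t).
      - destruct (ivt_gen f s t (IZR a + 1 / 2)) as [u [_ E]]; eauto. rewrite Ha, Hb. nra.
      - destruct (ivt_gen f t s (IZR a + 1 / 2)) as [u [_ E]]; eauto; [lra|]. rewrite Ha, Hb. nra. }
    destruct Hv as [u Hu]. destruct (Hz u) as [c Hc]. rewrite Hc in Hu.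
    assert (a < c)%Z by (apply lt_IZR; lra). assert (c < a + 1)%Z by (apply lt_IZR; rewrite plus_IZR; lra).
    lia. }
  intros s t. destruct (Rtotal_order (f s) (f t)) as [L|[L|L]]; auto; exfalso; eauto.
Qed.

(** The difference of two lifts of one torus curve is continuous with integer coordinates. Equations
    on the torus thus become equations in the plane with one fixed translation. *)
Lemma lattice_difference_const f g : rcont f -> rcont g -> (forall s, eqT (f s) (g s)) ->
  exists k, lattice k /\ forall s, f s = vadd (g s) k.
Proof.
  intros Hf Hg H. exists (vsub (f 0) (g 0)). split; [apply H|]. intros s.
  assert (Hc : forall q, q = (1, 0) \/ q = (0, 1) ->
    dot q (f s) - dot q (g s) = dot q (f 0) - dot q (g 0)).
  { intros q Hq. apply (integer_valued_const (fun s => dot q (f s) - dot q (g s))).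
    - intros x. apply continuity_pt_minus; apply rcont_dot; auto.
    - intros t. destruct (H t) as [a [b E]]. rewrite <- dot_sub, E.
      destruct Hq as [-> | ->]; [exists a|exists b]; unfold dot; simpl; ring. }
  pose proof (Hc _ (or_introl eq_refl)) as E1. pose proof (Hc _ (or_intror eq_refl)) as E2.
  unfold dot in E1, E2; simpl in E1, E2. apply injective_projections; simpl; lra.
Qed.

Lemma line_rcont x d : rcont (fun t => vadd x (vscale t d)).
Proof.
  intros s eps He. npos d. exists (eps / (n1 d + 1)).
  split; [apply Rdiv_lt_0_compat; lra|]. intros t Ht. unfold dist.
  replace (vsub (vadd x (vscale t d)) (vadd x (vscale s d))) with (vscale (t - s) d) by vring.
  rewrite n1_scale. apply Rmult_lt_compat_r with (r := n1 d + 1) in Ht; [|lra].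
  replace (eps / (n1 d + 1) * (n1 d + 1)) with eps in Ht by (field; lra).
  rpos (t - s). nra.
Qed.

Lemma rational_near x n : exists a b : nat, Rabs ((INR a - INR b) / INR (S n) - x) <= / INR (S n).
Proof.
  destruct (floor_ex (x * INR (S n))) as [j Hj]. exists (Z.to_nat j), (Z.to_nat (- j)).
  assert (E : INR (Z.to_nat j) - INR (Z.to_nat (- j)) = IZR j).
  { rewrite !INR_IZR_INZ, <- minus_IZR. f_equal. lia. }
  assert (P : 0 < INR (S n)) by (apply lt_0_INR; lia).
  rewrite E. replace (IZR j / INR (S n) - x) with ((IZR j - x * INR (S n)) * / INR (S n)) by (field; lra).
  rewrite Rabs_mult, Rabs_inv, (Rabs_pos_eq (INR (S n))) by lra.
  rewrite <- (Rmult_1_l (/ INR (S n))) at 2. apply Rmult_le_compat_r.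
  - apply Rlt_le, Rinv_0_lt_compat; auto.
  - apply Rabs_le. lra.
Qed.

(** Rational points with common denominator [e + 1] and tolerance [/ (e + 1)], coded by Cantor
    pairing; signed integers are written as differences of naturals. *)
Lemma countable_targets : exists (v : nat -> vec) (t : nat -> R), (forall j, 0 < t j) /\
  forall x eps, 0 < eps -> exists j, dist (v j) x < eps /\ t j < eps.
Proof.
  pose (dec := fun n => let (a, n1) := of_nat n in let (b, n2) := of_nat n1 in
                        let (c, n3) := of_nat n2 in let (d, e) := of_nat n3 in (a, b, c, d, e)).
  exists (fun n => let '(a, b, c, d, e) := dec n in
            ((INR a - INR b) / INR (S e), (INR c - INR d) / INR (S e))),
         (fun n => let '(_, _, _, _, e) := dec n in / INR (S e)).
  split.
  - intros j. destruct (dec j) as [[[[a b] c] d] e]. apply inv_INR_pos.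
  - intros x eps He. destruct (inv_INR_small (eps / 2)) as [e He']; [lra|].
    specialize (He' e (Nat.le_refl e)).
    destruct (rational_near (fst x) e) as [a [b H1]]. destruct (rational_near (snd x) e) as [c [d H2]].
    exists (to_nat (a, to_nat (b, to_nat (c, to_nat (d, e))))).
    assert (Ed : dec (to_nat (a, to_nat (b, to_nat (c, to_nat (d, e))))) = (a, b, c, d, e)).
    { unfold dec. rewrite !cancel_of_to. auto. }
    rewrite Ed. split; [|lra]. unfold dist, n1, vsub. cbn [fst snd]. lra.
Qed.

Lemma dist_nearT x y eps k : lattice k -> dist (vsub x k) y < eps -> nearT x y eps.
Proof.
  intros [a [b ->]] H. exists a, b. eapply Rle_lt_trans; [apply vnorm_le_n1|].
  replace (vsub (vsub x y) (IZR a, IZR b)) with (vsub (vsub x (IZR a, IZR b)) y) by vring. exact H.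
Qed.

Lemma dense_set_of_dist (P : vec -> Prop) :
  (forall x eps, 0 < eps -> exists z, P z /\ dist z x < eps) -> dense_set P.
Proof.
  intros H x eps He. destruct (H x eps He) as [z [Hz Hd]]. exists z. split; auto.
  apply dist_nearT with zero; [exists 0%Z, 0%Z; auto|].
  replace (vsub z zero) with z by vring. auto.
Qed.

(** * The lift: translations, differentiability, cones, surjectivity *)

Section Torus.
Variables (M : mat) (G : vec -> vec) (DG : vec -> mat) (mu K alpha : R) (pA pB : vec).
Hypothesis M_int : is_int_mat M.
Hypothesis G_per : Zperiodic G.
Hypothesis G_der : has_derivative G DG.
Hypothesis DG_cont : mat_continuous DG.
Hypothesis DF_inv : forall z, mdet (DF M DG z) <> 0.
Hypothesis M_inv : mdet M <> 0.
Hypothesis mu_ge2 : 2 <= Rabs mu.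
Hypothesis pA_M : forall v, dot pA (mv M v) = mu * dot pA v.
Hypothesis alpha_pos : 0 < alpha.
Hypothesis K_gt1 : 1 < K.
Hypothesis coord_indep : fst pA * snd pB - snd pA * fst pB <> 0.

Local Notation A := (dot pA).
Local Notation B := (dot pB).
Local Notation F := (liftF M G).
Local Notation D := (DF M DG).
Local Notation cst := (ccst pA pB alpha).
Local Notation DFn' := (DFn M G DG).
Local Notation inC := (in_cone pA pB alpha).

Hypothesis D_cone : forall z v, v <> zero -> inC v ->
  Rabs (B (mv (D z) v)) < alpha * Rabs (A (mv (D z) v)) /\ K * Rabs (A v) < Rabs (A (mv (D z) v)).
Hypothesis D_center : forall z v, v <> zero -> ~ (Rabs (B v) < alpha * Rabs (A v)) ->
  vnorm (mv (D z) v) < K * vnorm v.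

Lemma F_add_lattice z k : lattice k -> F (vadd z k) = vadd (F z) (mv M k).
Proof.
  intros [a [b ->]]. unfold liftF. rewrite G_per, mv_add. vring.
Qed.

Lemma M_lattice k : lattice k -> lattice (mv M k).
Proof.
  intros [a [b ->]]. destruct M_int as [x [y [z [w ->]]]].
  exists (x * a + y * b)%Z, (z * a + w * b)%Z. unfold mv; simpl.
  rewrite !plus_IZR, !mult_IZR. auto.
Qed.

Lemma Mn_lattice n k : lattice k -> lattice (iter n (mv M) k).
Proof. intros H. induction n; simpl; auto. apply M_lattice; auto. Qed.

Lemma Fn_add_lattice n z k : lattice k ->
  iter n F (vadd z k) = vadd (iter n F z) (iter n (mv M) k).
Proof.
  intros H. induction n; simpl; auto. rewrite IHn, F_add_lattice; auto. apply Mn_lattice; auto.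
Qed.

Lemma Fn_eqT n x y : eqT x y -> eqT (iter n F x) (iter n F y).
Proof.
  intros H. apply eqT_ex in H. destruct H as [k [Hk ->]]. rewrite Fn_add_lattice; auto.
  apply eqT_add_lattice, Mn_lattice; auto.
Qed.

Lemma A_Mn n k : A (iter n (mv M) k) = mu ^ n * A k.
Proof. induction n; simpl; [ring|]. rewrite pA_M, IHn. ring. Qed.

Lemma line_derivative p x d t :
  derivable_pt_lim (fun t => dot p (F (vadd x (vscale t d)))) t
    (dot p (mv (D (vadd x (vscale t d))) d)).
Proof.
  intros eps He. set (z := vadd x (vscale t d)).
  (* The factor 2 comes from comparing the sum norm with the Euclidean norm of [has_derivative]; the
     added 1 makes the final inequality strict. *)
  set (q := 2 * n1 p * vnorm d + 1).
  assert (Q : 0 < q) by (unfold q; npos p; pose proof (vnorm_pos d); nra).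
  destruct (G_der z (eps / q)) as [dl [Hdl HG]]; [apply Rdiv_lt_0_compat; auto|].
  assert (P : 0 < dl / (vnorm d + 1)).
  { apply Rdiv_lt_0_compat; auto. pose proof (vnorm_pos d). lra. }
  exists (mkposreal _ P). intros s Hs0 Hs. simpl in Hs.
  specialize (HG (vscale s d)). rewrite vnorm_scale in HG.
  assert (Hsm : Rabs s * vnorm d < dl).
  { pose proof (vnorm_pos d). rpos s.
    apply Rmult_lt_compat_r with (r := vnorm d + 1) in Hs; [|lra].
    replace (dl / (vnorm d + 1) * (vnorm d + 1)) with dl in Hs by (field; lra). nra. }
  specialize (HG Hsm).
  set (er := vsub (vsub (G (vadd z (vscale s d))) (G z)) (mv (DG z) (vscale s d))) in HG.
  assert (E : dot p (F (vadd x (vscale (t + s) d))) - dot p (F z) = s * dot p (mv (D z) d) + dot p er).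
  { replace (vadd x (vscale (t + s) d)) with (vadd z (vscale s d)) by (unfold z; vring).
    unfold er, liftF, DF, madd. vring. }
  rewrite E.
  replace ((s * dot p (mv (D z) d) + dot p er) / s - dot p (mv (D z) d)) with (dot p er / s)
    by (field; auto).
  unfold Rdiv. rewrite Rabs_mult, Rabs_inv.
  pose proof (Rabs_pos_lt _ Hs0) as Ps.
  apply Rmult_lt_reg_r with (Rabs s); auto. rewrite Rmult_assoc, Rinv_l, Rmult_1_r by lra.
  pose proof (dot_le p er). pose proof (n1_le_vnorm er). npos p.
  apply Rle_lt_trans with (n1 p * (2 * (eps / q * (Rabs s * vnorm d)))); [nra|].
  replace (n1 p * (2 * (eps / q * (Rabs s * vnorm d)))) with
    (eps * Rabs s * ((q - 1) / q)) by (unfold q; field; unfold q in Q; lra).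
  rewrite <- (Rmult_1_r (eps * Rabs s)) at 2. apply Rmult_lt_compat_l; [nra|].
  apply Rmult_lt_reg_r with q; auto. unfold Rdiv. rewrite Rmult_assoc, Rinv_l; lra.
Qed.

(** The mean value theorem is scalar, so a functional [p] is fixed; the intermediate point depends
    on it. *)
Lemma mean_value p x y : exists t, 0 < t < 1 /\
  dot p (vsub (F y) (F x)) = dot p (mv (D (vadd x (vscale t (vsub y x)))) (vsub y x)).
Proof.
  destruct (MVT_cor2 (fun t => dot p (F (vadd x (vscale t (vsub y x)))))
    (fun t => dot p (mv (D (vadd x (vscale t (vsub y x)))) (vsub y x))) 0 1) as [t [E Ht]]; [lra| |].
  - intros c _. apply line_derivative.
  - exists t. split; auto. rewrite dot_sub.
    replace (vadd x (vscale 1 (vsub y x))) with y in E by vring.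
    replace (vadd x (vscale 0 (vsub y x))) with x in E by vring. lra.
Qed.

Lemma segment_dist x y z t d : 0 < t < 1 -> dist x z < d -> dist y z < d ->
  dist (vadd x (vscale t (vsub y x))) z < d.
Proof.
  intros Ht Hx Hy. unfold dist in *.
  replace (vsub (vadd x (vscale t (vsub y x))) z) with
    (vadd (vscale (1 - t) (vsub x z)) (vscale t (vsub y z))) by vring.
  eapply Rle_lt_trans; [apply n1_add|]. rewrite !n1_scale, !Rabs_pos_eq by lra. nra.
Qed.

(** Each row of the increment is the row of the derivative at some point of the segment, which is
    near [z], so continuity of [DG] compares it with the row at [z]. *)
Lemma F_sder z : sder F (D z) z.
Proof.
  intros eps He. destruct (DG_cont z (eps / 2)) as [d [Hd HD]]; [lra|].
  exists d. split; auto. intros x y Hx Hy.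
  assert (Hrow : forall p, p = (1, 0) \/ p = (0, 1) ->
    Rabs (dot p (vsub (vsub (F x) (F y)) (mv (D z) (vsub x y)))) <= eps / 2 * dist x y).
  { intros p Hp. destruct (mean_value p y x) as [t [Ht E]].
    set (xi := vadd y (vscale t (vsub x y))) in *.
    assert (Hxi : vnorm (vsub xi z) < d).
    { eapply Rle_lt_trans; [apply vnorm_le_n1|]. apply segment_dist; auto. }
    destruct (HD xi Hxi) as [E1 [E2 [E3 E4]]].
    rewrite dot_sub, E, <- dot_sub.
    set (v := vsub x y) in *. unfold dist. fold v.
    rpos (fst v). rpos (snd v).
    destruct Hp as [-> | ->].
    - replace (dot (1, 0) (vsub (mv (D xi) v) (mv (D z) v))) with
        ((m11 (DG xi) - m11 (DG z)) * fst v + (m12 (DG xi) - m12 (DG z)) * snd v)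
        by (unfold DF, madd; vring).
      eapply Rle_trans; [apply Rabs_triang|]. rewrite !Rabs_mult. unfold n1. nra.
    - replace (dot (0, 1) (vsub (mv (D xi) v) (mv (D z) v))) with
        ((m21 (DG xi) - m21 (DG z)) * fst v + (m22 (DG xi) - m22 (DG z)) * snd v)
        by (unfold DF, madd; vring).
      eapply Rle_trans; [apply Rabs_triang|]. rewrite !Rabs_mult. unfold n1. nra. }
  pose proof (Hrow (1, 0) (or_introl eq_refl)) as R1.
  pose proof (Hrow (0, 1) (or_intror eq_refl)) as R2.
  set (w := vsub (vsub (F x) (F y)) (mv (D z) (vsub x y))) in *.
  replace (dot (1, 0) w) with (fst w) in R1 by (unfold dot; simpl; ring).
  replace (dot (0, 1) w) with (snd w) in R2 by (unfold dot; simpl; ring).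
  unfold n1. lra.
Qed.

Lemma F_loclip z : loclip F z.
Proof. apply sder_loclip with (D z), F_sder. Qed.

Lemma F_cont z : cont_at F z.
Proof. apply loclip_cont, F_loclip. Qed.

Lemma Fn_loclip n z : loclip (iter n F) z.
Proof. apply loclip_iter, F_loclip. Qed.

Lemma Fn_cont n z : cont_at (iter n F) z.
Proof. apply loclip_cont, Fn_loclip. Qed.

Lemma Fn_sder n z : sder (iter n F) (DFn M G DG n z) z.
Proof.
  induction n; simpl; [apply sder_id|].
  apply (sder_comp (iter n F) F); auto. apply F_sder.
Qed.

(* The quotient of the two increments is a quotient of derivatives at a common point. *)
Lemma F_cone_strict x y : x <> y -> inC (vsub x y) ->
  Rabs (B (vsub (F x) (F y))) < alpha * Rabs (A (vsub (F x) (F y))) /\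
  K * Rabs (A (vsub x y)) < Rabs (A (vsub (F x) (F y))).
Proof.
  intros Hxy Hc.
  assert (Hd : vsub x y <> zero).
  { intros E. apply Hxy. apply dist_eq. unfold dist. rewrite E. apply n1_zero. }
  destruct (mean_value pA y x) as [t [_ Et]].
  pose proof (D_cone (vadd y (vscale t (vsub x y))) _ Hd Hc) as [_ HA]. rewrite <- Et in HA.
  split; auto.
  set (a := A (vsub (F x) (F y))) in *. set (b := B (vsub (F x) (F y))) in *.
  (* As in the Cauchy mean value theorem: the functional [a B - b A] vanishes on the increment, so
     at some point the derivative image has the same ratio of [B] to [A]. *)
  destruct (mean_value (vsub (vscale a pB) (vscale b pA)) y x) as [s [_ Es]].
  pose proof (D_cone (vadd y (vscale s (vsub x y))) _ Hd Hc) as [HB HA'].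
  set (w := mv (D (vadd y (vscale s (vsub x y)))) (vsub x y)) in *.
  assert (Hlin : forall v, dot (vsub (vscale a pB) (vscale b pA)) v = a * B v - b * A v)
    by (intros v; vring).
  rewrite !Hlin in Es. fold a b in Es.
  assert (E : b * A w = a * B w) by lra.
  assert (E' : Rabs b * Rabs (A w) = Rabs a * Rabs (B w)) by (rewrite <- !Rabs_mult; f_equal; auto).
  rpos (A (vsub x y)). rpos (B w).
  assert (0 < Rabs (A w)) by nra.
  assert (0 < Rabs a) by nra.
  apply Rmult_lt_reg_r with (Rabs (A w)); auto. rewrite E'. nra.
Qed.

Lemma F_cone x y : inC (vsub x y) ->
  inC (vsub (F x) (F y)) /\ K * Rabs (A (vsub x y)) <= Rabs (A (vsub (F x) (F y))).
Proof.
  intros H. destruct (classic (x = y)) as [->|E].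
  - replace (vsub y y) with zero by vring. replace (vsub (F y) (F y)) with zero by vring.
    unfold in_cone, dot, zero; simpl. rewrite !Rmult_0_r, Rplus_0_l, Rabs_R0. lra.
  - destruct (F_cone_strict x y E H). unfold in_cone. lra.
Qed.

Lemma G_bounded : exists C, forall z, n1 (G z) <= C.
Proof.
  apply NNPP. intros Hno.
  assert (Hex : forall n : nat, exists z, n1 z <= 2 /\ INR n < n1 (G z)).
  { intros n. apply NNPP. intros Hn. apply Hno. exists (INR n). intros z.
    apply Rnot_lt_le. intros L. apply Hn. destruct (lattice_reduce z) as [k [Hk Hz]].
    exists (vsub z k). split; auto. apply lattice_opp in Hk. destruct Hk as [a [b Hk]].
    replace (vsub z k) with (vadd z (IZR a, IZR b)) by (rewrite <- Hk; vring).
    rewrite G_per. auto. }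
  destruct (nat_choice _ Hex) as [u Hu].
  destruct (bounded_vsubseq u 2) as [l [phi [Hphi Hl]]]; [apply Hu|].
  destruct (cont_at_vcv _ _ _ (F_cont l) Hl 1) as [N HN]; [lra|].
  destruct (INR_unbounded (n1 (F l) + 1 + mnorm M * 2)) as [N' HN'].
  set (n := (N + N')%nat). specialize (HN n ltac:(lia)).
  destruct (Hu (phi n)) as [U1 U2]. pose proof (subseq_mono phi Hphi n).
  assert (INR N' <= INR (phi n)) by (apply le_INR; lia).
  pose proof (mv_le M (u (phi n))). pose proof (mnorm_pos M).
  assert (T : n1 (G (u (phi n))) <= dist (F (u (phi n))) (F l) + n1 (F l) + n1 (mv M (u (phi n)))).
  { replace (G (u (phi n))) with
      (vadd (vadd (vsub (F (u (phi n))) (F l)) (F l)) (vscale (-1) (mv M (u (phi n))))) by (unfold liftF; vring).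
    eapply Rle_trans; [apply n1_add|]. rewrite n1_opp.
    pose proof (n1_add (vsub (F (u (phi n))) (F l)) (F l)). unfold dist. lra. }
  npos (u (phi n)). nra.
Qed.

Lemma F_proper : exists c C, 0 < c /\ forall z, c * n1 z <= n1 (F z) + C.
Proof.
  destruct (mat_lower M M_inv) as [c [Hc HM]]. destruct G_bounded as [C HG].
  exists c, C. split; auto. intros z. specialize (HM z). specialize (HG z).
  pose proof (n1_add (F z) (vscale (-1) (G z))) as T. rewrite n1_opp in T.
  replace (vadd (F z) (vscale (-1) (G z))) with (mv M z) in T by (unfold liftF; vring). lra.
Qed.

(* At a minimum of [|F z - y|] the derivative, being onto, forces [F z = y]. *)
Lemma F_surj y : exists z, F z = y.
Proof.
  (* Negated, since [completeness] yields suprema: the infimum of the distance is [- s]. *)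
  pose (E := fun r => exists z, r = - vnorm (vsub (F z) y)).
  destruct (completeness E) as [s [Hub Hlub]].
  { exists 0. intros r [z ->]. pose proof (vnorm_pos (vsub (F z) y)). lra. }
  { exists (- vnorm (vsub (F zero) y)), zero; auto. }
  assert (Hex : forall n : nat, exists z, vnorm (vsub (F z) y) < - s + / INR (S n)).
  { intros n. apply NNPP. intros Hn. pose proof (inv_INR_pos n).
    assert (s <= s - / INR (S n)); [|lra]. apply Hlub. intros r [z ->].
    apply Rnot_lt_le. intros L. apply Hn. exists z. lra. }
  destruct (nat_choice _ Hex) as [u Hu].
  destruct F_proper as [c [C [Hc HF]]].
  destruct (bounded_vsubseq u ((2 * (- s + 1) + n1 y + C) / c)) as [z [phi [Hphi Hz]]].
  { intros n. apply Rmult_le_reg_l with c; auto.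
    replace (c * ((2 * (- s + 1) + n1 y + C) / c)) with (2 * (- s + 1) + n1 y + C) by (field; lra).
    eapply Rle_trans; [apply HF|]. specialize (Hu n).
    pose proof (inv_INR_le1 n).
    pose proof (n1_le_vnorm (vsub (F (u n)) y)). pose proof (n1_add (vsub (F (u n)) y) y) as T.
    replace (vadd (vsub (F (u n)) y) y) with (F (u n)) in T by vring. lra. }
  assert (Hmin : vnorm (vsub (F z) y) <= - s).
  { apply Rnot_lt_le. intros L. set (g := vnorm (vsub (F z) y) + s).
    destruct (cont_at_vcv _ _ _ (F_cont z) Hz (g / 2)) as [N HN]; [unfold g; lra|].
    destruct (inv_INR_small (g / 2)) as [N' HN']; [unfold g; lra|].
    specialize (HN (N + N')%nat ltac:(lia)).
    specialize (HN' (phi (N + N')%nat) ltac:(pose proof (subseq_mono phi Hphi (N + N')); lia)).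
    specialize (Hu (phi (N + N')%nat)).
    pose proof (vnorm_add (vsub (F (u (phi (N + N')%nat))) y) (vsub (F z) (F (u (phi (N + N')%nat))))) as T.
    replace (vadd (vsub (F (u (phi (N + N')%nat))) y) (vsub (F z) (F (u (phi (N + N')%nat))))) with
      (vsub (F z) y) in T by vring.
    pose proof (vnorm_le_n1 (vsub (F z) (F (u (phi (N + N')%nat))))) as V.
    fold (dist (F z) (F (u (phi (N + N')%nat)))) in V. rewrite dist_sym in V. unfold g in *. lra. }
  exists z. apply NNPP. intros Hne.
  set (r := vsub (F z) y) in *.
  assert (Hr : 0 < vnorm r).
  { pose proof (n1_le_vnorm r). assert (0 < n1 r); [|lra].
    destruct (Rle_lt_or_eq_dec _ _ (dist_pos (F z) y)) as [P|P]; auto.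
    elim Hne. apply dist_eq; auto. }
  set (Q := D z). assert (HQ : mdet Q <> 0) by apply DF_inv.
  (* Newton direction, the solution of [Q d = - r] by the adjugate. *)
  set (d := vscale (- / mdet Q) (mv (Mat (m22 Q) (- m12 Q) (- m21 Q) (m11 Q)) r)).
  assert (Hd : mv Q d = vscale (-1) r).
  { unfold d. rewrite mv_scale. unfold mdet in *. unfold vscale, mv.
    apply injective_projections; simpl; field; auto. }
  npos d.
  destruct (F_sder z (vnorm r / (2 * (n1 d + 1)))) as [dl [Hdl HS]].
  { apply Rdiv_lt_0_compat; lra. }
  assert (P1 : 0 < dl / (2 * (n1 d + 1))) by (apply Rdiv_lt_0_compat; lra).
  (* A step [t] along [d] replaces the residual [r] by [(1 - t) r] plus an error below [t |r|],
     which contradicts minimality. *)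
  destruct (pos_min2 (1 / 2) _ ltac:(lra) P1) as [t Ht].
  assert (Hdist : dist (vadd z (vscale t d)) z = t * n1 d).
  { unfold dist. replace (vsub (vadd z (vscale t d)) z) with (vscale t d) by vring.
    rewrite n1_scale, Rabs_pos_eq; lra. }
  assert (Htd : t * n1 d < dl).
  { apply Rle_lt_trans with (dl / (2 * (n1 d + 1)) * n1 d); [apply Rmult_le_compat_r; lra|].
    apply Rmult_lt_reg_r with (2 * (n1 d + 1)); [lra|]. unfold Rdiv.
    replace (dl * / (2 * (n1 d + 1)) * n1 d * (2 * (n1 d + 1))) with (dl * n1 d) by (field; lra). nra. }
  specialize (HS (vadd z (vscale t d)) z ltac:(rewrite Hdist; auto) ltac:(rewrite dist_refl; auto)).
  rewrite Hdist in HS.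
  set (er := vsub (vsub (F (vadd z (vscale t d))) (F z)) (mv (D z) (vsub (vadd z (vscale t d)) z))) in HS.
  assert (E1 : vsub (F (vadd z (vscale t d))) y = vadd (vscale (1 - t) r) er).
  { unfold er. replace (vsub (vadd z (vscale t d)) z) with (vscale t d) by vring.
    fold Q. rewrite mv_scale, Hd. unfold r. vring. }
  assert (Hs : - s <= vnorm (vsub (F (vadd z (vscale t d))) y)).
  { pose proof (Hub (- vnorm (vsub (F (vadd z (vscale t d))) y)) (ex_intro _ _ eq_refl)). lra. }
  rewrite E1 in Hs. pose proof (vnorm_add (vscale (1 - t) r) er) as T.
  rewrite vnorm_scale, Rabs_pos_eq in T by lra. pose proof (vnorm_le_n1 er).
  assert (vnorm r / (2 * (n1 d + 1)) * (t * n1 d) < t * vnorm r).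
  { apply Rmult_lt_reg_r with (2 * (n1 d + 1)); [lra|].
    replace (vnorm r / (2 * (n1 d + 1)) * (t * n1 d) * (2 * (n1 d + 1))) with (vnorm r * (t * n1 d)) by (field; lra).
    assert (0 < t * vnorm r) by nra. nra. }
  lra.
Qed.

Lemma F_loc_lower z : exists c d, 0 < c /\ 0 < d /\
  forall x y, dist x z < d -> dist y z < d -> c * dist x y <= dist (F x) (F y).
Proof.
  destruct (mat_lower (D z) (DF_inv z)) as [c [Hc HD]].
  destruct (F_sder z (c / 2)) as [d [Hd HS]]; [lra|].
  exists (c / 2), d. repeat split; auto; try lra. intros x y Hx Hy.
  specialize (HS x y Hx Hy). specialize (HD (vsub x y)). unfold dist in *.
  pose proof (n1_add (vsub (F x) (F y)) (vscale (-1) (vsub (vsub (F x) (F y)) (mv (D z) (vsub x y))))) as T.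
  rewrite n1_opp in T.
  replace (vadd (vsub (F x) (F y)) (vscale (-1) (vsub (vsub (F x) (F y)) (mv (D z) (vsub x y)))))
    with (mv (D z) (vsub x y)) in T by vring. lra.
Qed.

(** * The expanding coordinate and the inverse *)

Lemma mu_pow_ne0 n : mu ^ n <> 0.
Proof. apply pow_nonzero. intros E. rewrite E, Rabs_R0 in mu_ge2. lra. Qed.

Lemma mu_pow_ge n : 2 ^ n <= Rabs (mu ^ n).
Proof. rewrite <- RPow_abs. apply pow_incr. lra. Qed.

(** [A (F z) = mu A z + A (G z)] with [G] bounded, so consecutive terms of the sequence differ by
    [O(|mu|^-(n+1))], uniformly in [z]. *)
Lemma level_ex : exists C, forall z, exists l, forall n,
  Rabs (l - A (iter n F z) / mu ^ n) <= C * (/ 2) ^ n.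
Proof.
  destruct G_bounded as [C HG]. exists (2 * (n1 pA * C)). intros z.
  (* The real sequence is placed on the first axis in order to reuse the planar statement. *)
  destruct (geom_cauchy (fun n => (A (iter n F z) / mu ^ n, 0)) (n1 pA * C)) as [l [_ Hl]].
  - intros n.
    assert (E : forall a b, dist (a, 0) (b, 0) = Rabs (a - b))
      by (intros a b; unfold dist, n1, vsub; simpl; rewrite Rminus_diag, Rabs_R0; ring).
    rewrite E. clear E.
    replace (iter (S n) F z) with (F (iter n F z)) by reflexivity. unfold liftF at 1.
    rewrite dot_add, pA_M. pose proof (mu_pow_ne0 n) as E0. pose proof (mu_pow_ne0 1) as E1.
    simpl in E1. rewrite Rmult_1_r in E1.
    replace ((mu * A (iter n F z) + A (G (iter n F z))) / mu ^ S n - A (iter n F z) / mu ^ n)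
      with (A (G (iter n F z)) * / mu ^ S n) by (simpl; field; auto).
    rewrite Rabs_mult, Rabs_inv. apply Rmult_le_compat; try apply Rabs_pos.
    + apply Rlt_le, Rinv_0_lt_compat, Rabs_pos_lt, mu_pow_ne0.
    + eapply Rle_trans; [apply dot_le|]. apply Rmult_le_compat_l; [apply n1_pos|auto].
    + rewrite pow_inv. apply Rinv_le_contravar; [apply pow_lt; lra|].
      pose proof (mu_pow_ge (S n)). simpl in *. pose proof (pow_lt 2 n ltac:(lra)). lra.
  - exists (fst l). intros n. specialize (Hl n). eapply Rle_trans; [|apply Hl].
    set (a := A (iter n F z) / mu ^ n). unfold dist, n1, vsub; simpl.
    rpos (snd l - 0). lra.
Qed.

(* [lev z] is the limit of [A (F^n z) / mu^n]. *)
Definition lev (z : vec) : R :=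
  epsilon (inhabits 0) (fun l => exists C, forall n, Rabs (l - A (iter n F z) / mu ^ n) <= C * (/ 2) ^ n).

(** The geometric rate determines the limit, so identities for [lev] are proved by showing that a
    candidate satisfies such a bound. *)
Lemma lev_unique z l C :
  (forall n, Rabs (l - A (iter n F z) / mu ^ n) <= C * (/ 2) ^ n) -> lev z = l.
Proof.
  intros H.
  assert (Hs : exists C, forall n, Rabs (lev z - A (iter n F z) / mu ^ n) <= C * (/ 2) ^ n)
    by exact (epsilon_spec (inhabits 0)
         (fun l => exists C, forall n, Rabs (l - A (iter n F z) / mu ^ n) <= C * (/ 2) ^ n)
         (ex_intro _ l (ex_intro _ C H))).
  destruct Hs as [C' H']. apply cond_eq. intros eps He.
  destruct (pow_small (/ 2) (C' + C) eps) as [N HN]; [lra|auto|].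
  specialize (HN N (Nat.le_refl N)). specialize (H N). specialize (H' N).
  pose proof (Rabs_tri_minus (lev z) (A (iter N F z) / mu ^ N) l).
  rewrite (Rabs_minus_sym (A (iter N F z) / mu ^ N)) in *. lra.
Qed.

Lemma lev_spec : exists C, forall z n, Rabs (lev z - A (iter n F z) / mu ^ n) <= C * (/ 2) ^ n.
Proof.
  destruct level_ex as [C H]. exists C. intros z. destruct (H z) as [l Hl].
  rewrite (lev_unique z l C); auto.
Qed.

Lemma lev_near_ex : exists C, forall z, Rabs (lev z - A z) <= C.
Proof.
  destruct lev_spec as [C H]. exists C. intros z. specialize (H z 0%nat). simpl in H.
  rewrite Rdiv_1_r in H. lra.
Qed.

Lemma lev_F z : lev (F z) = mu * lev z.
Proof.
  destruct lev_spec as [C H]. apply lev_unique with (Rabs mu * C). intros n.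
  rewrite <- Nat.iter_succ_r. specialize (H z (S n)). pose proof (mu_pow_ne0 1) as E. simpl in E.
  replace (mu * lev z - A (iter (S n) F z) / mu ^ n) with
    (mu * (lev z - A (iter (S n) F z) / mu ^ S n)).
  - rewrite Rabs_mult, Rmult_assoc. apply Rmult_le_compat_l; [apply Rabs_pos|].
    eapply Rle_trans; [apply H|]. rpos (lev z - A (iter (S n) F z) / mu ^ S n).
    pose proof (pow_lt (/ 2) n ltac:(lra)). simpl in *. nra.
  - simpl. field. split; [apply mu_pow_ne0|lra].
Qed.

Lemma lev_Fn n z : lev (iter n F z) = mu ^ n * lev z.
Proof. induction n; simpl; [ring|]. rewrite lev_F, IHn. ring. Qed.

Lemma lev_add_lattice z k : lattice k -> lev (vadd z k) = lev z + A k.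
Proof.
  intros Hk. destruct lev_spec as [C H]. apply lev_unique with C. intros n.
  rewrite Fn_add_lattice, dot_add, A_Mn by auto.
  replace (lev z + A k - (A (iter n F z) + mu ^ n * A k) / mu ^ n) with
    (lev z - A (iter n F z) / mu ^ n); auto.
  field. apply mu_pow_ne0.
Qed.

Lemma lev_sub_lattice z k : lattice k -> lev (vsub z k) = lev z - A k.
Proof.
  intros Hk. replace (lev z) with (lev (vadd (vsub z k) k)) by (f_equal; vring).
  rewrite lev_add_lattice; auto. ring.
Qed.

Lemma lev_cont z eps : 0 < eps ->
  exists delta, 0 < delta /\ forall x, dist x z < delta -> Rabs (lev x - lev z) < eps.
Proof.
  intros He. destruct lev_spec as [C H].
  destruct (pow_small (/ 2) C (eps / 3)) as [N HN]; [lra|lra|]. specialize (HN N (Nat.le_refl N)).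
  destruct (Fn_cont N z (eps / (3 * (n1 pA + 1)))) as [d [Hd Hf]].
  { apply Rdiv_lt_0_compat; auto. npos pA. lra. }
  exists d. split; auto. intros x Hx. specialize (Hf x Hx).
  pose proof (H x N) as Hx'. pose proof (H z N) as Hz'.
  pose proof (Rabs_tri_minus (lev x) (A (iter N F x) / mu ^ N) (lev z)).
  pose proof (Rabs_tri_minus (A (iter N F x) / mu ^ N) (A (iter N F z) / mu ^ N) (lev z)).
  rewrite (Rabs_minus_sym (A (iter N F z) / mu ^ N) (lev z)) in *.
  assert (Rabs (A (iter N F x) / mu ^ N - A (iter N F z) / mu ^ N) < eps / 3); [|lra].
  replace (A (iter N F x) / mu ^ N - A (iter N F z) / mu ^ N) with
    ((A (iter N F x) - A (iter N F z)) * / mu ^ N) by (unfold Rdiv; ring).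
  rewrite Rabs_mult, Rabs_inv.
  apply Rle_lt_trans with (Rabs (A (iter N F x) - A (iter N F z))).
  - rewrite <- (Rmult_1_r (Rabs (A (iter N F x) - A (iter N F z)))) at 2.
    apply Rmult_le_compat_l; [apply Rabs_pos|]. rewrite <- Rinv_1. apply Rinv_le_contravar; [lra|].
    pose proof (mu_pow_ge N). pose proof (pow_R1_Rle 2 N ltac:(lra)). lra.
  - pose proof (dot_dist pA (iter N F x) (iter N F z)). npos pA.
    pose proof (dist_pos (iter N F x) (iter N F z)).
    apply mul_lt_of_lt_div in Hf; [|lra]. lra.
Qed.

Lemma Fn_cone n x y : inC (vsub x y) ->
  inC (vsub (iter n F x) (iter n F y)) /\
  K ^ n * Rabs (A (vsub x y)) <= Rabs (A (vsub (iter n F x) (iter n F y))).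
Proof. apply (Tn_cone pA pB alpha F K K_gt1 F_cone). Qed.

(** Equal levels stay equal, so the [A] coordinates of the two orbits differ by at most [2 C] for
    all time, whereas the cone multiplies their difference by [K^n]. *)
Lemma lev_inj x y : inC (vsub x y) -> lev x = lev y -> x = y.
Proof.
  intros Hc E. destruct lev_near_ex as [C H].
  assert (Hb : forall n, Rabs (A (vsub x y)) <= 2 * C * (/ K) ^ n).
  { intros n. destruct (Fn_cone n x y Hc) as [_ Hn]. rewrite (dot_sub pA (iter n F x)) in Hn.
    pose proof (H (iter n F x)) as E1. pose proof (H (iter n F y)) as E2.
    rewrite lev_Fn in E1, E2. rewrite <- E in E2.
    pose proof (Rabs_tri_minus (A (iter n F x)) (mu ^ n * lev x) (A (iter n F y))) as T.
    rewrite (Rabs_minus_sym (A (iter n F x)) (mu ^ n * lev x)) in T.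
    assert (P : 0 < K ^ n) by (apply pow_lt; lra). rewrite pow_inv.
    apply Rmult_le_reg_l with (K ^ n); auto.
    replace (K ^ n * (2 * C * / K ^ n)) with (2 * C) by (field; lra). lra. }
  assert (E0 : Rabs (A (vsub x y)) = 0).
  { apply Rle_antisym; [|apply Rabs_pos]. apply Rnot_lt_le. intros L.
    destruct (pow_small (/ K) (2 * C) (Rabs (A (vsub x y)))) as [N HN]; auto.
    { split; [apply Rlt_le, Rinv_0_lt_compat; lra|]. rewrite <- Rinv_1. apply Rinv_lt_contravar; lra. }
    specialize (HN N (Nat.le_refl N)). specialize (Hb N). lra. }
  apply dist_eq. apply Rle_antisym; [|apply dist_pos]. unfold dist.
  pose proof (in_cone_bound pA pB alpha alpha_pos coord_indep _ Hc) as H1. rewrite E0 in H1. lra.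
Qed.

Local Notation leafpt' := (leafpt pB lev).

Lemma lev_leafpt c b : lev (leafpt' c b) = c.
Proof. destruct lev_near_ex as [C H]. apply (leafpt_h pA pB coord_indep lev C lev_cont H). Qed.

Lemma B_leafpt c b : B (leafpt' c b) = b.
Proof. destruct lev_near_ex as [C H]. apply (leafpt_B pA pB coord_indep lev C lev_cont H). Qed.

Lemma leafpt_lev z : leafpt' (lev z) (B z) = z.
Proof.
  destruct lev_near_ex as [C H].
  apply (leafpt_of pA pB alpha alpha_pos coord_indep lev C lev_cont H lev_inj).
Qed.

Lemma leafpt_lip c b b' : dist (leafpt' c b) (leafpt' c b') <= cst * Rabs (b - b').
Proof.
  destruct lev_near_ex as [C H].
  apply (leafpt_dist pA pB alpha alpha_pos coord_indep lev C lev_cont H lev_inj).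
Qed.

Lemma lev_B_eq x y : lev x = lev y -> B x = B y -> x = y.
Proof. apply (leaf_eq pA pB alpha alpha_pos lev lev_inj). Qed.

Lemma lev_dist x y : lev x = lev y -> dist x y <= cst * Rabs (B x - B y).
Proof. apply (leaf_dist pA pB alpha alpha_pos coord_indep lev lev_inj). Qed.

Lemma lev_out x y : lev x = lev y -> alpha * Rabs (A (vsub x y)) <= Rabs (B (vsub x y)).
Proof. apply (leaf_out pA pB alpha lev lev_inj). Qed.

Lemma cst_pos : 0 < cst.
Proof. apply ccst_pos; auto. Qed.

Lemma lev_close q eps : 0 < eps -> exists delta, 0 < delta /\
  forall x, inC (vsub x q) -> Rabs (lev x - lev q) < delta -> dist x q < eps.
Proof.
  destruct lev_near_ex as [C H].
  apply (cone_level_close pA pB alpha alpha_pos coord_indep lev C lev_cont H lev_inj).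
Qed.

Lemma leaf_map_continuity f c : (forall z, cont_at f z) -> continuity (fun b => B (f (leafpt' c b))).
Proof.
  intros Hf. apply continuity_eps. intros s eps He. pose proof cst_pos. npos pB.
  destruct (Hf (leafpt' c s) (eps / (n1 pB + 1))) as [d [Hd H1]]; [apply Rdiv_lt_0_compat; lra|].
  exists (d / cst). split; [apply Rdiv_lt_0_compat; auto|].
  intros t Ht. assert (Hl : dist (leafpt' c t) (leafpt' c s) < d).
  { eapply Rle_lt_trans; [apply leafpt_lip|].
    apply mul_lt_of_lt_div in Ht; [|lra]. auto. }
  specialize (H1 _ Hl). eapply Rle_lt_trans; [apply dot_dist|].
  apply mul_lt_of_lt_div in H1; [|lra].
  pose proof (dist_pos (f (leafpt' c t)) (f (leafpt' c s))). lra.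
Qed.

(* [F] preserves levels, and on a level it is a locally injective map of the line. *)
Lemma F_inj x y : F x = F y -> x = y.
Proof.
  intros E.
  assert (El : lev x = lev y).
  { apply Rmult_eq_reg_l with mu; [rewrite <- !lev_F, E; auto|].
    pose proof (mu_pow_ne0 1) as H. simpl in H. lra. }
  apply lev_B_eq; auto.
  apply (local_injective_real (fun b => B (F (leafpt' (lev x) b)))).
  - apply (leaf_map_continuity F), F_cont.
  - intros t. destruct (F_loc_lower (leafpt' (lev x) t)) as [c [d [Hc [Hd Hl]]]].
    pose proof cst_pos.
    exists (d / cst). split; [apply Rdiv_lt_0_compat; auto|].
    assert (Hn : forall s, Rabs (s - t) < d / cst ->
              dist (leafpt' (lev x) s) (leafpt' (lev x) t) < d).
    { intros s Hs. eapply Rle_lt_trans; [apply leafpt_lip|].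
      apply mul_lt_of_lt_div in Hs; [|lra]. auto. }
    intros s s' Hs Hs' Es. specialize (Hl _ _ (Hn s Hs) (Hn s' Hs')).
    assert (Ef : F (leafpt' (lev x) s) = F (leafpt' (lev x) s')).
    { apply lev_B_eq; auto. rewrite !lev_F, !lev_leafpt. auto. }
    rewrite Ef, dist_refl in Hl.
    pose proof (dist_pos (leafpt' (lev x) s) (leafpt' (lev x) s')) as Hp.
    assert (E' : leafpt' (lev x) s = leafpt' (lev x) s') by (apply dist_eq; nra).
    rewrite <- (B_leafpt (lev x) s), E'. apply B_leafpt.
  - rewrite leafpt_lev, E. rewrite El, leafpt_lev. auto.
Qed.

Definition Finv (y : vec) : vec := epsilon (inhabits zero) (fun z => F z = y).

Lemma F_Finv y : F (Finv y) = y.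
Proof. apply (epsilon_spec (inhabits zero) (fun z => F z = y)), F_surj. Qed.

Lemma Finv_F z : Finv (F z) = z.
Proof. apply F_inj, F_Finv. Qed.

(** By properness the preimages of a convergent sequence are bounded, and any limit point is the
    unique preimage of the limit. *)
Lemma Finv_cont y : cont_at Finv y.
Proof.
  intros eps He. apply NNPP. intros Hno.
  assert (Hex : forall n : nat, exists x, dist x y < / INR (S n) /\ eps <= dist (Finv x) (Finv y)).
  { intros n. apply NNPP. intros Hn. apply Hno. exists (/ INR (S n)). split; [apply inv_INR_pos|].
    intros x Hx. apply Rnot_le_lt. intros L. apply Hn. eauto. }
  destruct (nat_choice _ Hex) as [u Hu].
  destruct F_proper as [c [C [Hc HF]]].
  destruct (bounded_vsubseq (fun n => Finv (u n)) ((n1 y + 1 + C) / c)) as [z [phi [Hphi Hz]]].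
  { intros n. apply Rmult_le_reg_l with c; auto.
    replace (c * ((n1 y + 1 + C) / c)) with (n1 y + 1 + C) by (field; lra).
    eapply Rle_trans; [apply HF|]. rewrite F_Finv. destruct (Hu n) as [U _].
    pose proof (inv_INR_le1 n).
    pose proof (n1_add (vsub (u n) y) y) as T. unfold dist in U.
    replace (vadd (vsub (u n) y) y) with (u n) in T by vring. lra. }
  assert (Ez : z = Finv y).
  { apply F_inj. rewrite F_Finv.
    apply (vcv_unique (fun n => F (Finv (u (phi n))))).
    - apply (cont_at_vcv F (fun n => Finv (u (phi n)))); auto. apply F_cont.
    - intros e Hep. destruct (inv_INR_small e Hep) as [N HN]. exists N. intros n Hn. rewrite F_Finv.
      destruct (Hu (phi n)) as [U _]. pose proof (subseq_mono phi Hphi n).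
      specialize (HN (phi n) ltac:(lia)). lra. }
  destruct (Hz eps He) as [N HN]. specialize (HN N (Nat.le_refl N)). rewrite Ez in HN.
  destruct (Hu (phi N)) as [_ U]. lra.
Qed.

Lemma Finv_loclip y : loclip Finv y.
Proof.
  destruct (F_loc_lower (Finv y)) as [c [d [Hc [Hd Hl]]]].
  destruct (Finv_cont y d Hd) as [e [He Hi]].
  exists (/ c), e. split; [apply Rinv_0_lt_compat; auto|]. split; auto.
  intros x x' Hx Hx'. specialize (Hl _ _ (Hi x Hx) (Hi x' Hx')). rewrite !F_Finv in Hl.
  apply Rmult_le_reg_l with c; auto. rewrite <- Rmult_assoc, Rinv_r by lra. lra.
Qed.

Lemma Finvn_loclip n z : loclip (iter n Finv) z.
Proof. apply loclip_iter, Finv_loclip. Qed.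

Lemma Finvn_cont n z : cont_at (iter n Finv) z.
Proof. apply loclip_cont, Finvn_loclip. Qed.

Lemma Fn_Finvn n z : iter n F (iter n Finv z) = z.
Proof. apply iter_cancel, F_Finv. Qed.

Lemma Finvn_Fn n z : iter n Finv (iter n F z) = z.
Proof. apply iter_cancel, Finv_F. Qed.

(** The pointwise strict inequality [D_center] becomes uniform by compactness: pairs violating it at
    smaller and smaller scales, reduced modulo the lattice, would produce a point and a unit
    direction violating it. *)
Lemma F_center : exists K1 delta, 1 <= K1 < K /\ 0 < delta /\ forall x y, dist x y < delta ->
  alpha * Rabs (A (vsub x y)) <= Rabs (B (vsub x y)) ->
  vnorm (vsub (F x) (F y)) <= K1 * vnorm (vsub x y).
Proof.
  apply NNPP. intros Hno.
  (* Factors in [[1, K)] tending to [K], so that violation of all of them gives expansion by [K] in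
     the limit. *)
  pose (K1 := fun n : nat => K - (K - 1) * / INR (S n)).
  assert (HK1 : forall n, 1 <= K1 n < K).
  { intros n. unfold K1. pose proof (inv_INR_pos n). pose proof (inv_INR_le1 n). nra. }
  assert (Hex : forall n : nat, exists xy : vec * vec, n1 (fst xy) <= 2 /\
     dist (fst xy) (snd xy) < / INR (S n) /\
     alpha * Rabs (A (vsub (fst xy) (snd xy))) <= Rabs (B (vsub (fst xy) (snd xy))) /\
     K1 n * vnorm (vsub (fst xy) (snd xy)) < vnorm (vsub (F (fst xy)) (F (snd xy)))).
  { intros n. apply NNPP. intros Hn. apply Hno. exists (K1 n), (/ INR (S n)).
    split; [apply HK1|]. split; [apply inv_INR_pos|]. intros x y Hd Hc. apply Rnot_lt_le. intros L.
    apply Hn. destruct (lattice_reduce x) as [k [Hk Hx]].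
    exists (vsub x k, vsub y k); simpl. split; auto. rewrite dist_subr. split; auto.
    replace (vsub (vsub x k) (vsub y k)) with (vsub x y) by vring. split; auto.
    assert (Es : forall z, F (vsub z k) = vadd (F z) (mv M (vscale (-1) k))).
    { intros z. replace (vsub z k) with (vadd z (vscale (-1) k)) by vring.
      apply F_add_lattice, lattice_opp; auto. }
    rewrite !Es.
    replace (vsub (vadd (F x) (mv M (vscale (-1) k))) (vadd (F y) (mv M (vscale (-1) k)))) with
      (vsub (F x) (F y)) by vring. auto. }
  destruct (nat_choice _ Hex) as [u Hu].
  assert (Hpos : forall n, 0 < n1 (vsub (fst (u n)) (snd (u n)))).
  { intros n. apply n1_gt0. intros E. destruct (Hu n) as [_ [_ [_ U]]]. rewrite E in U.
    assert (E2 : fst (u n) = snd (u n)) by (apply dist_eq; unfold dist; rewrite E; apply n1_zero).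
    rewrite E2 in U. replace (vsub (F (snd (u n))) (F (snd (u n)))) with (vscale 0 zero) in U by vring.
    rewrite vnorm_scale, Rabs_R0 in U. pose proof (HK1 n). pose proof (vnorm_pos zero). nra. }
  pose (w := fun n => vscale (/ n1 (vsub (fst (u n)) (snd (u n)))) (vsub (fst (u n)) (snd (u n)))).
  assert (Hw1 : forall n, n1 (w n) = 1).
  { intros n. unfold w. specialize (Hpos n).
    rewrite n1_scale, Rabs_pos_eq by (apply Rlt_le, Rinv_0_lt_compat; auto). field. lra. }
  (* Extracting the first point and the unit direction suffices: the second point merges with the
     first. *)
  destruct (bounded_vsubseq (fun n => fst (u n)) 2) as [z [p1 [Hp1 Hz]]]; [apply Hu|].
  destruct (bounded_vsubseq (fun n => w (p1 n)) 1) as [v [p2 [Hp2 Hv]]].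
  { intros n. rewrite Hw1. lra. }
  pose (p := fun n => p1 (p2 n)).
  assert (Hp : forall n, (n <= p n)%nat).
  { intros n. unfold p. pose proof (subseq_mono p1 Hp1 (p2 n)). pose proof (subseq_mono p2 Hp2 n). lia. }
  assert (Hz' : vcv (fun n => fst (u (p n))) z) by (apply (vcv_subseq (fun n => fst (u (p1 n)))); auto).
  change (vcv (fun n => w (p n)) v) in Hv.
  (* the unit limit direction [v] lies outside the open cone and is expanded at least by K *)
  assert (Hv0 : v <> zero).
  { intros E. destruct (Hv 1) as [N HN]; [lra|]. specialize (HN N (Nat.le_refl N)).
    cbv beta in HN. rewrite E in HN. unfold dist in HN.
    replace (vsub (w (p N)) zero) with (w (p N)) in HN by vring.
    rewrite Hw1 in HN. lra. }
  assert (Hout : alpha * Rabs (A v) <= Rabs (B v)).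
  { apply Rnot_lt_le. intros L. set (g := alpha * Rabs (A v) - Rabs (B v)).
    set (q := n1 pB + alpha * n1 pA + 1).
    assert (Q : 0 < q) by (unfold q; npos pA; npos pB; nra).
    destruct (Hv (g / q)) as [N HN]; [apply Rdiv_lt_0_compat; unfold g; lra|].
    specialize (HN N (Nat.le_refl N)). cbv beta in HN.
    apply mul_lt_of_lt_div in HN; [|lra].
    destruct (Hu (p N)) as [_ [_ [U _]]].
    assert (Ow : alpha * Rabs (A (w (p N))) <= Rabs (B (w (p N)))).
    { unfold w. rewrite !dot_scale, !Rabs_mult.
      set (s := Rabs (/ n1 (vsub (fst (u (p N))) (snd (u (p N)))))).
      assert (0 <= s) by apply Rabs_pos. nra. }
    pose proof (dot_dist pA (w (p N)) v) as EA. pose proof (dot_dist pB (w (p N)) v) as EB.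
    pose proof (Rabs_triang_inv (B (w (p N))) (B v)).
    pose proof (Rabs_triang_inv (A v) (A (w (p N)))). rewrite (Rabs_minus_sym (A v)) in *.
    pose proof (dist_pos (w (p N)) v). unfold q, g in *. nra. }
  pose proof (D_center z v Hv0 ltac:(lra)) as Hlt.
  set (g := K * vnorm v - vnorm (mv (D z) v)).
  assert (Hg : 0 < g) by (unfold g; lra).
  (* The errors below add up to at most [(K + mnorm (D z) + 2) e], which is [g / 4]. *)
  set (e := g / (4 * (K + mnorm (D z) + 2))). pose proof (mnorm_pos (D z)).
  assert (He : 0 < e) by (apply Rdiv_lt_0_compat; lra).
  assert (Eg : 4 * (e * (K + mnorm (D z) + 2)) = g) by (unfold e; field; lra).
  destruct (F_sder z e He) as [d [Hd HS]].
  destruct (Hv e He) as [N1 HN1]. destruct (Hz' (d / 2)) as [N2 HN2]; [lra|].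
  destruct (inv_INR_small (Rmin (d / 2) (e / (K * (vnorm v + e + 1))))) as [N3 HN3].
  { apply Rmin_pos; [lra|]. apply Rdiv_lt_0_compat; auto. pose proof (vnorm_pos v). nra. }
  set (n := (N1 + N2 + N3)%nat).
  specialize (HN1 n ltac:(lia)). specialize (HN2 n ltac:(lia)). cbv beta in *.
  specialize (HN3 (p n) ltac:(pose proof (Hp n); lia)).
  pose proof (Rmin_l (d / 2) (e / (K * (vnorm v + e + 1)))).
  pose proof (Rmin_r (d / 2) (e / (K * (vnorm v + e + 1)))).
  destruct (Hu (p n)) as [_ [U2 [_ U4]]]. specialize (Hpos (p n)).
  set (x := fst (u (p n))) in *. set (y := snd (u (p n))) in *.
  assert (Hy : dist y z < d).
  { pose proof (dist_tri y x z). rewrite (dist_sym y x) in *. lra. }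
  specialize (HS x y ltac:(lra) Hy).
  set (r := n1 (vsub x y)) in *.
  assert (Ew : vsub x y = vscale r (w (p n))).
  { unfold w. fold x y r. unfold vscale; simpl. apply injective_projections; simpl; field; lra. }
  set (er := vsub (vsub (F x) (F y)) (mv (D z) (vsub x y))) in *.
  assert (EF : vsub (F x) (F y) = vadd (vscale r (mv (D z) (w (p n)))) er).
  { unfold er. rewrite Ew, mv_scale. vring. }
  assert (L1 : vnorm (vsub (F x) (F y)) <= r * vnorm (mv (D z) (w (p n))) + e * r).
  { rewrite EF. eapply Rle_trans; [apply vnorm_add|]. rewrite vnorm_scale, Rabs_pos_eq by lra.
    pose proof (vnorm_le_n1 er). unfold dist in HS. fold r in HS. lra. }
  assert (Hwv : vnorm (vsub v (w (p n))) <= e).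
  { eapply Rle_trans; [apply vnorm_le_n1|]. fold (dist v (w (p n))). rewrite dist_sym. lra. }
  assert (L2 : vnorm (mv (D z) (w (p n))) <= vnorm (mv (D z) v) + mnorm (D z) * e).
  { replace (mv (D z) (w (p n))) with (vadd (mv (D z) v) (mv (D z) (vsub (w (p n)) v))) by vring.
    eapply Rle_trans; [apply vnorm_add|]. apply Rplus_le_compat_l.
    eapply Rle_trans; [apply vnorm_le_n1|]. eapply Rle_trans; [apply mv_le|].
    apply Rmult_le_compat_l; auto. unfold dist in HN1. lra. }
  assert (L3 : vnorm v <= vnorm (w (p n)) + e).
  { replace v with (vadd (w (p n)) (vsub v (w (p n)))) at 1 by vring.
    eapply Rle_trans; [apply vnorm_add|]. lra. }
  assert (L4 : vnorm (w (p n)) <= vnorm v + e).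
  { replace (w (p n)) with (vadd v (vscale (-1) (vsub v (w (p n))))) by vring.
    eapply Rle_trans; [apply vnorm_add|]. rewrite vnorm_scale.
    replace (Rabs (-1)) with 1 by (rewrite Rabs_left; lra). lra. }
  rewrite Ew, vnorm_scale, Rabs_pos_eq in U4 by lra.
  assert (L5 : K1 (p n) * vnorm (w (p n)) < vnorm (mv (D z) v) + mnorm (D z) * e + e).
  { apply Rmult_lt_reg_l with r; auto. nra. }
  assert (L6 : (K - K1 (p n)) * vnorm (w (p n)) <= e).
  { unfold K1. replace (K - (K - (K - 1) * / INR (S (p n)))) with ((K - 1) * / INR (S (p n))) by ring.
    assert (HI : / INR (S (p n)) <= e / (K * (vnorm v + e + 1))) by lra.
    pose proof (vnorm_pos v). pose proof (vnorm_pos (w (p n))). pose proof (inv_INR_pos (p n)).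
    apply Rmult_le_compat_r with (r := K * (vnorm v + e + 1)) in HI; [|nra].
    replace (e / (K * (vnorm v + e + 1)) * (K * (vnorm v + e + 1))) with e in HI by (field; nra).
    apply Rle_trans with (/ INR (S (p n)) * (K * (vnorm v + e + 1))); auto.
    replace ((K - 1) * / INR (S (p n)) * vnorm (w (p n))) with
      (/ INR (S (p n)) * ((K - 1) * vnorm (w (p n)))) by ring.
    apply Rmult_le_compat_l; [lra|]. nra. }
  unfold g in *. nra.
Qed.

(** * Powers of [F] composed with translations *)

(* The lifts of the powers of the torus map. *)
Definition shifted (n : nat) (k z : vec) : vec := vsub (iter n F z) k.
Definition shifted_inv (n : nat) (k z : vec) : vec := iter n Finv (vadd z k).
(** The solution of [mu^n h - A k = h], the level carried to itself by [shifted n k]. *)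
Definition fixed_level (n : nat) (k : vec) : R := A k / (mu ^ n - 1).

Lemma shifted_K n k z : shifted n k (shifted_inv n k z) = z.
Proof. unfold shifted, shifted_inv. rewrite Fn_Finvn. vring. Qed.

Lemma shifted_invK n k z : shifted_inv n k (shifted n k z) = z.
Proof.
  unfold shifted, shifted_inv. replace (vadd (vsub (iter n F z) k) k) with (iter n F z) by vring.
  apply Finvn_Fn.
Qed.

Lemma shifted_loclip n k z : loclip (shifted n k) z.
Proof.
  replace (shifted n k) with (fun x => vadd (iter n F x) (vscale (-1) k)).
  - apply (loclip_comp (iter n F) (fun x => vadd x (vscale (-1) k)));
      [apply Fn_loclip|apply loclip_shift].
  - unfold shifted. apply functional_extensionality. intros x. vring.
Qed.

Lemma shifted_inv_loclip n k z : loclip (shifted_inv n k) z.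
Proof.
  apply (loclip_comp (fun x => vadd x k) (iter n Finv));
    [apply loclip_shift|apply Finvn_loclip].
Qed.

Lemma shifted_cont n k z : cont_at (shifted n k) z.
Proof. apply loclip_cont, shifted_loclip. Qed.

Lemma shifted_inv_cont n k z : cont_at (shifted_inv n k) z.
Proof. apply loclip_cont, shifted_inv_loclip. Qed.

Lemma shifted_cone n k x y : inC (vsub x y) ->
  inC (vsub (shifted n k x) (shifted n k y)) /\
  K ^ n * Rabs (A (vsub x y)) <= Rabs (A (vsub (shifted n k x) (shifted n k y))).
Proof.
  intros H. unfold shifted.
  replace (vsub (vsub (iter n F x) k) (vsub (iter n F y) k)) with
    (vsub (iter n F x) (iter n F y)) by vring. apply Fn_cone; auto.
Qed.

Lemma mu_pow_ne1 n : (1 <= n)%nat -> mu ^ n - 1 <> 0.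
Proof.
  intros Hn E. pose proof (mu_pow_ge n). replace (mu ^ n) with 1 in * by lra. rewrite Rabs_R1 in *.
  assert (2 ^ 1 <= 2 ^ n) by (apply Rle_pow; [lra|auto]). lra.
Qed.

Lemma shifted_lev n k z : lattice k -> lev (shifted n k z) = mu ^ n * lev z - A k.
Proof. intros Hk. unfold shifted. rewrite lev_sub_lattice, lev_Fn; auto. Qed.

Lemma shifted_fixed_level n k z : (1 <= n)%nat -> lattice k ->
  lev (shifted n k z) - fixed_level n k = mu ^ n * (lev z - fixed_level n k).
Proof.
  intros Hn Hk. rewrite shifted_lev by auto. unfold fixed_level. field. apply mu_pow_ne1; auto.
Qed.

(** The translations accumulate through powers of [M] and stay in the lattice; this brings
    statements about the lifts back to the torus. *)
Lemma shifted_iter n k j : lattice k -> exists k', lattice k' /\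
  forall z, iter j (shifted n k) z = vsub (iter (n * j) F z) k'.
Proof.
  intros Hk. induction j as [|j [k' [Hk' IH]]].
  - exists zero. split; [exists 0%Z, 0%Z; auto|]. intros z. rewrite Nat.mul_0_r. simpl. vring.
  - exists (vadd k (iter n (mv M) k')). split; [apply lattice_add; auto; apply Mn_lattice; auto|].
    intros z. simpl. rewrite IH. unfold shifted.
    replace (vsub (iter (n * j) F z) k') with (vadd (iter (n * j) F z) (vscale (-1) k')) by vring.
    rewrite Fn_add_lattice by (apply lattice_opp; auto). rewrite <- Nat.iter_add.
    replace (n * S j)%nat with (n + n * j)%nat by lia.
    assert (E : forall v, iter n (mv M) (vscale (-1) v) = vscale (-1) (iter n (mv M) v)).
    { clear. intros v. induction n; simpl; auto. rewrite IHn. apply mv_scale. }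
    rewrite E. vring.
Qed.

Lemma Fn_center n : (1 <= n)%nat -> exists k1 delta, k1 < K ^ n /\ 0 < delta /\
  forall x y, dist x y < delta -> lev x = lev y ->
    vnorm (vsub (iter n F x) (iter n F y)) <= k1 * vnorm (vsub x y).
Proof.
  intros Hn. destruct F_center as [K1 [d [HK1 [Hd H]]]].
  (* Small enough that all intermediate distances remain below [d]; the 2 pays for the change of
     norm. *)
  exists (K1 ^ n), (d / (2 * K1 ^ n)).
  assert (P : forall j, 1 <= K1 ^ j) by (intros j; apply pow_R1_Rle; lra).
  assert (Hlt : forall j, K1 ^ S j < K ^ S j).
  { induction j; [simpl; lra|]. specialize (P (S j)). simpl in *. nra. }
  split; [destruct n; [lia|apply Hlt]|]. specialize (P n) as Pn.
  split; [apply Rdiv_lt_0_compat; lra|]. intros x y Hxy E.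
  assert (Hj : forall j, (j <= n)%nat ->
    vnorm (vsub (iter j F x) (iter j F y)) <= K1 ^ j * vnorm (vsub x y)).
  { induction j; intros Hj; [simpl; lra|]. specialize (IHj ltac:(lia)). simpl iter.
    eapply Rle_trans.
    - apply H.
      + eapply Rle_lt_trans; [apply n1_le_vnorm|]. pose proof (vnorm_le_n1 (vsub x y)) as V.
        fold (dist x y) in V. pose proof (vnorm_pos (vsub x y)).
        assert (K1 ^ j <= K1 ^ n) by (apply Rle_pow; [lra|lia]).
        apply mul_lt_of_lt_div in Hxy; [|lra].
        apply Rle_lt_trans with (2 * (K1 ^ j * vnorm (vsub x y))); [lra|].
        apply Rle_lt_trans with (2 * K1 ^ n * dist x y); auto.
        rewrite Rmult_assoc. apply Rmult_le_compat_l; [lra|].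
        apply Rmult_le_compat; auto. specialize (P j). lra.
      + apply lev_out. rewrite !lev_Fn, E. auto.
    - simpl. rewrite Rmult_assoc. apply Rmult_le_compat_l; lra. }
  apply Hj. auto.
Qed.

Lemma mu_pow_pow_ge n j : (1 <= n)%nat -> 2 ^ j <= Rabs ((mu ^ n) ^ j).
Proof. intros Hn. rewrite <- pow_mult. eapply Rle_trans; [|apply mu_pow_ge]. apply Rle_pow; [lra|nia]. Qed.

(** * Unstable sets of the lifts *)

Section Backward_orbits.
Variables (n : nat) (k : vec).
Hypothesis n_pos : (1 <= n)%nat.
Hypothesis k_lat : lattice k.
Local Notation T := (shifted n k).
Local Notation Ti := (shifted_inv n k).

Lemma Kn_gt1 : 1 < K ^ n.
Proof.
  destruct n; [lia|]. simpl. pose proof (pow_R1_Rle K n0 ltac:(lra)). nra.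
Qed.

Lemma mun_gt1 : 1 < Rabs (mu ^ n).
Proof.
  pose proof (mu_pow_pow_ge n 1 n_pos) as H. rewrite !pow_1 in H. lra.
Qed.

Lemma back_ex x c : exists y, lev y = c /\
  forall j, inC (vsub (iter j Ti x) (iter j Ti y)).
Proof.
  destruct lev_near_ex as [C H].
  apply (unstable_ex pA pB alpha alpha_pos coord_indep lev C lev_cont H T Ti (K ^ n) (mu ^ n)
    (fixed_level n k)).
  - apply shifted_K.
  - apply shifted_invK.
  - apply shifted_inv_cont.
  - apply Kn_gt1.
  - apply mun_gt1.
  - apply shifted_cone.
  - intros z. apply shifted_fixed_level; auto.
Qed.

Lemma back_dist x y j : (forall j, inC (vsub (iter j Ti x) (iter j Ti y))) ->
  (K ^ n) ^ j * dist (iter j Ti x) (iter j Ti y) <= cst * n1 pA * dist x y.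
Proof.
  intros H. apply (unstable_asym pA pB alpha alpha_pos coord_indep T Ti (K ^ n)); auto.
  - apply shifted_K.
  - apply Kn_gt1.
  - apply shifted_cone.
Qed.

Lemma back_dist_le x y j : (forall j, inC (vsub (iter j Ti x) (iter j Ti y))) ->
  dist (iter j Ti x) (iter j Ti y) <= cst * n1 pA * dist x y.
Proof.
  intros H. pose proof (back_dist x y j H). pose proof Kn_gt1.
  pose proof (pow_R1_Rle (K ^ n) j ltac:(lra)).
  pose proof (dist_pos (iter j Ti x) (iter j Ti y)). nra.
Qed.

Lemma back_tendsto x y Cst eps : 0 < eps ->
  (forall j, (K ^ n) ^ j * dist (iter j Ti x) (iter j Ti y) <= Cst) ->
  exists N, forall j, (N <= j)%nat -> dist (iter j Ti x) (iter j Ti y) < eps.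
Proof. apply asym_tendsto, Kn_gt1. Qed.

Lemma back_eq x y Cst : lev x = lev y ->
  (forall j, (K ^ n) ^ j * dist (iter j Ti x) (iter j Ti y) <= Cst) -> x = y.
Proof.
  apply (asym_level_eq lev T Ti (K ^ n) (mu ^ n) (fixed_level n k)).
  - apply shifted_K.
  - apply Kn_gt1.
  - apply mun_gt1.
  - intros z. apply shifted_fixed_level; auto.
  - destruct (Fn_center n n_pos) as [k1 [d [Hk1 [Hd H]]]]. exists k1, d.
    split; auto. split; auto. intros a b Hab E. unfold shifted.
    replace (vsub (vsub (iter n F a) k) (vsub (iter n F b) k)) with
      (vsub (iter n F a) (iter n F b)) by vring. auto.
Qed.

Lemma back_level j z :
  (mu ^ n) ^ j * (lev (iter j Ti z) - fixed_level n k) = lev z - fixed_level n k.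
Proof.
  apply (Tinvn_level lev T).
  - apply shifted_K.
  - intros x. apply shifted_fixed_level; auto.
Qed.

Lemma back_level_tendsto z eps : 0 < eps ->
  exists N, forall j, (N <= j)%nat -> Rabs (lev (iter j Ti z) - fixed_level n k) < eps.
Proof.
  intros He. destruct (pow_small (/ 2) (Rabs (lev z - fixed_level n k)) eps) as [N HN]; [lra|auto|].
  exists N. intros j Hj. specialize (HN j Hj). eapply Rle_lt_trans; [|apply HN].
  rewrite <- (back_level j z), Rabs_mult.
  pose proof (mu_pow_pow_ge n j n_pos).
  pose proof (pow_lt 2 j ltac:(lra)). rewrite pow_inv.
  rpos (lev (iter j Ti z) - fixed_level n k).
  apply Rmult_le_reg_r with (2 ^ j); auto. rewrite Rmult_assoc, Rinv_l by lra. nra.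
Qed.

End Backward_orbits.

(** * The quasiperiodic curve is a level set *)

Section Curve.
Variables (p : nat) (gamma : R -> vec) (rho : R).
Hypothesis p_pos : (1 <= p)%nat.
Hypothesis gamma_quasi : quasiperiodic_curve M G p gamma rho.

Lemma gamma_rcont : rcont gamma.
Proof.
  intros s eps He. destruct gamma_quasi as [Hc _]. destruct (Hc s (eps / 2)) as [d [Hd H]]; [lra|].
  exists d. split; auto. intros t Ht. specialize (H t Ht).
  eapply Rle_lt_trans; [apply n1_le_vnorm|]. lra.
Qed.

Lemma gamma_iter (k0 : vec) : (forall s, gamma (s + 1) = vadd (gamma s) k0) ->
  forall (j : Z) s, gamma (s + IZR j) = vadd (gamma s) (vscale (IZR j) k0).
Proof.
  intros H.
  assert (Hn : forall (n : nat) s, gamma (s + INR n) = vadd (gamma s) (vscale (INR n) k0)).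
  { induction n; intros s.
    - simpl. rewrite Rplus_0_r. vring.
    - rewrite S_INR, <- Rplus_assoc, H, IHn. vring. }
  intros j s. destruct (Z_le_gt_dec 0 j) as [L|L].
  - rewrite <- (Z2Nat.id j L), <- INR_IZR_INZ. apply Hn.
  - pose proof (Hn (Z.to_nat (- j)) (s + IZR j)) as E.
    rewrite INR_IZR_INZ, Z2Nat.id, opp_IZR in E by lia.
    replace (s + IZR j + - IZR j) with s in E by ring. rewrite E. vring.
Qed.

(* The level along the curve satisfies [h (s + rho) = mu^p h s - A kT] and is periodic, hence
   constant; the curve closes up by a translation [k0 <> zero] and therefore fills the level set. *)
Lemma curve_structure : exists k0 kT, lattice k0 /\ k0 <> zero /\ lattice kT /\ A k0 = 0 /\
  (forall s, gamma (s + 1) = vadd (gamma s) k0) /\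
  (forall s, shifted p kT (gamma s) = gamma (s + rho)) /\
  (forall s, lev (gamma s) = fixed_level p kT) /\
  (forall z, lev z = fixed_level p kT -> exists s, z = gamma s) /\
  (forall s t, B (gamma s) = B (gamma t) -> s = t).
Proof.
  pose proof gamma_rcont as Hgc. destruct gamma_quasi as [_ [H1 [Hinj [_ Hrot]]]].
  destruct (lattice_difference_const (fun s => gamma (s + 1)) gamma) as [k0 [Lk0 Hk0]]; auto.
  { apply rcont_shift; auto. }
  destruct (lattice_difference_const (fun s => iter p F (gamma s)) (fun s => gamma (s + rho)))
    as [kT [LkT HkT]]; auto.
  { apply (rcont_comp gamma (iter p F)); auto. apply Fn_cont. }
  { apply rcont_shift; auto. }
  cbv beta in *.
  assert (HT : forall s, shifted p kT (gamma s) = gamma (s + rho)).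
  { intros s. unfold shifted. rewrite HkT. vring. }
  pose proof (mu_pow_ne1 p p_pos) as Hne.
  assert (Hlev : forall s, lev (gamma (s + rho)) = mu ^ p * lev (gamma s) - A kT).
  { intros s. rewrite <- HT. apply shifted_lev; auto. }
  (* Computing the level at parameter [1 + rho] in two ways gives [(mu^p - 1) A k0 = 0]. *)
  assert (HA : A k0 = 0).
  { pose proof (Hlev (0 + 1)) as E. replace (0 + 1 + rho) with (0 + rho + 1) in E by ring.
    rewrite !Hk0, !lev_add_lattice, Hlev in E by auto.
    assert (E' : (mu ^ p - 1) * A k0 = 0) by lra. apply Rmult_integral in E'. tauto. }
  pose proof (gamma_iter k0 Hk0) as Hit.
  assert (Hcst : forall s, lev (gamma s) = fixed_level p kT).
  { assert (Hlc : continuity (fun s => lev (gamma s))).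
    { apply continuity_eps. intros s eps He. destruct (lev_cont (gamma s) eps He) as [d [Hd H2]].
      destruct (Hgc s d Hd) as [e [Hep H3]]. exists e. split; auto. }
    destruct (continuity_ab_maj (fun s => lev (gamma s)) 0 1) as [sM [HM _]]; [lra|intros; apply Hlc|].
    destruct (continuity_ab_min (fun s => lev (gamma s)) 0 1) as [sm [Hm _]]; [lra|intros; apply Hlc|].
    set (h0 := fixed_level p kT) in *.
    set (Cb := Rabs (lev (gamma sM) - h0) + Rabs (lev (gamma sm) - h0)).
    (* Since [A k0 = 0], the level along the curve has period 1 and is bounded; rotation multiplies
       its deviation from [h0] by [mu^p], so the deviation is zero. *)
    assert (Hb : forall s, Rabs (lev (gamma s) - h0) <= Cb).
    { intros s. destruct (floor_ex s) as [j Hj].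
      replace s with (s - IZR j + IZR j) by ring. rewrite Hit.
      rewrite lev_add_lattice by (apply lattice_scale_Z; auto). rewrite dot_scale, HA.
      specialize (HM (s - IZR j) ltac:(lra)). specialize (Hm (s - IZR j) ltac:(lra)).
      unfold Cb. rpos (lev (gamma sM) - h0). rpos (lev (gamma sm) - h0).
      pose proof (Rle_abs (lev (gamma sM) - h0)). pose proof (Rle_abs (- (lev (gamma sm) - h0))).
      rewrite Rabs_Ropp in *. apply Rabs_le. lra. }
    assert (Hgr : forall (i : nat) s, lev (gamma (s + INR i * rho)) - h0 = (mu ^ p) ^ i * (lev (gamma s) - h0)).
    { induction i; intros s.
      - simpl. rewrite Rmult_0_l, Rplus_0_r. ring.
      - rewrite S_INR. replace (s + (INR i + 1) * rho) with (s + INR i * rho + rho) by ring.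
        rewrite <- HT. unfold h0. rewrite shifted_fixed_level by auto. fold h0. rewrite IHi. simpl. ring. }
    intros s. apply cond_eq. intros eps He.
    destruct (pow_small (/ 2) Cb eps) as [i Hi]; [lra|auto|]. specialize (Hi i (Nat.le_refl i)).
    specialize (Hgr i s). specialize (Hb (s + INR i * rho)). rewrite Hgr, Rabs_mult in Hb.
    pose proof (mu_pow_pow_ge p i p_pos).
    pose proof (pow_lt 2 i ltac:(lra)). rewrite pow_inv in Hi.
    rpos (lev (gamma s) - h0). eapply Rle_lt_trans; [|apply Hi].
    apply Rmult_le_reg_r with (2 ^ i); auto. rewrite Rmult_assoc, Rinv_l by lra. nra. }
  pose proof (rcont_dot gamma pB Hgc) as Hbc.
  assert (Hne0 : k0 <> zero).
  (* If [k0] were zero, [B] would be periodic along the curve and [psi] would take opposite values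
     at 0 and 1/2. A zero of [psi] identifies two parameters half a turn apart. *)
  { intros E0. pose (psi := fun s => B (gamma (s + 1 / 2)) - B (gamma s)).
    destruct (ivt_gen psi 0 (1 / 2) 0) as [s [_ Es]].
    - intros x. apply continuity_pt_minus; [|apply Hbc].
      apply (rcont_dot (fun s => gamma (s + 1 / 2))), rcont_shift; auto.
    - lra.
    - unfold psi. replace (1 / 2 + 1 / 2) with (0 + 1) by field. rewrite Hk0, E0.
      replace (vadd (gamma 0) zero) with (gamma 0) by vring.
      replace (0 + 1 / 2) with (1 / 2) by ring.
      pose proof (pow2_ge_0 (B (gamma (1 / 2)) - B (gamma 0))). simpl in *. lra.
    - unfold psi in Es.
      assert (E1 : gamma (s + 1 / 2) = gamma s) by (apply lev_B_eq; [rewrite !Hcst; auto|lra]).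
      destruct (Hinj (s + 1 / 2) s) as [j Hj]; [rewrite E1; apply eqT_refl|].
      assert (0 < j)%Z by (apply lt_IZR; lra). assert (j < 1)%Z by (apply lt_IZR; lra). lia. }
  assert (HB : B k0 <> 0).
  { intros E. apply Hne0. apply (coord_ext pA pB coord_indep); unfold zero; rewrite ?HA, ?E;
    unfold dot; simpl; ring. }
  exists k0, kT. repeat (split; auto).
  - intros z Ez.
    (* [B] grows by [B k0], non-zero, at each turn; after [n] turns either way its values enclose
       [B z]. *)
    destruct (INR_unbounded (Rabs (B z - B (gamma 0)) / Rabs (B k0))) as [n Hn].
    pose proof (Rabs_pos_lt _ HB) as PB.
    apply Rmult_lt_compat_r with (r := Rabs (B k0)) in Hn; auto.
    unfold Rdiv in Hn. rewrite Rmult_assoc, Rinv_l, Rmult_1_r in Hn by lra.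
    destruct (ivt_gen (fun s => B (gamma s)) (- INR n) (INR n) (B z)) as [s [_ Es]]; auto.
    + pose proof (pos_INR n). lra.
    + assert (Eg : forall j : Z, B (gamma (IZR j)) = B (gamma 0) + IZR j * B k0).
      { intros j. rewrite <- (Rplus_0_l (IZR j)) at 1. rewrite Hit, dot_add, dot_scale. auto. }
      pose proof (Eg (Z.of_nat n)) as Ep. pose proof (Eg (- Z.of_nat n)%Z) as En.
      rewrite opp_IZR, <- INR_IZR_INZ in En. rewrite <- INR_IZR_INZ in Ep. rewrite Ep, En.
      set (x := B z - B (gamma 0)) in *.
      assert (Hsq : Rabs x ^ 2 <= Rabs (INR n * B k0) ^ 2).
      { apply pow_incr. split; [apply Rabs_pos|]. rewrite Rabs_mult, (Rabs_pos_eq (INR n)) by apply pos_INR. lra. }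
      rewrite !pow2_abs in Hsq. unfold x in Hsq. nra.
    + exists s. apply lev_B_eq; [rewrite Hcst; auto|auto].
  - intros s t E.
    assert (E1 : gamma s = gamma t) by (apply lev_B_eq; [rewrite !Hcst; auto|lra]).
    destruct (Hinj s t) as [j Hj]; [rewrite E1; apply eqT_refl|].
    replace s with (t + IZR j) in E by lra. rewrite Hit, dot_add, dot_scale in E.
    assert (E2 : IZR j * B k0 = 0) by lra. apply Rmult_integral in E2. destruct E2; [lra|tauto].
Qed.

(** * Transitivity *)

Lemma lattice_A_ne0 : exists k, lattice k /\ A k <> 0.
Proof.
  destruct (Req_dec (fst pA) 0) as [E|E].
  - exists (0, 1). split; [exists 0%Z, 1%Z; auto|]. unfold dot; simpl. intros E2.
    apply coord_indep. rewrite E. replace (snd pA) with 0 by lra. ring.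
  - exists (1, 0). split; [exists 1%Z, 0%Z; auto|]. unfold dot; simpl. lra.
Qed.

(** A short segment in a cone direction joins two different levels. Iteration magnifies the gap
    beyond [|A kA|], and then some lattice translate of the level [c] is crossed. *)
Lemma level_hit x eps c : 0 < eps -> exists n u k, dist u x < eps /\ lattice k /\
  lev (iter n F u) = c + A k.
Proof.
  intros He. set (w := of_coord pA pB 1 0).
  assert (Aw : A w = 1) by (apply coord_A; auto). assert (Bw : B w = 0) by (apply coord_B; auto).
  npos w. set (t1 := eps / (2 * (n1 w + 1))).
  assert (Ht1 : 0 < t1) by (apply Rdiv_lt_0_compat; lra).
  assert (Et1 : 2 * (t1 * (n1 w + 1)) = eps) by (unfold t1; field; lra).
  set (x1 := vadd x (vscale t1 w)).
  assert (Hne : lev x1 <> lev x).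
  { intros E.
    assert (Hd : vsub x1 x = vscale t1 w) by (unfold x1; vring).
    assert (E1 : x1 = x).
    { apply lev_inj; auto. unfold in_cone. rewrite Hd, !dot_scale, Aw, Bw, Rmult_0_r, Rabs_R0.
      rpos (t1 * 1). nra. }
    assert (E2 : A (vscale t1 w) = 0) by (rewrite <- Hd, E1, dot_sub; ring).
    rewrite dot_scale, Aw in E2. lra. }
  destruct lattice_A_ne0 as [kA [HkA Ha]].
  set (g := Rabs (lev x - lev x1)). assert (Hg : 0 < g) by (apply Rabs_pos_lt; lra).
  destruct (pow_small (/ 2) (Rabs (A kA)) g) as [n Hn]; [lra|auto|]. specialize (Hn n (Nat.le_refl n)).
  assert (Hbig : Rabs (A kA) <= Rabs (mu ^ n * lev x - mu ^ n * lev x1)).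
  { rewrite <- Rmult_minus_distr_l, Rabs_mult. fold g. pose proof (mu_pow_ge n).
    pose proof (pow_lt 2 n ltac:(lra)). rewrite pow_inv in Hn.
    apply Rmult_lt_compat_r with (r := 2 ^ n) in Hn; auto.
    rewrite Rmult_assoc, Rinv_l in Hn by lra. nra. }
  destruct (multiple_between (A kA) c _ _ Ha Hbig) as [j Hj].
  destruct (ivt_gen (fun t => mu ^ n * lev (vadd x (vscale t w))) 0 t1 (c + IZR j * A kA)) as [t [Ht E]].
  - intros s. apply continuity_pt_scal.
    apply (continuity_eps (fun t => lev (vadd x (vscale t w)))). intros s' e Hep.
    destruct (lev_cont (vadd x (vscale s' w)) e Hep) as [d [Hd H1]].
    destruct (line_rcont x w s' d Hd) as [d' [Hd' H2]]. exists d'. split; auto.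
  - lra.
  - replace (vadd x (vscale 0 w)) with x by vring. exact Hj.
  - exists n, (vadd x (vscale t w)), (vscale (IZR j) kA). split; [|split].
    + unfold dist. replace (vsub (vadd x (vscale t w)) x) with (vscale t w) by vring.
      rewrite n1_scale, Rabs_pos_eq by lra. nra.
    + apply lattice_scale_Z; auto.
    + rewrite lev_Fn, dot_scale. auto.
Qed.

Lemma gamma_back kT : (forall s, shifted p kT (gamma s) = gamma (s + rho)) ->
  forall j s, iter j (shifted_inv p kT) (gamma s) = gamma (s - INR j * rho).
Proof.
  intros HT j s. induction j.
  - simpl. f_equal. ring.
  - rewrite Nat.iter_succ, IHj, S_INR. replace (s - INR j * rho) with (s - (INR j + 1) * rho + rho) by ring.
    rewrite <- HT. apply shifted_invK.
Qed.

(** The unstable set of [v] meets the invariant level, which is the curve; the meeting point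
    [gamma theta] shadows [v] backwards. *)
Lemma backward_to_curve kT v : lattice kT ->
  (forall z, lev z = fixed_level p kT -> exists s, z = gamma s) ->
  exists theta Cst, forall j, (K ^ p) ^ j *
    dist (iter j (shifted_inv p kT) v) (iter j (shifted_inv p kT) (gamma theta)) <= Cst.
Proof.
  intros LkT Hon. destruct (back_ex p kT p_pos LkT v (fixed_level p kT)) as [y [Hy Hc]].
  destruct (Hon y Hy) as [theta ->].
  exists theta, (cst * n1 pA * dist v (gamma theta)). intros j.
  apply back_dist; auto.
Qed.

(* Some point near [x] reaches the curve, while the backward orbit of [v] follows an irrational
   rotation on the curve and comes close to that point of the curve. *)
Lemma transitive_F x eps v : 0 < eps ->
  exists n u, dist u x < eps /\ eqT (iter n F u) v.
Proof.
  intros He.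
  destruct curve_structure as [k0 [kT [Lk0 [_ [LkT [_ [Hk0 [HT [_ [Hon _]]]]]]]]]].
  destruct (level_hit x (eps / 2) (fixed_level p kT)) as [n [u [k [Hu [Lk El]]]]]; [lra|].
  destruct (Hon (vsub (iter n F u) k)) as [s0 Hs0].
  { rewrite lev_sub_lattice, El by auto. ring. }
  destruct (Finvn_cont n (iter n F u) (eps / 2)) as [d [Hd HF]]; [lra|]. rewrite Finvn_Fn in HF.
  destruct (gamma_rcont s0 (d / 2)) as [e [Hep Hg]]; [lra|].
  destruct (backward_to_curve kT v LkT Hon) as [theta [Cst Hb]].
  destruct (back_tendsto p kT p_pos v (gamma theta) Cst (d / 2)) as [N HN]; [lra|auto|].
  destruct gamma_quasi as [_ [_ [_ [Hirr _]]]].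
  (* A time [j] beyond [N] at which the backward rotation of [theta] is near [s0] modulo 1. *)
  destruct (irrational_dense rho Hirr (theta - s0) e N Hep) as [j [l [Hj Hl]]].
  specialize (HN j Hj). rewrite gamma_back in HN by auto.
  set (y := iter j (shifted_inv p kT) v) in *.
  replace (theta - INR j * rho) with (theta - INR j * rho - IZR l + IZR l) in HN by ring.
  rewrite (gamma_iter k0 Hk0) in HN.
  specialize (Hg (theta - INR j * rho - IZR l)
    ltac:(replace (theta - INR j * rho - IZR l - s0) with (theta - s0 - INR j * rho - IZR l) by ring; auto)).
  (* The backward image of [v], translated along the curve by [l] turns and then by [k] so as to lie
     near [F^n u]. *)
  set (y' := vadd (vsub y (vscale (IZR l) k0)) k).
  assert (Hy' : dist y' (iter n F u) < d).
  { replace (iter n F u) with (vadd (gamma s0) k) by (rewrite <- Hs0; vring).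
    unfold y'. rewrite dist_addr.
    pose proof (dist_tri (vsub y (vscale (IZR l) k0)) (gamma (theta - INR j * rho - IZR l)) (gamma s0)) as T.
    replace (dist (vsub y (vscale (IZR l) k0)) (gamma (theta - INR j * rho - IZR l))) with
      (dist y (vadd (gamma (theta - INR j * rho - IZR l)) (vscale (IZR l) k0))) in T
      by (unfold dist; f_equal; vring). lra. }
  exists (p * j + n)%nat, (iter n Finv y'). split.
  - pose proof (dist_tri (iter n Finv y') u x). specialize (HF y' Hy'). lra.
  - rewrite Nat.iter_add, Fn_Finvn.
    apply eqT_trans with (iter (p * j) F y).
    + apply Fn_eqT. unfold y'. eapply eqT_trans; [apply eqT_add_lattice; auto|].
      apply eqT_sub_lattice, lattice_scale_Z; auto.
    + destruct (shifted_iter p kT j LkT) as [k' [Lk' Hk']].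
      pose proof (Hk' y) as E. unfold y in E at 1.
      rewrite (iter_cancel (shifted p kT) (shifted_inv p kT)) in E by apply shifted_K.
      rewrite E. apply eqT_sym, eqT_sub_lattice; auto.
Qed.

Lemma Fn_sub_lattice m y k : lattice k ->
  iter m F (vsub y k) = vsub (iter m F y) (iter m (mv M) k).
Proof.
  intros Lk. replace (iter m F y) with (iter m F (vadd (vsub y k) k)) by (f_equal; vring).
  rewrite Fn_add_lattice by auto. vring.
Qed.

(** A fixed point of a composite loop of lifts thereby becomes a periodic point on the torus. *)
Lemma loop_form n k1 N kz j i k2 : lattice k1 -> lattice kz -> lattice k2 ->
  exists kk, lattice kk /\ forall y,
    shifted i k2 (iter j (shifted N kz) (shifted n k1 y)) =
    vsub (iter (n + (N * j + i)) F y) kk.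
Proof.
  intros Lk1 Lkz Lk2. destruct (shifted_iter N kz j Lkz) as [k3 [Lk3 Hk3]].
  exists (vadd (vadd (iter i (mv M) (iter (N * j) (mv M) k1)) (iter i (mv M) k3)) k2).
  split. { repeat apply lattice_add; auto; repeat apply Mn_lattice; auto. }
  intros y. unfold shifted at 1. rewrite Hk3. unfold shifted.
  replace (n + (N * j + i))%nat with (i + (N * j + n))%nat by lia.
  rewrite !Nat.iter_add, !Fn_sub_lattice by (repeat apply Mn_lattice; auto). vring.
Qed.

(** * Eigenvalues of cone-preserving matrices *)

Lemma DFn_cone n z v : v <> zero -> inC v ->
  mv (DFn' n z) v <> zero /\ inC (mv (DFn' n z) v) /\
  K ^ n * Rabs (A v) <= Rabs (A (mv (DFn' n z) v)).
Proof.
  intros Hv Hc. induction n as [|n [IH1 [IH2 IH3]]]; simpl.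
  - replace (mv mid v) with v by (unfold mid; vring). repeat split; auto; lra.
  - rewrite mv_mmul. destruct (D_cone (iter n F z) _ IH1 IH2) as [H1 H2].
    split; [|split].
    + intros E. rewrite E in H2. unfold dot at 2 in H2. unfold zero in H2; simpl in H2.
      rewrite !Rmult_0_r, Rplus_0_l, Rabs_R0 in H2.
      rpos (A (mv (DFn' n z) v)). nra.
    + unfold in_cone. lra.
    + nra.
Qed.

Lemma DFn_cone_strict n z v : (1 <= n)%nat -> v <> zero -> inC v ->
  Rabs (B (mv (DFn' n z) v)) < alpha * Rabs (A (mv (DFn' n z) v)) /\
  Rabs (A v) < Rabs (A (mv (DFn' n z) v)).
Proof.
  intros Hn Hv Hc. destruct n; [lia|].
  destruct (DFn_cone n z v Hv Hc) as [H1 [H2 H3]]. simpl. rewrite mv_mmul.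
  destruct (D_cone (iter n F z) _ H1 H2) as [H4 H5]. split; auto.
  pose proof (pow_R1_Rle K n ltac:(lra)). rpos (A v).
  set (y := Rabs (A (mv (DFn' n z) v))) in *.
  assert (Rabs (A v) <= y) by nra. assert (y <= K * y) by nra. lra.
Qed.

(* [l1] is the eigenvalue of the eigenvector of coordinates [(1, s)] in the cone; the functional
   [B - s A] vanishes on it and is a left eigenvector for the other eigenvalue [l2]. *)
Definition cone_eigen (Q : mat) (s l1 l2 : R) : Prop :=
  Rabs s < alpha /\ 1 < Rabs l1 /\ l1 + l2 = mtr Q /\ l1 * l2 = mdet Q /\
  (forall v, dot (vsub pB (vscale s pA)) (mv Q v) = l2 * dot (vsub pB (vscale s pA)) v) /\
  exists q, forall v, A (mv Q v) = l1 * A v + q * dot (vsub pB (vscale s pA)) v.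

(** On vectors of coordinates [(1, s)] the matrix acts on slopes by [b s / a s], which maps
    [[-alpha, alpha]] strictly inside itself; a fixed slope is an eigenvector in the cone. *)
Lemma cone_eigen_ex Q :
  (forall v, v <> zero -> inC v -> Rabs (B (mv Q v)) < alpha * Rabs (A (mv Q v)) /\
     Rabs (A v) < Rabs (A (mv Q v))) ->
  exists s l1 l2, cone_eigen Q s l1 l2.
Proof.
  intros HQ. set (w := of_coord pA pB 1 0). set (e := of_coord pA pB 0 1).
  assert (Aw : A w = 1) by (apply coord_A; auto). assert (Bw : B w = 0) by (apply coord_B; auto).
  assert (Ae : A e = 0) by (apply coord_A; auto). assert (Be : B e = 1) by (apply coord_B; auto).
  set (v := fun s => vadd w (vscale s e)).
  assert (Av : forall s, A (v s) = 1) by (intros s; unfold v; rewrite dot_add, dot_scale, Aw, Ae; ring).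
  assert (Bv : forall s, B (v s) = s) by (intros s; unfold v; rewrite dot_add, dot_scale, Bw, Be; ring).
  assert (Hv0 : forall s, v s <> zero).
  { intros s E. pose proof (Av s) as E1. rewrite E in E1. unfold dot, zero in E1; simpl in E1. lra. }
  set (a := fun s => A (mv Q w) + s * A (mv Q e)). set (b := fun s => B (mv Q w) + s * B (mv Q e)).
  assert (Ea : forall s, A (mv Q (v s)) = a s) by (intros s; unfold v, a; rewrite mv_add, mv_scale, dot_add, dot_scale; auto).
  assert (Eb : forall s, B (mv Q (v s)) = b s) by (intros s; unfold v, b; rewrite mv_add, mv_scale, dot_add, dot_scale; auto).
  assert (Hs : forall s, - alpha <= s <= alpha -> Rabs (b s) < alpha * Rabs (a s) /\ 1 < Rabs (a s)).
  { intros s Hs. rewrite <- Ea, <- Eb. rewrite <- Rabs_R1 at 1. rewrite <- (Av s). apply HQ; auto.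
    unfold in_cone. rewrite Av, Bv, Rabs_R1, Rmult_1_r. apply Rabs_le. lra. }
  assert (Ca : continuity a).
  { replace a with (fun s => A (mv Q w) + s * A (mv Q e) + s * s * 0); [apply quadratic_continuity|].
    apply functional_extensionality. intros s. unfold a. ring. }
  (* [|a| > 1] on the interval, so [a] keeps its sign, and [b s - s a s] then has opposite signs at
     the two ends. *)
  assert (Hsgn : 0 < a (- alpha) * a alpha).
  { apply Rnot_le_lt. intros L. destruct (ivt_gen a (- alpha) alpha 0) as [s [Hs1 E]]; auto; [lra|lra|].
    destruct (Hs s Hs1) as [_ H1]. rewrite E, Rabs_R0 in H1. lra. }
  assert (Hphi : exists s, - alpha <= s <= alpha /\ b s - s * a s = 0).
  { destruct (ivt_gen (fun s => b s - s * a s) (- alpha) alpha 0) as [s [Hs1 E]].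
    - replace (fun s => b s - s * a s) with
        (fun s => B (mv Q w) + s * (B (mv Q e) - A (mv Q w)) + s * s * (- A (mv Q e)));
        [apply quadratic_continuity|].
      apply functional_extensionality. intros s. unfold a, b. ring.
    - lra.
    - destruct (Hs (- alpha) ltac:(lra)) as [H1 _]. destruct (Hs alpha ltac:(lra)) as [H2 _].
      set (a1 := a (- alpha)) in *. set (a2 := a alpha) in *.
      set (b1 := b (- alpha)) in *. set (b2 := b alpha) in *.
      destruct (Rle_or_lt a1 0) as [L|L].
      + assert (a2 < 0) by nra. rewrite (Rabs_left1 a1) in H1 by auto. rewrite (Rabs_left1 a2) in H2 by lra.
        apply Rabs_def2 in H1, H2. nra.
      + assert (0 < a2) by nra. rewrite (Rabs_pos_eq a1) in H1 by lra. rewrite (Rabs_pos_eq a2) in H2 by lra.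
        apply Rabs_def2 in H1, H2. nra.
    - exists s. auto. }
  destruct Hphi as [s [Hs1 Es]]. destruct (Hs s Hs1) as [H1 H2].
  assert (Hv : mv Q (v s) = vscale (a s) (v s)).
  { apply (coord_ext pA pB coord_indep); rewrite dot_scale.
    - rewrite Ea, Av. ring.
    - rewrite Eb, Bv. lra. }
  (* The action of [Q] on the quotient of the plane by the eigenvector, hence the other
     eigenvalue. *)
  set (c := B (mv Q e) - s * A (mv Q e)).
  assert (Htr : a s + c = mtr Q).
  { unfold a, c, w, e, of_coord, dot, mv, mtr; simpl. field. auto. }
  pose proof (eigenvalue_char Q (a s) (v s) (Hv0 s) Hv) as Hchar.
  assert (Hdec : forall u, u = vadd (vscale (A u) (v s)) (vscale (dot (vsub pB (vscale s pA)) u) e)).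
  { intros u. assert (Hl : dot (vsub pB (vscale s pA)) u = B u - s * A u) by vring. rewrite Hl.
    apply (coord_ext pA pB coord_indep); rewrite dot_add, !dot_scale, ?Av, ?Bv, ?Ae, ?Be; ring. }
  assert (Hl : forall u, dot (vsub pB (vscale s pA)) u = B u - s * A u) by (intros u; vring).
  assert (Hq : forall u, mv Q u = vadd (vscale (A u * a s) (v s)) (vscale (B u - s * A u) (mv Q e))).
  { intros u. rewrite (Hdec u) at 1. rewrite mv_add, !mv_scale, Hv, Hl. vring. }
  exists s, (a s), c. unfold cone_eigen. split; [|split; [|split; [|split; [|split]]]]; auto.
  - replace (b s) with (s * a s) in H1 by lra. rewrite Rabs_mult in H1. nra.
  - replace c with (mtr Q - a s) by lra. lra.
  - intros u. rewrite !Hl, (Hq u), !dot_add, !dot_scale, Av, Bv. unfold c. ring.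
  - exists (A (mv Q e)). intros u. rewrite (Hq u) at 1. rewrite dot_add, !dot_scale, Av, Hl. ring.
Qed.

Lemma DFn_eigen n z : (1 <= n)%nat -> exists s l1 l2, cone_eigen (DFn' n z) s l1 l2.
Proof. intros Hn. apply cone_eigen_ex. intros v Hv Hc. apply DFn_cone_strict; auto. Qed.

Lemma cone_eigen_roots Q s l1 l2 x y : cone_eigen Q s l1 l2 -> cplx_eigenvalue Q x y ->
  y = 0 /\ (x = l1 \/ x = l2).
Proof.
  intros [_ [_ [Ht [Hd _]]]] [E1 E2]. rewrite <- Ht, <- Hd in *.
  assert (Hy : y = 0).
  { assert (E3 : y * (2 * x - (l1 + l2)) = 0) by lra. apply Rmult_integral in E3.
    destruct E3 as [E3|E3]; auto. assert (x = (l1 + l2) / 2) by lra. subst x.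
    assert (E4 : ((l1 - l2) / 2) ^ 2 + y ^ 2 = 0) by lra.
    pose proof (pow2_ge_0 ((l1 - l2) / 2)). pose proof (pow2_ge_0 y).
    assert (E5 : y ^ 2 = 0) by lra. simpl in E5. rewrite Rmult_1_r in E5.
    apply Rmult_integral in E5. tauto. }
  split; auto. subst y. assert (E3 : (x - l1) * (x - l2) = 0) by lra.
  apply Rmult_integral in E3. destruct E3; [left|right]; lra.
Qed.

Lemma cone_eigen_is_root Q s l1 l2 l : cone_eigen Q s l1 l2 -> l = l1 \/ l = l2 ->
  cplx_eigenvalue Q l 0.
Proof.
  intros [_ [_ [Ht [Hd _]]]] H. unfold cplx_eigenvalue. rewrite <- Ht, <- Hd.
  destruct H as [-> | ->]; split; ring.
Qed.

(** * Density of repellers *)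

(** If [|l2| <= 1], points displaced slightly along its eigenvector would move away by a factor at
    most 3/2, contradicting the factor 2; [l1] is already large by the cone. *)
Lemma expanding_is_repeller n z delta : (1 <= n)%nat -> eqT (iter n F z) z -> 0 < delta ->
  (forall x, dist x z < delta -> 2 * dist x z <= dist (iter n F x) (iter n F z)) ->
  is_repeller M G DG z.
Proof.
  intros Hn Hz Hd Hexp. exists n. split; [lia|]. split; auto. intros x y Hxy.
  destruct (DFn_eigen n z Hn) as [s [l1 [l2 He]]].
  destruct (cone_eigen_roots _ _ _ _ _ _ He Hxy) as [-> Hx]. apply sq_gt1.
  destruct Hx as [-> | ->]; [apply He|].
  destruct (root_eigenvector (DFn' n z) l2) as [v [Hv0 Hv]].
  { destruct He as [_ [_ [<- [<- _]]]]. ring. }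
  apply Rnot_le_lt. intros L. pose proof (n1_gt0 v Hv0) as Pv.
  destruct (Fn_sder n z (1 / 2)) as [d [Hd' HS]]; [lra|].
  destruct (pos_min2 delta d Hd Hd') as [e [Hm He12]]. set (t := e / (2 * n1 v)).
  assert (Ht : 0 < t) by (apply Rdiv_lt_0_compat; lra).
  assert (Et : t * n1 v = e / 2) by (unfold t; field; lra).
  set (u := vadd z (vscale t v)).
  assert (Eu : vsub u z = vscale t v) by (unfold u; vring).
  assert (Du : dist u z = t * n1 v) by (unfold dist; rewrite Eu, n1_scale, Rabs_pos_eq; lra).
  specialize (Hexp u ltac:(lra)). specialize (HS u z ltac:(lra) ltac:(rewrite dist_refl; auto)).
  rewrite Du in *. rewrite Eu, mv_scale, Hv in HS.
  set (er := vsub (vsub (iter n F u) (iter n F z)) (vscale t (vscale l2 v))) in HS.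
  assert (E : dist (iter n F u) (iter n F z) <= t * (Rabs l2 * n1 v) + 1 / 2 * (t * n1 v)).
  { unfold dist. replace (vsub (iter n F u) (iter n F z)) with
      (vadd (vscale t (vscale l2 v)) er) by (unfold er; vring).
    eapply Rle_trans; [apply n1_add|]. rewrite !n1_scale, (Rabs_pos_eq t) by lra. lra. }
  assert (t * (Rabs l2 * n1 v) <= t * n1 v); [|lra].
  replace (t * (Rabs l2 * n1 v)) with (Rabs l2 * (t * n1 v)) by ring. nra.
Qed.

Lemma eigen_coord_bound s d : Rabs s < alpha ->
  n1 d <= cst * (1 + alpha) * (Rabs (A d) + Rabs (dot (vsub pB (vscale s pA)) d)).
Proof.
  intros Hs. pose proof cst_pos as Pc. rpos (A d). rpos (B d).
  assert (Hl : Rabs (B d) <= Rabs (dot (vsub pB (vscale s pA)) d) + alpha * Rabs (A d)).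
  { replace (B d) with (dot (vsub pB (vscale s pA)) d + s * A d) by vring.
    eapply Rle_trans; [apply Rabs_triang|]. rewrite Rabs_mult. nra. }
  rpos (dot (vsub pB (vscale s pA)) d).
  rewrite Rmult_assoc.
  destruct (Rle_or_lt (Rabs (B d)) (alpha * Rabs (A d))) as [L|L].
  - eapply Rle_trans; [apply (in_cone_bound pA pB alpha alpha_pos coord_indep d L)|].
    apply Rmult_le_compat_l; [lra|]. nra.
  - eapply Rle_trans; [apply (out_cone_bound pA pB alpha alpha_pos coord_indep d); lra|].
    apply Rmult_le_compat_l; [lra|]. nra.
Qed.

(* In the norm [eta |A v| + |phi v|] with [eta] small, a triangular matrix with both
   eigenvalues outside the unit disk is expanding. *)
Lemma repeller_basin n k z : lattice k -> (1 <= n)%nat -> shifted n k z = z ->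
  (forall x y, cplx_eigenvalue (DFn' n z) x y -> x ^ 2 + y ^ 2 > 1) ->
  exists r C q, 0 < r /\ 0 < C /\ 0 <= q < 1 /\ forall j x y, dist x z < r -> dist y z < r ->
    dist (iter j (shifted_inv n k) x) (iter j (shifted_inv n k) y) <= C * q ^ j * dist x y.
Proof.
  intros Lk Hn Hz Hrep. destruct (DFn_eigen n z Hn) as [s [l1 [l2 He]]].
  assert (Hl2 : 1 < Rabs l2).
  { assert (R2 : l2 ^ 2 + 0 ^ 2 > 1)
      by (apply Hrep; apply (cone_eigen_is_root _ _ _ _ _ He); auto).
    rewrite <- (pow2_abs l2) in R2. rpos l2. simpl in R2. nra. }
  destruct He as [Hs [Hl1 [_ [_ [Hphi [q Hq]]]]]].
  set (Q := DFn' n z) in *. set (pf := vsub pB (vscale s pA)) in *.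
  (* Makes the off-diagonal contribution [eta |q|] at most half of the excess [|l2| - 1]. *)
  set (eta := (Rabs l2 - 1) / (2 * (Rabs q + 1))).
  pose proof (Rabs_pos q) as Pq.
  assert (Heta : 0 < eta) by (apply Rdiv_lt_0_compat; lra).
  assert (Eeta : eta * (Rabs q + 1) = (Rabs l2 - 1) / 2) by (unfold eta; field; lra).
  set (nst := fun v => eta * Rabs (A v) + Rabs (dot pf v)).
  set (kp := Rmin (Rabs l1) ((1 + Rabs l2) / 2)).
  assert (Hkp : 1 < kp /\ kp <= Rabs l1 /\ kp <= (1 + Rabs l2) / 2).
  { unfold kp. split; [apply Rmin_glb_lt; lra|]. split; [apply Rmin_l|apply Rmin_r]. }
  assert (Hexp : forall v, kp * nst v <= nst (mv Q v)).
  { intros v. unfold nst. rewrite Hphi, Hq, Rabs_mult.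
    pose proof (Rabs_triang_inv (l1 * A v) (- (q * dot pf v))) as T.
    rewrite Rabs_Ropp, !Rabs_mult in T. unfold Rminus in T. rewrite Ropp_involutive in T.
    pose proof (Rabs_pos (A v)) as PA. pose proof (Rabs_pos (dot pf v)) as PF.
    assert (E1 : eta * (Rabs l1 * Rabs (A v) - Rabs q * Rabs (dot pf v)) <=
                 eta * Rabs (l1 * A v + q * dot pf v)) by (apply Rmult_le_compat_l; lra).
    assert (E2 : kp * (eta * Rabs (A v)) <= eta * Rabs l1 * Rabs (A v)).
    { replace (eta * Rabs l1 * Rabs (A v)) with (Rabs l1 * (eta * Rabs (A v))) by ring.
      apply Rmult_le_compat_r; [nra|lra]. }
    assert (E3 : eta * Rabs q <= (Rabs l2 - 1) / 2) by lra.
    assert (E4 : (kp + eta * Rabs q) * Rabs (dot pf v) <= Rabs l2 * Rabs (dot pf v))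
      by (apply Rmult_le_compat_r; lra).
    nra. }
  pose proof cst_pos as Pc.
  set (cc := cst * (1 + alpha)). assert (Pcc : 0 < cc) by (unfold cc; nra).
  destruct (pos_min2 eta 1 Heta) as [mn [Pm Hmn]]; [lra|].
  set (c1 := mn / cc). assert (Hc1 : 0 < c1) by (apply Rdiv_lt_0_compat; auto).
  set (c2 := eta * n1 pA + n1 pf + 1).
  assert (Hc2 : 0 < c2) by (unfold c2; npos pA; npos pf; nra).
  assert (Hlow : forall v, c1 * n1 v <= nst v).
  { intros v. pose proof (eigen_coord_bound s v Hs) as E. fold pf cc in E.
    rpos (A v). rpos (dot pf v).
    apply Rmult_le_reg_l with cc; auto.
    replace (cc * (c1 * n1 v)) with (mn * n1 v) by (unfold c1; field; lra).
    apply Rle_trans with (mn * (cc * (Rabs (A v) + Rabs (dot pf v)))); [apply Rmult_le_compat_l; lra|].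
    replace (mn * (cc * (Rabs (A v) + Rabs (dot pf v)))) with
      (cc * (mn * (Rabs (A v) + Rabs (dot pf v)))) by ring.
    apply Rmult_le_compat_l; [lra|]. unfold nst. nra. }
  assert (Hup : forall v, nst v <= c2 * n1 v).
  { intros v. unfold nst, c2. pose proof (dot_le pA v). pose proof (dot_le pf v). npos v. nra. }
  assert (Htri : forall u v, nst u <= nst v + nst (vsub v u)).
  { intros u v. unfold nst. rewrite !dot_sub.
    pose proof (Rabs_triang_inv (A u) (A v)). pose proof (Rabs_triang_inv (dot pf u) (dot pf v)).
    rewrite (Rabs_minus_sym (A u)) in *. rewrite (Rabs_minus_sym (dot pf u)) in *. nra. }
  (* Halfway between 1 and the linear rate [kp]: the difference absorbs the nonlinear remainder. *)
  set (k3 := (1 + kp) / 2).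
  destruct (Fn_sder n z (c1 * (k3 - 1) / c2)) as [d [Hd HS]].
  { apply Rdiv_lt_0_compat; auto. apply Rmult_lt_0_compat; auto. unfold k3. lra. }
  set (T := shifted n k) in *. set (Ti := shifted_inv n k).
  assert (Hloc : forall x y, dist x z < d -> dist y z < d ->
            k3 * nst (vsub x y) <= nst (vsub (T x) (T y))).
  { intros x y Hx Hy. specialize (HS x y Hx Hy). fold Q in HS.
    replace (vsub (T x) (T y)) with (vsub (iter n F x) (iter n F y)) by (unfold T, shifted; vring).
    pose proof (Htri (mv Q (vsub x y)) (vsub (iter n F x) (iter n F y))) as E1.
    pose proof (Hexp (vsub x y)) as E2. pose proof (Hlow (vsub x y)) as E3.
    pose proof (Hup (vsub (vsub (iter n F x) (iter n F y)) (mv Q (vsub x y)))) as E4.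
    assert (E5 : c2 * n1 (vsub (vsub (iter n F x) (iter n F y)) (mv Q (vsub x y)))
                 <= (k3 - 1) * nst (vsub x y)).
    { apply Rle_trans with (c2 * (c1 * (k3 - 1) / c2 * dist x y)); [apply Rmult_le_compat_l; lra|].
      replace (c2 * (c1 * (k3 - 1) / c2 * dist x y)) with ((k3 - 1) * (c1 * dist x y)) by (field; lra).
      apply Rmult_le_compat_l; [unfold k3; lra|]. auto. }
    unfold k3 in *. lra. }
  assert (Hzi : Ti z = z) by (unfold Ti; rewrite <- Hz at 1; apply shifted_invK).
  (* The inverse sends the [d']-ball into the region where [Hloc] holds. It therefore contracts the
     [nst]-ball of radius [c1 d'] into itself, and all iterates are controlled. *)
  destruct (shifted_inv_cont n k z d Hd) as [d' [Hd' Hci]]. fold Ti in Hci. rewrite Hzi in Hci.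
  assert (Hball : forall x, nst (vsub x z) < c1 * d' -> dist x z < d').
  { intros x Hx. pose proof (Hlow (vsub x z)). unfold dist. nra. }
  assert (Hk3 : 1 < k3) by (unfold k3; lra).
  assert (Hstep : forall x y, nst (vsub x z) < c1 * d' -> nst (vsub y z) < c1 * d' ->
            nst (vsub (Ti x) (Ti y)) <= / k3 * nst (vsub x y)).
  { intros x y Hx Hy. pose proof (Hloc (Ti x) (Ti y) (Hci x (Hball x Hx)) (Hci y (Hball y Hy))) as E.
    unfold T, Ti in E. rewrite !shifted_K in E. fold Ti in E.
    apply Rmult_le_reg_l with k3; [lra|]. rewrite <- Rmult_assoc, Rinv_r by lra. lra. }
  assert (Hnn : forall v, 0 <= nst v) by (intros v; pose proof (Hlow v); npos v; nra).
  assert (Hik : 0 < / k3 < 1).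
  { split; [apply Rinv_0_lt_compat; lra|]. rewrite <- Rinv_1. apply Rinv_lt_contravar; lra. }
  assert (Hn0 : nst (vsub z z) < c1 * d').
  { replace (vsub z z) with zero by vring. pose proof (Hup zero) as E. rewrite n1_zero in E.
    assert (0 < c1 * d') by nra. lra. }
  assert (Hst : forall x, nst (vsub x z) < c1 * d' -> nst (vsub (Ti x) z) < c1 * d').
  { intros x Hx. pose proof (Hstep x z Hx Hn0) as E. rewrite Hzi in E. pose proof (Hnn (vsub x z)). nra. }
  assert (Hinv : forall j x, nst (vsub x z) < c1 * d' -> nst (vsub (iter j Ti x) z) < c1 * d').
  { intros j x Hx. induction j; simpl; auto. }
  assert (Hj : forall j x y, nst (vsub x z) < c1 * d' -> nst (vsub y z) < c1 * d' ->
            nst (vsub (iter j Ti x) (iter j Ti y)) <= (/ k3) ^ j * nst (vsub x y)).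
  { intros j x y Hx Hy. induction j; simpl; [lra|].
    eapply Rle_trans; [apply Hstep; apply Hinv; auto|]. rewrite Rmult_assoc.
    apply Rmult_le_compat_l; lra. }
  exists (c1 * d' / c2), (c2 / c1), (/ k3).
  split; [apply Rdiv_lt_0_compat; nra|]. split; [apply Rdiv_lt_0_compat; auto|]. split; [lra|].
  intros j x y Hx Hy.
  assert (Hx' : forall x, dist x z < c1 * d' / c2 -> nst (vsub x z) < c1 * d').
  { intros u Hu. eapply Rle_lt_trans; [apply Hup|]. fold (dist u z).
    apply mul_lt_of_lt_div in Hu; [|lra]. auto. }
  specialize (Hj j x y (Hx' x Hx) (Hx' y Hy)).
  pose proof (Hlow (vsub (iter j Ti x) (iter j Ti y))) as E1.
  pose proof (Hup (vsub x y)) as E2. pose proof (pow_lt (/ k3) j ltac:(lra)) as P.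
  apply Rmult_le_reg_l with c1; auto. unfold dist at 1.
  apply Rle_trans with ((/ k3) ^ j * (c2 * n1 (vsub x y))).
  - eapply Rle_trans; [apply E1|]. eapply Rle_trans; [apply Hj|]. apply Rmult_le_compat_l; lra.
  - right. unfold dist. field. repeat split; lra.
Qed.

(** A loop run backwards, from [u] near [x] to the basin of [z0], then [j] inverse steps there, then
    back to [u], contracts a ball around [u] once [j] is large. Its fixed point is expanded by the
    forward loop. *)
Lemma repellers_dense z0 : is_repeller M G DG z0 -> forall x eps, 0 < eps ->
  exists z, is_repeller M G DG z /\ dist z x < eps.
Proof.
  intros [N [HN [Hper Hrep]]] x eps He.
  apply eqT_ex in Hper. destruct Hper as [kz [Lkz Ez]].
  assert (Hz : shifted N kz z0 = z0) by (unfold shifted; rewrite Ez; vring).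
  destruct (repeller_basin N kz z0 Lkz HN Hz Hrep) as [r [C [q [Hr [HC [Hq Hbas]]]]]].
  set (Ti := shifted_inv N kz) in *.
  assert (Hzi : Ti z0 = z0) by (unfold Ti; rewrite <- Hz at 1; apply shifted_invK).
  assert (Hzij : forall j, iter j Ti z0 = z0) by (induction j; simpl; auto; rewrite IHj; auto).
  destruct (transitive_F x (eps / 2) z0) as [n [u [Hu En]]]; [lra|].
  apply eqT_ex in En. destruct En as [k1 [Lk1 En]].
  destruct (transitive_F z0 r u Hr) as [i [b [Hb Ei]]].
  apply eqT_ex in Ei. destruct Ei as [k2 [Lk2 Ei]].
  (* [S1] sends [u] to [b] near [z0]; [S2] sends [z0] to [u] *)
  set (S1 := shifted_inv i k2). set (S2 := shifted_inv n k1).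
  assert (E1 : S1 u = b) by (unfold S1, shifted_inv; rewrite <- Ei; apply Finvn_Fn).
  assert (E2 : S2 z0 = u) by (unfold S2, shifted_inv; rewrite <- En; apply Finvn_Fn).
  destruct (shifted_inv_loclip i k2 u) as [L1 [d1 [HL1 [Hd1 Lip1]]]]. fold S1 in Lip1.
  destruct (shifted_inv_cont i k2 u (r - dist b z0)) as [d3 [Hd3 C1]]; [lra|]. fold S1 in C1.
  destruct (shifted_inv_loclip n k1 z0) as [L2 [d2 [HL2 [Hd2 Lip2]]]]. fold S2 in Lip2.
  destruct (pos_min3 (eps / 4) (d1 / 2) (d3 / 2)) as [e Hee]; try lra.
  assert (HS1 : forall y, dist y u <= e -> dist (S1 y) z0 < r).
  { intros y Hy. specialize (C1 y ltac:(lra)). rewrite E1 in C1.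
    pose proof (dist_tri (S1 y) b z0). lra. }
  destruct (pow_small q (C * r) d2 Hq Hd2) as [N1 HN1].
  destruct (pow_small q (L2 * (C * r)) (e / 2) Hq) as [N2 HN2]; [lra|].
  destruct (pow_small q (L2 * (C * L1)) (/ 2) Hq) as [N3 HN3]; [lra|].
  (* [N1] reaches the domain of the Lipschitz bound for [S2], [N2] returns the ball into its half,
     [N3] gives the ratio [/ 2]; the 1 makes the period positive. *)
  set (j := (N1 + N2 + N3 + 1)%nat).
  specialize (HN1 j ltac:(lia)). specialize (HN2 j ltac:(lia)). specialize (HN3 j ltac:(lia)).
  pose proof (pow_le q j (proj1 Hq)) as Pq.
  set (H := fun y => S2 (iter j Ti (S1 y))).
  assert (Hmid : forall y, dist y u <= e -> dist (iter j Ti (S1 y)) z0 <= C * r * q ^ j).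
  { intros y Hy. specialize (HS1 y Hy). pose proof (Hbas j (S1 y) z0 HS1 ltac:(rewrite dist_refl; auto)) as E.
    rewrite Hzij in E. eapply Rle_trans; [apply E|].
    replace (C * r * q ^ j) with (C * q ^ j * r) by ring. apply Rmult_le_compat_l; [nra|lra]. }
  assert (Hclose : forall y, dist y u <= e -> dist (H y) u <= e / 2).
  { intros y Hy. specialize (Hmid y Hy). unfold H. rewrite <- E2 at 1.
    eapply Rle_trans; [apply Lip2; [lra|rewrite dist_refl; auto]|].
    apply Rle_trans with (L2 * (C * r * q ^ j)); [apply Rmult_le_compat_l; lra|]. nra. }
  assert (Hcon : forall y y', dist y u <= e -> dist y' u <= e -> dist (H y) (H y') <= / 2 * dist y y').
  { intros y y' Hy Hy'. pose proof (Hmid y Hy). pose proof (Hmid y' Hy'). unfold H.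
    eapply Rle_trans; [apply Lip2; lra|].
    pose proof (Hbas j (S1 y) (S1 y') (HS1 y Hy) (HS1 y' Hy')) as B1.
    pose proof (Lip1 y y' ltac:(lra) ltac:(lra)) as B2.
    apply Rle_trans with (L2 * (C * q ^ j * (L1 * dist y y'))).
    - apply Rmult_le_compat_l; [lra|]. eapply Rle_trans; [apply B1|].
      apply Rmult_le_compat_l; [nra|auto].
    - replace (L2 * (C * q ^ j * (L1 * dist y y'))) with (L2 * (C * L1) * q ^ j * dist y y') by ring.
      apply Rmult_le_compat_r; [apply dist_pos|lra]. }
  destruct (banach (fun y => dist y u <= e) H) as [z [Pz Fz]].
  - exists u. rewrite dist_refl. lra.
  - intros z Hcl. apply Rnot_lt_le. intros L. destruct (Hcl (dist z u - e)) as [z' [P1 P2]]; [lra|].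
    pose proof (dist_tri z z' u). rewrite (dist_sym z z') in *. lra.
  - intros y Hy. specialize (Hclose y Hy). lra.
  - auto.
  - pose proof (Hclose z Pz) as Hzu. rewrite Fz in Hzu.
    (* The forward loop, inverse to [H]: contraction of [H] by [/ 2] becomes expansion by 2. *)
    set (Tt := (n + (N * j + i))%nat).
    destruct (loop_form n k1 N kz j i k2 Lk1 Lkz Lk2) as [kk [Lkk Hkk]].
    assert (Hback : forall y, H (vsub (iter Tt F y) kk) = y).
    { intros y. unfold Tt. rewrite <- Hkk. unfold H, S1. rewrite shifted_invK. unfold Ti.
      rewrite (iter_cancel (shifted_inv N kz) (shifted N kz)) by apply shifted_invK.
      unfold S2. apply shifted_invK. }
    set (Tm := fun y => vsub (iter Tt F y) kk) in *.
    assert (HTz : Tm z = z).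
    { assert (Hsurj : forall y, Tm (H y) = y).
      { intros y.
        assert (Hi : forall a c, H a = H c -> a = c).
        { intros a c E. unfold H, S1, S2, Ti in E.
          assert (I1 : forall m k, forall a c, shifted_inv m k a = shifted_inv m k c -> a = c).
          { intros m k a' c' E'. rewrite <- (shifted_K m k a'), E'. apply shifted_K. }
          apply I1 in E. apply (f_equal (iter j (shifted N kz))) in E.
          rewrite !(iter_cancel (shifted N kz) (shifted_inv N kz)) in E by apply shifted_K.
          apply I1 in E. auto. }
        apply Hi. apply Hback. }
      rewrite <- Fz at 1. apply Hsurj. }
    (* [z] lies in the half ball, so images of points near [z] stay in the full ball where [H]
       contracts. *)
    destruct (Fn_cont Tt z (e / 2)) as [d [Hd Hc]]; [lra|].
    exists z. split; [|pose proof (dist_tri z u x); lra].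
    apply (expanding_is_repeller Tt z d); auto.
    + unfold Tt, j. nia.
    + rewrite <- HTz at 2. apply eqT_sym, eqT_sub_lattice; auto.
    + intros y Hy. specialize (Hc y Hy).
      assert (Ed : dist (Tm y) (Tm z) = dist (iter Tt F y) (iter Tt F z)) by apply dist_subr.
      pose proof (dist_tri (Tm y) (Tm z) u) as Tr. rewrite HTz in Tr, Ed.
      pose proof (Hcon (Tm y) z ltac:(lra) ltac:(lra)) as E. unfold Tm in E at 1. rewrite Hback, Fz in E. lra.
Qed.

(** * Density of saddles *)

(** Outside the cone [|B - s A| >= |B| - |s| |A| >= (1 - |s| / alpha) |B|], and [|B|] dominates the
    norm there. *)
Lemma out_phi_bound s : Rabs s < alpha -> exists C0, 0 < C0 /\ forall d,
  alpha * Rabs (A d) <= Rabs (B d) -> n1 d <= C0 * Rabs (dot (vsub pB (vscale s pA)) d).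
Proof.
  intros Hs. pose proof cst_pos. exists (cst * (alpha / (alpha - Rabs s))).
  assert (P : 0 < alpha / (alpha - Rabs s)) by (apply Rdiv_lt_0_compat; lra).
  split; [nra|]. intros d Hd.
  eapply Rle_trans; [apply (out_cone_bound pA pB alpha alpha_pos coord_indep d Hd)|].
  rewrite Rmult_assoc. apply Rmult_le_compat_l; [lra|].
  replace (dot (vsub pB (vscale s pA)) d) with (B d - s * A d) by vring.
  pose proof (Rabs_triang_inv (B d) (s * A d)) as T. rewrite Rabs_mult in T.
  rpos s. rpos (A d). rpos (B d).
  apply Rmult_le_reg_r with (alpha - Rabs s); [lra|].
  replace (alpha / (alpha - Rabs s) * Rabs (B d - s * A d) * (alpha - Rabs s)) with
    (alpha * Rabs (B d - s * A d)) by (field; lra). nra.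
Qed.

(** The functional is an exact left eigenvector of the derivative, and on a level it dominates the
    norm, so it absorbs the remainder. It replaces the missing tangent of the level. *)
Lemma leaf_derivative n z s l1 l2 eps : cone_eigen (DFn' n z) s l1 l2 -> 0 < eps ->
  exists delta, 0 < delta /\ forall x y, dist x z < delta -> dist y z < delta -> lev x = lev y ->
    Rabs (dot (vsub pB (vscale s pA)) (vsub (iter n F x) (iter n F y))
          - l2 * dot (vsub pB (vscale s pA)) (vsub x y))
      <= eps * Rabs (dot (vsub pB (vscale s pA)) (vsub x y)).
Proof.
  intros [Hs [_ [_ [_ [Hphi _]]]]] He. destruct (out_phi_bound s Hs) as [C0 [HC0 HC]].
  set (pf := vsub pB (vscale s pA)) in *. npos pf.
  destruct (Fn_sder n z (eps / (C0 * (n1 pf + 1)))) as [d [Hd HS]].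
  { apply Rdiv_lt_0_compat; nra. }
  exists d. split; auto. intros x y Hx Hy E. specialize (HS x y Hx Hy).
  rewrite <- Hphi, <- dot_sub. eapply Rle_trans; [apply dot_le|].
  specialize (HC (vsub x y) (lev_out x y E)). unfold dist in HS.
  set (er := n1 (vsub (vsub (iter n F x) (iter n F y)) (mv (DFn' n z) (vsub x y)))) in *.
  npos (vsub x y). rpos (dot pf (vsub x y)).
  assert (P : 0 < eps / (C0 * (n1 pf + 1))) by (apply Rdiv_lt_0_compat; nra).
  apply Rle_trans with (n1 pf * (eps / (C0 * (n1 pf + 1)) * (C0 * Rabs (dot pf (vsub x y))))).
  - apply Rmult_le_compat_l; auto. eapply Rle_trans; [apply HS|]. apply Rmult_le_compat_l; lra.
  - replace (n1 pf * (eps / (C0 * (n1 pf + 1)) * (C0 * Rabs (dot pf (vsub x y))))) with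
      (eps * Rabs (dot pf (vsub x y)) * (n1 pf / (n1 pf + 1))) by (field; lra).
    rewrite <- (Rmult_1_r (eps * Rabs (dot pf (vsub x y)))) at 2.
    apply Rmult_le_compat_l; [nra|]. apply Rmult_le_reg_r with (n1 pf + 1); [lra|].
    unfold Rdiv. rewrite Rmult_assoc, Rinv_l; lra.
Qed.

(** While one orbit stays near the saddle, nearby points of its level do not drift from it in the
    functional, so they stay near too and contract at each step, although the level need not be that
    of the saddle. *)
Lemma leaf_tracking N kz z s l1 l2 : lattice kz -> shifted N kz z = z ->
  cone_eigen (DFn' N z) s l1 l2 -> Rabs l2 < 1 ->
  exists r C q, 0 < r /\ 0 < C /\ 0 <= q < 1 /\ forall j y,
    (forall l, (l <= j)%nat -> dist (iter l (shifted N kz) y) z < r) ->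
    forall x x', lev x = lev y -> lev x' = lev y -> dist x y < r -> dist x' y < r ->
    dist (iter j (shifted N kz) x) (iter j (shifted N kz) x') <= C * q ^ j * dist x x'.
Proof.
  intros Lk Hz He Hl2. destruct (leaf_derivative N z s l1 l2 ((1 - Rabs l2) / 2) He) as [r0 [Hr0 Hst]]; [lra|].
  destruct He as [Hs _]. destruct (out_phi_bound s Hs) as [C0 [HC0 HC]].
  set (pf := vsub pB (vscale s pA)) in *. pose proof (n1_pos pf) as Ppf.
  set (C := C0 * (n1 pf + 1)). assert (HCp : 0 < C) by (unfold C; nra).
  set (q := (1 + Rabs l2) / 2). pose proof (Rabs_pos l2) as Pl2.
  assert (Hq : 0 <= q < 1) by (unfold q; lra).
  set (T := shifted N kz) in *.
  assert (HT : forall x y, dist x z < r0 -> dist y z < r0 -> lev x = lev y ->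
            Rabs (dot pf (vsub (T x) (T y))) <= q * Rabs (dot pf (vsub x y))).
  { intros x y Hx Hy E. specialize (Hst x y Hx Hy E).
    replace (vsub (T x) (T y)) with (vsub (iter N F x) (iter N F y)) by (unfold T, shifted; vring).
    pose proof (Rabs_triang_inv (dot pf (vsub (iter N F x) (iter N F y))) (l2 * dot pf (vsub x y))) as T1.
    rewrite Rabs_mult in T1. unfold q. lra. }
  assert (Hlev : forall l x y, lev x = lev y -> lev (iter l T x) = lev (iter l T y)).
  { intros l x y E. induction l; simpl; auto. unfold T. rewrite !shifted_lev by auto. fold T. rewrite IHl. auto. }
  assert (Hphi : forall x y, lev x = lev y -> dist x y <= C0 * Rabs (dot pf (vsub x y))).
  { intros x y E. apply HC, lev_out; auto. }
  assert (Hphi2 : forall x y, C0 * Rabs (dot pf (vsub x y)) <= C * dist x y).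
  { intros x y. pose proof (dot_le pf (vsub x y)). pose proof (dist_pos x y). unfold dist, C in *. nra. }
  (* Chosen so that the distance [r] of the guide from [z] plus the drift [C r] from it stay below
     [r0]. *)
  set (r := r0 / (2 * (1 + C))). assert (Hr : 0 < r) by (apply Rdiv_lt_0_compat; lra).
  assert (Er : r * (1 + C) = r0 / 2) by (unfold r; field; lra).
  exists r, C, q. split; auto. split; auto. split; auto.
  intros j y Hy x x' Ex Ex' Hx Hx'.
  assert (Hstay : forall w, lev w = lev y -> dist w y < r -> forall l, (l <= j)%nat ->
     Rabs (dot pf (vsub (iter l T w) (iter l T y))) <= Rabs (dot pf (vsub w y)) /\
     dist (iter l T w) z < r0).
  { intros w Ew Hw.
    assert (Hd : forall l, (l <= j)%nat ->
      Rabs (dot pf (vsub (iter l T w) (iter l T y))) <= Rabs (dot pf (vsub w y)) ->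
      dist (iter l T w) z < r0).
    { intros l Hl H1. pose proof (Hphi (iter l T w) (iter l T y) (Hlev l _ _ Ew)).
      pose proof (Hphi2 w y). specialize (Hy l Hl).
      pose proof (dist_tri (iter l T w) (iter l T y) z). nra. }
    induction l; intros Hl.
    - simpl. split; [lra|]. apply (Hd 0%nat); simpl; [lia|lra].
    - destruct (IHl ltac:(lia)) as [I1 I2]. 
      assert (I3 : Rabs (dot pf (vsub (iter (S l) T w) (iter (S l) T y))) <= Rabs (dot pf (vsub w y))).
      { simpl. eapply Rle_trans; [apply HT; auto|].
        - specialize (Hy l ltac:(lia)). nra.
        - rpos (dot pf (vsub (iter l T w) (iter l T y))). nra. }
      split; auto. }
  assert (Hcon : forall l, (l <= j)%nat ->
     Rabs (dot pf (vsub (iter l T x) (iter l T x'))) <= q ^ l * Rabs (dot pf (vsub x x'))).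
  { induction l; intros Hl; [simpl; lra|]. simpl. eapply Rle_trans; [apply HT|].
    - apply Hstay; auto; lia.
    - apply Hstay; auto; lia.
    - apply Hlev. lra.
    - rewrite Rmult_assoc. apply Rmult_le_compat_l; [lra|]. apply IHl. lia. }
  specialize (Hcon j (Nat.le_refl j)). pose proof (pow_le q j (proj1 Hq)).
  eapply Rle_trans; [apply Hphi; apply Hlev; lra|].
  apply Rle_trans with (q ^ j * (C0 * Rabs (dot pf (vsub x x')))); [nra|].
  pose proof (Hphi2 x x'). replace (C * q ^ j * dist x x') with (q ^ j * (C * dist x x')) by ring.
  apply Rmult_le_compat_l; auto.
Qed.

Lemma leaf_neighbour z delta : 0 < delta ->
  exists x, lev x = lev z /\ dist x z < delta /\ x <> z.
Proof.
  intros Hd. pose proof cst_pos. set (t := delta / (2 * cst)).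
  assert (Ht : 0 < t) by (apply Rdiv_lt_0_compat; lra).
  exists (leafpt' (lev z) (B z + t)). split; [apply lev_leafpt|]. split.
  - rewrite <- (leafpt_lev z) at 3. eapply Rle_lt_trans; [apply leafpt_lip|].
    replace (B z + t - B z) with t by ring. rewrite Rabs_pos_eq by lra.
    replace (cst * t) with (delta / 2) by (unfold t; field; lra). lra.
  - intros E. pose proof (B_leafpt (lev z) (B z + t)) as E1. rewrite E in E1. lra.
Qed.

(* The iterates of a nearby point of the level set converge to [z] like [2^-j], whereas an
   eigenvalue [l2] of modulus at least 1 would keep them above [(3/4)^j]. *)
Lemma contracting_is_saddle n k z delta : (1 <= n)%nat -> lattice k -> shifted n k z = z -> 0 < delta ->
  (forall x, lev x = lev z -> dist x z < delta -> dist (shifted n k x) z <= / 2 * dist x z) ->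
  is_saddle M G DG z.
Proof.
  intros Hn Lk Hz Hd Hcon. destruct (DFn_eigen n z Hn) as [s [l1 [l2 He]]].
  assert (Hl2 : Rabs l2 < 1).
  { apply Rnot_le_lt. intros L.
    destruct (leaf_derivative n z s l1 l2 (1 / 4) He) as [d [Hd' Hst]]; [lra|].
    pose proof (proj1 He) as Hs. destruct (out_phi_bound s Hs) as [C0 [HC0 HC]].
    set (pf := vsub pB (vscale s pA)) in *. set (T := shifted n k) in *.
    destruct (pos_min2 delta d Hd Hd') as [e [Pe He12]].
    destruct (leaf_neighbour z e Pe) as [x [Ex [Hx Hxz]]].
    assert (Hj : forall j, lev (iter j T x) = lev z /\
       dist (iter j T x) z <= (/ 2) ^ j * dist x z /\
       (3 / 4) ^ j * Rabs (dot pf (vsub x z)) <= Rabs (dot pf (vsub (iter j T x) z))).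
    { induction j as [|j [I1 [I2 I3]]]; [simpl; repeat split; auto; lra|].
      assert (Hle : dist (iter j T x) z <= dist x z).
      { pose proof (dist_pos x z). assert ((/ 2) ^ j <= 1).
        { rewrite <- (pow1 j). apply pow_incr. lra. } nra. }
      simpl. split; [|split].
      - transitivity (lev (T z)); [|rewrite Hz; auto].
        unfold T at 1 3. rewrite !shifted_lev, I1 by auto. auto.
      - eapply Rle_trans; [apply Hcon; auto; lra|]. rewrite Rmult_assoc. apply Rmult_le_compat_l; lra.
      - specialize (Hst (iter j T x) z ltac:(lra) ltac:(rewrite dist_refl; auto) I1).
        replace (vsub (T (iter j T x)) z) with
          (vsub (iter n F (iter j T x)) (iter n F z))
          by (rewrite <- Hz at 2; unfold T, shifted; vring).
        set (a := dot pf (vsub (iter n F (iter j T x)) (iter n F z))) in *.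
        set (b := dot pf (vsub (iter j T x) z)) in *.
        pose proof (Rabs_triang_inv (l2 * b) a) as T1. rewrite (Rabs_minus_sym (l2 * b)), Rabs_mult in T1.
        rpos b. nra. }
    pose proof (HC (vsub x z) (lev_out x z Ex)) as Hpx. fold (dist x z) in Hpx.
    assert (Px : 0 < dist x z).
    { destruct (Rle_lt_or_eq_dec _ _ (dist_pos x z)) as [P|P]; auto. elim Hxz. apply dist_eq; auto. }
    set (a := Rabs (dot pf (vsub x z))) in *. assert (Pa : 0 < a) by nra.
    destruct (pow_small (2 / 3) (n1 pf * dist x z) a) as [j Hjj]; [lra|auto|].
    specialize (Hjj j (Nat.le_refl j)). destruct (Hj j) as [_ [J2 J3]].
    pose proof (dot_le pf (vsub (iter j T x) z)) as J4. fold (dist (iter j T x) z) in J4.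
    npos pf. pose proof (pow_lt (3 / 4) j ltac:(lra)).
    (* The ratio of the two rates, [/ 2] over [3 / 4]. *)
    assert (J5 : (/ 2) ^ j = (3 / 4) ^ j * (2 / 3) ^ j) by (rewrite <- Rpow_mult_distr; f_equal; field).
    rewrite J5 in J2. nra. }
  exists n. split; [lia|]. split.
  { rewrite <- Hz at 2. apply eqT_sym, eqT_sub_lattice; auto. }
  exists l1, 0, l2, 0. split; [apply (cone_eigen_is_root _ _ _ _ _ He); auto|].
  split; [apply sq_gt1; apply He|]. split; [apply (cone_eigen_is_root _ _ _ _ _ He); auto|].
  rewrite <- (pow2_abs l2). rpos l2. simpl. nra.
Qed.

Lemma in_cone_sym x y : inC (vsub x y) -> inC (vsub y x).
Proof.
  unfold in_cone. rewrite !dot_sub, (Rabs_minus_sym (B x)), (Rabs_minus_sym (A x)). auto.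
Qed.

Lemma iter_shifted_injective n k j x y :
  iter j (shifted n k) x = iter j (shifted n k) y -> x = y.
Proof.
  intros E. apply (f_equal (iter j (shifted_inv n k))) in E.
  rewrite !(iter_cancel (shifted_inv n k) (shifted n k)) in E by apply shifted_invK. auto.
Qed.

Lemma iter_shifted_lev n k j x y : lattice k -> lev x = lev y ->
  lev (iter j (shifted n k) x) = lev (iter j (shifted n k) y).
Proof. intros Lk E. induction j; simpl; auto. rewrite !shifted_lev, IHj by auto. auto. Qed.

(** Read in the charts of the levels, the map is a continuous injective function of one variable. *)
Lemma leaf_between n k j a b c : lattice k -> lev a = lev b -> lev c = lev b ->
  B a < B b < B c \/ B c < B b < B a ->
  let T := iter j (shifted n k) in
  B (T a) < B (T b) < B (T c) \/ B (T c) < B (T b) < B (T a).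
Proof.
  intros Lk Ea Ec H T.
  assert (E : forall w, lev w = lev b -> B (T w) = B (T (leafpt' (lev b) (B w)))).
  { intros w Ew. rewrite <- Ew, leafpt_lev. auto. }
  rewrite (E a), (E b), (E c) by auto.
  apply (injective_between' (fun t => B (T (leafpt' (lev b) t)))); auto.
  - apply leaf_map_continuity. intros z. apply loclip_cont, loclip_iter, shifted_loclip.
  - intros t t' Et. rewrite <- (B_leafpt (lev b) t), <- (B_leafpt (lev b) t'). f_equal.
    apply (iter_shifted_injective n k j). apply lev_B_eq; auto.
    apply iter_shifted_lev; auto. rewrite !lev_leafpt. auto.
Qed.

Lemma B_between a b c a' b' c' g : g <= Rabs (B b - B a) -> g <= Rabs (B c - B b) ->
  Rabs (B a' - B a) < g / 2 -> Rabs (B b' - B b) < g / 2 -> Rabs (B c' - B c) < g / 2 ->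
  B a < B b < B c \/ B c < B b < B a -> B a' < B b' < B c' \/ B c' < B b' < B a'.
Proof.
  intros H1 H2 H3 H4 H5 H. apply Rabs_def2 in H3, H4, H5. destruct H as [H|H]; [left|right];
  [rewrite Rabs_pos_eq in H1, H2 by lra|rewrite Rabs_left in H1, H2 by lra]; lra.
Qed.

(* A point [y] near [x0] lying on a homoclinic orbit of [z0]: it is carried by [F^n] to the
   level set of [z0] and has the preimage [x] backward asymptotic to [z0]. Two points of the level
   set of a preimage of [z0] follow, backwards, two distinct points of the curve, while the unstable
   set of [z0] meets the curve; for a suitable time it separates their backward images. *)
Lemma homoclinic N kz z0 x0 eps r : (1 <= N)%nat -> lattice kz -> shifted N kz z0 = z0 ->
  0 < eps -> 0 < r ->
  exists n k1 i k2 x y, lattice k1 /\ lattice k2 /\ dist y x0 < eps /\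
    lev (shifted n k1 y) = lev z0 /\ dist (shifted n k1 y) z0 < r /\
    shifted i k2 x = y /\ forall l, dist (iter l (shifted_inv N kz) x) z0 < r.
Proof.
  intros HN Lkz Hz He Hr.
  destruct (transitive_F x0 (eps / 2) z0) as [n [u [Hu En]]]; [lra|].
  apply eqT_ex in En. destruct En as [k1 [Lk1 En]].
  assert (Eu : shifted n k1 u = z0) by (unfold shifted; rewrite En; vring).
  destruct (shifted_cont n k1 u r Hr) as [d1 [Hd1 C1]]. rewrite Eu in C1.
  destruct (pos_min2 d1 (eps / 2)) as [d2 [Hd2 [M1 M2]]]; try lra.
  pose proof cst_pos as Pc. set (tau := d2 / (2 * cst)).
  assert (Htau : 0 < tau) by (apply Rdiv_lt_0_compat; lra).
  assert (Etau : cst * tau = d2 / 2) by (unfold tau; field; lra).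
  (* Second end of a short arc of the level of [u], to be crossed by the unstable set of [z0]. *)
  set (u' := leafpt' (lev u) (B u + tau)).
  assert (Lu' : lev u' = lev u) by apply lev_leafpt.
  assert (Bu' : B u' = B u + tau) by apply B_leafpt.
  destruct curve_structure as [k0 [kT [Lk0 [_ [LkT [HA0 [Hk0 [HT [Hlg [Hon Hbi]]]]]]]]]].
  destruct (backward_to_curve kT u LkT Hon) as [th [C HC]].
  destruct (backward_to_curve kT u' LkT Hon) as [th' [C' HC']].
  set (Si := shifted_inv p kT) in *.
  (* If both ends shadowed the same curve point, they would be backward asymptotic at the unstable
     rate within one level, hence equal. *)
  assert (Hth : th <> th').
  { intros E. subst th'. assert (u = u').
    { apply (back_eq p kT p_pos LkT u u' (C + C')); auto. intros j. fold Si.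
      specialize (HC j). specialize (HC' j).
      pose proof (dist_tri (iter j Si u) (iter j Si (gamma th)) (iter j Si u')) as T1.
      rewrite (dist_sym (iter j Si (gamma th)) (iter j Si u')) in T1.
      pose proof (pow_lt (K ^ p) j ltac:(apply pow_lt; lra)). nra. }
    rewrite <- H in Bu'. lra. }
  destruct (back_ex N kz HN Lkz z0 (fixed_level p kT)) as [q [Lq Hq]].
  destruct (Hon q Lq) as [sq Esq].
  (* The rotation preserves the parameter difference [Dl]; [s0] places [sq] midway between the two
     shadows. *)
  set (Dl := th' - th). set (s0 := sq - Dl / 2).
  assert (HDl : Dl <> 0) by (unfold Dl; lra).
  assert (Hbet : B (gamma s0) < B (gamma sq) < B (gamma (s0 + Dl)) \/
                 B (gamma (s0 + Dl)) < B (gamma sq) < B (gamma s0)).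
  { apply (injective_between' (fun s => B (gamma s))); auto.
    - apply rcont_dot, gamma_rcont.
    - unfold s0. destruct (Rlt_or_le 0 Dl); [left|right]; lra. }
  destruct (pos_min2 (Rabs (B (gamma sq) - B (gamma s0))) (Rabs (B (gamma (s0 + Dl)) - B (gamma sq))))
    as [g [Hg [G1 G2]]]; try (apply Rabs_pos_lt; lra).
  pose proof (n1_pos pB) as PB. set (e1 := g / (4 * (n1 pB + 1))).
  assert (He1 : 0 < e1) by (apply Rdiv_lt_0_compat; lra).
  assert (HBe : forall a b, dist a b < 2 * e1 -> Rabs (B a - B b) < g / 2).
  { intros a b Hab. eapply Rle_lt_trans; [apply dot_dist|]. pose proof (dist_pos a b).
    replace (g / 2) with ((n1 pB + 1) * (2 * e1)) by (unfold e1; field; lra). nra. }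
  destruct (gamma_rcont s0 e1 He1) as [g1 [Hg1 Cg1]].
  destruct (gamma_rcont (s0 + Dl) e1 He1) as [g2 [Hg2 Cg2]].
  destruct (lev_close q e1 He1) as [dq [Hdq Cq]].
  destruct (back_level_tendsto p kT p_pos LkT u dq Hdq) as [N1 HN1]. fold Si in HN1.
  destruct (back_tendsto p kT p_pos u (gamma th) C e1 He1 HC) as [N2 HN2]. fold Si in HN2.
  destruct (back_tendsto p kT p_pos u' (gamma th') C' e1 He1 HC') as [N3 HN3]. fold Si in HN3.
  destruct gamma_quasi as [_ [_ [_ [Hirr _]]]].
  destruct (pos_min2 g1 g2 Hg1 Hg2) as [gm [Pgm Hgm]].
  (* At time [-j] the ends of the arc are, up to the translation [sh], near [gamma s0] and
     [gamma (s0 + Dl)]. *)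
  destruct (irrational_dense rho Hirr (th - s0) gm (N1 + N2 + N3)%nat Pgm) as [j [l [Hj Hl]]].
  specialize (HN1 j ltac:(lia)). specialize (HN2 j ltac:(lia)). specialize (HN3 j ltac:(lia)).
  unfold Si in HN2, HN3. rewrite gamma_back in HN2, HN3 by auto. fold Si in HN2, HN3.
  set (sh := vscale (IZR l) k0). assert (Lsh : lattice sh) by (apply lattice_scale_Z; auto).
  set (w := th - s0 - INR j * rho - IZR l) in *.
  replace (th - INR j * rho) with (s0 + w + IZR l) in HN2 by (unfold w; ring).
  replace (th' - INR j * rho) with (s0 + Dl + w + IZR l) in HN3 by (unfold w, Dl; ring).
  rewrite (gamma_iter k0 Hk0) in HN2, HN3. fold sh in HN2, HN3.
  specialize (Cg1 (s0 + w) ltac:(replace (s0 + w - s0) with w by ring; lra)).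
  specialize (Cg2 (s0 + Dl + w) ltac:(replace (s0 + Dl + w - (s0 + Dl)) with w by ring; lra)).
  set (a := iter j Si u) in *. set (a' := iter j Si u') in *.
  (* Continues the unstable set of [z0] from [q] to the level of the pulled-back arc; the levels are
     close, so [x] is close to [q]. *)
  destruct (back_ex N kz HN Lkz q (lev a)) as [x [Lx Hx]].
  assert (Dx : dist x q < e1).
  { apply Cq; [apply in_cone_sym; apply (Hx 0%nat)|]. rewrite Lx, Lq. auto. }
  assert (Laa : lev a' = lev a).
  { pose proof (back_level p kT p_pos LkT j u) as E1. pose proof (back_level p kT p_pos LkT j u') as E2.
    fold Si in E1, E2. fold a in E1. fold a' in E2. rewrite Lu', <- E1 in E2.
    apply Rmult_eq_reg_l in E2; [lra|]. apply pow_nonzero, mu_pow_ne0. }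
  set (b := vadd x sh).
  assert (Lb : lev b = lev a).
  { unfold b. rewrite lev_add_lattice, Lx by auto. unfold sh. rewrite dot_scale, HA0. ring. }
  assert (Hba : B (vsub a sh) < B x < B (vsub a' sh) \/ B (vsub a' sh) < B x < B (vsub a sh)).
  { apply (B_between (gamma s0) (gamma sq) (gamma (s0 + Dl)) (vsub a sh) x (vsub a' sh) g); auto; apply HBe.
    - pose proof (dist_tri (vsub a sh) (gamma (s0 + w)) (gamma s0)) as T1.
      replace (dist (vsub a sh) (gamma (s0 + w))) with (dist a (vadd (gamma (s0 + w)) sh)) in T1
        by (unfold dist; f_equal; vring). lra.
    - rewrite <- Esq. lra.
    - pose proof (dist_tri (vsub a' sh) (gamma (s0 + Dl + w)) (gamma (s0 + Dl))) as T1.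
      replace (dist (vsub a' sh) (gamma (s0 + Dl + w))) with (dist a' (vadd (gamma (s0 + Dl + w)) sh)) in T1
        by (unfold dist; f_equal; vring). lra. }
  assert (Hbb : B a < B b < B a' \/ B a' < B b < B a).
  { unfold b. rewrite dot_add. rewrite !dot_sub in Hba. lra. }
  (* The translate [b] of [x] separates [a] from [a']; [j] forward steps put [y] between [u] and
     [u']. *)
  pose proof (leaf_between p kT j a b a' LkT ltac:(lra) ltac:(lra) Hbb) as Hy. cbv zeta in Hy.
  assert (Hcan : forall v, iter j (shifted p kT) (iter j Si v) = v).
  { intros v. apply iter_cancel. intros z. apply shifted_K. }
  unfold a, a' in Hy. rewrite !Hcan in Hy. set (y := iter j (shifted p kT) b) in *.
  assert (Ly : lev y = lev u).
  { rewrite <- (Hcan u). apply iter_shifted_lev; auto. }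
  assert (Dy : dist y u < d2).
  { pose proof (lev_dist y u Ly) as E. rewrite Bu' in Hy.
    assert (Hb : Rabs (B y - B u) < tau) by (apply Rabs_def1; lra).
    apply (Rmult_lt_compat_l _ _ _ Pc) in Hb. lra. }
  destruct (shifted_iter p kT j LkT) as [k' [Lk' Hk']].
  destruct (back_tendsto N kz HN q x (cst * n1 pA * dist q x) (r / 2)) as [P1 HP1]; [lra| |].
  { intros l'. apply back_dist; auto. }
  destruct (back_tendsto N kz HN z0 q (cst * n1 pA * dist z0 q) (r / 2)) as [P2 HP2]; [lra| |].
  { intros l'. apply back_dist; auto. }
  (* Going [l0] further steps back along the unstable set puts the whole remaining backward orbit
     within [r] of [z0]. *)
  set (Ti := shifted_inv N kz) in *. set (l0 := (P1 + P2)%nat).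
  assert (Hzi : Ti z0 = z0) by (unfold Ti; rewrite <- Hz at 1; apply shifted_invK).
  assert (Hzij : forall j, iter j Ti z0 = z0) by (induction j0; simpl; auto; rewrite IHj0; auto).
  destruct (shifted_iter N kz l0 Lkz) as [k3 [Lk3 Hk3]].
  exists n, k1, (p * j + N * l0)%nat,
    (vsub (vadd k' (iter (p * j) (mv M) k3)) (iter (p * j) (mv M) sh)), (iter l0 Ti x), y.
  split; auto. split.
  { apply lattice_sub; [apply lattice_add; auto|]; apply Mn_lattice; auto. }
  split; [pose proof (dist_tri y u x0); lra|].
  split; [rewrite <- Eu, !shifted_lev, Ly by auto; auto|].
  split; [apply C1; lra|]. split.
  - unfold shifted. rewrite Nat.iter_add.
    assert (E3 : iter (N * l0) F (iter l0 Ti x) = vadd x k3).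
    { pose proof (Hk3 (iter l0 Ti x)) as E. unfold Ti in E at 1.
      rewrite (iter_cancel (shifted N kz) (shifted_inv N kz)) in E by apply shifted_K.
      rewrite E at 2. vring. }
    rewrite E3. unfold y. rewrite Hk'. unfold b. rewrite !Fn_add_lattice by auto. vring.
  - intros l'. rewrite <- Nat.iter_add.
    specialize (HP1 (l' + l0)%nat ltac:(lia)). specialize (HP2 (l' + l0)%nat ltac:(lia)).
    rewrite Hzij in HP2.
    pose proof (dist_tri (iter (l' + l0) Ti x) (iter (l' + l0) Ti q) z0) as T1.
    rewrite (dist_sym (iter (l' + l0) Ti x) (iter (l' + l0) Ti q)) in T1.
    rewrite (dist_sym (iter (l' + l0) Ti q) z0) in T1. lra.
Qed.

(** The loop leaving [y] through [S1], staying [j] steps near [z0] and returning by [S2] expands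
    levels affinely, so it has one invariant level, close to that of [y]. An arc of it is contracted
    by the passage near the saddle. *)
Lemma saddles_dense z0 : is_saddle M G DG z0 -> forall x0 eps, 0 < eps ->
  exists z, is_saddle M G DG z /\ dist z x0 < eps.
Proof.
  intros [N [HN [Hper [a1 [b1 [a2 [b2 [_ [_ [Hroot Hlt]]]]]]]]]] x0 eps He.
  apply eqT_ex in Hper. destruct Hper as [kz [Lkz Ez]].
  assert (Hz : shifted N kz z0 = z0) by (unfold shifted; rewrite Ez; vring).
  destruct (DFn_eigen N z0 HN) as [s [l1 [l2 Heig]]].
  assert (Hl2 : Rabs l2 < 1).
  { destruct (cone_eigen_roots _ _ _ _ _ _ Heig Hroot) as [-> [->| ->]].
    - destruct Heig as [_ [Hl1 _]]. pose proof (sq_gt1 l1 Hl1). lra.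
    - rewrite <- (pow2_abs l2) in Hlt. rpos l2. simpl in Hlt. nra. }
  destruct (leaf_tracking N kz z0 s l1 l2 Lkz Hz Heig Hl2) as [r [C [q [Hr [HC [Hq Htrack]]]]]].
  destruct (homoclinic N kz z0 x0 (eps / 2) (r / 4)) as
    [n [k1 [i [k2 [x [y [Lk1 [Lk2 [Hy [Hy1 [Hy2 [Hx1 Hx2]]]]]]]]]]]]; auto; [lra|lra|].
  set (T := shifted N kz) in *. set (Ti := shifted_inv N kz) in *.
  set (S1 := shifted n k1) in *. set (S2 := shifted i k2) in *.
  assert (Hh0 : fixed_level N kz = lev z0).
  { pose proof (shifted_lev N kz z0 Lkz) as E. fold T in E. rewrite Hz in E. unfold fixed_level.
    pose proof (mu_pow_ne1 N HN). apply Rmult_eq_reg_r with (mu ^ N - 1); auto.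
    unfold Rdiv. rewrite Rmult_assoc, Rinv_l by auto. lra. }
  set (h0 := lev z0) in *.
  assert (LS1 : forall w, lev (S1 w) = h0 + mu ^ n * (lev w - lev y)).
  { intros w. rewrite <- Hy1. unfold S1. rewrite !shifted_lev by auto. ring. }
  assert (LS2 : forall w, lev (S2 w) = lev y + mu ^ i * (lev w - lev x)).
  { intros w. rewrite <- Hx1. unfold S2. rewrite !shifted_lev by auto. ring. }
  assert (LTi : forall j w, (mu ^ N) ^ j * (lev (iter j Ti w) - h0) = lev w - h0).
  { intros j w. rewrite <- Hh0. apply back_level; auto. }
  assert (LT : forall j w, lev (iter j T w) = h0 + (mu ^ N) ^ j * (lev w - h0)).
  { intros j w. pose proof (LTi j (iter j T w)) as E.
    rewrite (iter_cancel Ti T) in E by apply shifted_invK. lra. }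
  destruct (shifted_loclip n k1 y) as [Ln [dn [HLn [Hdn Lipn]]]]. fold S1 in Lipn.
  destruct (shifted_cont n k1 y (r / 4)) as [d1 [Hd1 C1]]; [lra|]. fold S1 in C1.
  destruct (pos_min3 (eps / 2) (dn / 2) (d1 / 2)) as [e1 He1]; try lra.
  destruct (shifted_loclip i k2 x) as [Li [di [HLi [Hdi Lipi]]]]. fold S2 in Lipi.
  destruct (shifted_cont i k2 x (e1 / 2)) as [d3 [Hd3 C3]]; [lra|]. fold S2 in C3. rewrite Hx1 in C3.
  destruct (pos_min2 di d3 Hdi Hd3) as [e3 [He3 [M1 M2]]].
  set (C' := cst * n1 pA).
  assert (HC' : 0 <= C') by (unfold C'; pose proof cst_pos; npos pA; nra).
  assert (P2 : 0 < r / (4 * (C' + 1))) by (apply Rdiv_lt_0_compat; lra).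
  destruct (pos_min2 (e3 / 2) _ ltac:(lra) P2) as [e2 [He2 [M3 M4]]].
  assert (HC2 : C' * e2 <= r / 4).
  { apply Rle_trans with ((C' + 1) * (r / (4 * (C' + 1)))); [|right; field; lra].
    apply Rmult_le_compat; lra. }
  destruct (lev_close y e1 (proj1 He1)) as [da [Hda Ca]].
  destruct (lev_close x e2 He2) as [db [Hdb Cb]].
  destruct (pos_min2 da db Hda Hdb) as [dm [Pdm Hdm]].
  (* By how much one loop shifts the level of [y]; it does not depend on [j]. *)
  set (E := mu ^ i * (h0 - lev x)).
  destruct (pow_small (/ 2) (2 * Rabs E) dm) as [N1 HN1]; [lra|auto|].
  destruct (pow_small q (C * r) (e3 / 2) Hq) as [N2 HN2]; [lra|].
  destruct (pow_small q (Li * (C * Ln)) (/ 2) Hq) as [N3 HN3]; [lra|].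
  (* [N1] brings the invariant level close to that of [y], [N2] keeps the returning arc small, [N3]
     gives the ratio [/ 2]; the 1 ensures [|mj| >= 2]. *)
  set (j := (N1 + N2 + N3 + 1)%nat).
  specialize (HN1 j ltac:(lia)). specialize (HN2 j ltac:(lia)). specialize (HN3 j ltac:(lia)).
  pose proof (pow_le q j (proj1 Hq)) as Pq.
  set (mj := mu ^ (n + (N * j + i))).
  assert (Emj : mj = mu ^ i * ((mu ^ N) ^ j * mu ^ n)).
  { unfold mj. rewrite !pow_add, pow_mult. ring. }
  assert (Hmj : 2 ^ j <= Rabs mj).
  { unfold mj. eapply Rle_trans; [|apply mu_pow_ge]. apply Rle_pow; [lra|nia]. }
  assert (Hj2 : 2 <= 2 ^ j).
  { replace 2 with (2 ^ 1) at 1 by ring. apply Rle_pow; [lra|unfold j; lia]. }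
  assert (Hmj1 : 1 - mj <> 0).
  { intros E0. replace mj with 1 in Hmj by lra. rewrite Rabs_R1 in Hmj. lra. }
  (* Fixed point of the action [d |-> mj d + E] of the loop on levels measured from [lev y]. *)
  set (del := E / (1 - mj)).
  assert (Edel : del = mj * del + E) by (unfold del; field; auto).
  assert (Hdel : Rabs del <= 2 * Rabs E * (/ 2) ^ j).
  { unfold del, Rdiv. rewrite Rabs_mult, Rabs_inv, pow_inv.
    rewrite (Rmult_comm 2), Rmult_assoc. apply Rmult_le_compat_l; [apply Rabs_pos|].
    assert (Rabs mj / 2 <= Rabs (1 - mj)).
    { pose proof (Rabs_triang_inv mj 1). rewrite Rabs_R1 in *. rewrite (Rabs_minus_sym 1 mj). lra. }
    replace (2 * / 2 ^ j) with (/ (2 ^ j / 2)) by (field; apply pow_nonzero; lra).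
    apply Rinv_le_contravar; lra. }
  set (cs := lev y + del). set (cd := h0 + (mu ^ N) ^ j * (mu ^ n * del)).
  assert (Ecd : mu ^ i * (cd - lev x) = del).
  { rewrite Edel, Emj. unfold cd, E. ring. }
  assert (Hcd : Rabs (cd - lev x) <= Rabs del).
  { rewrite <- Ecd, Rabs_mult. pose proof (mu_pow_ge i). pose proof (pow_R1_Rle 2 i ltac:(lra)).
    rewrite <- (Rmult_1_l (Rabs (cd - lev x))) at 1.
    apply Rmult_le_compat_r; [apply Rabs_pos|lra]. }
  (* [leaf_tracking] needs a guide on the level [cd] reached after the passage. The unstable set of
     [x] supplies it, and its backward orbit remains near that of [x], hence near [z0]. *)
  destruct (back_ex N kz HN Lkz x cd) as [xd [Lxd Hxd]]. fold Ti in Hxd.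
  assert (Dxd : dist xd x < e2).
  { apply Cb; [apply in_cone_sym; apply (Hxd 0%nat)|]. rewrite Lxd. lra. }
  set (p0 := iter j Ti xd).
  assert (Horb : forall l, (l <= j)%nat -> dist (iter l T p0) z0 < r / 2).
  { intros l Hl. unfold p0, T. unfold Ti at 1.
    rewrite (iter_cancel_le (shifted N kz) (shifted_inv N kz)) by (auto; apply shifted_K). fold Ti.
    pose proof (back_dist_le N kz HN x xd (j - l) Hxd) as E1. fold Ti C' in E1.
    rewrite (dist_sym x xd) in E1. specialize (Hx2 (j - l)%nat).
    pose proof (dist_tri (iter (j - l) Ti xd) (iter (j - l) Ti x) z0) as T1.
    rewrite (dist_sym (iter (j - l) Ti xd) (iter (j - l) Ti x)) in T1.
    assert (C' * dist xd x <= C' * e2) by (apply Rmult_le_compat_l; lra). lra. }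
  assert (Hp0 : iter j T p0 = xd).
  { unfold p0, T, Ti. apply iter_cancel. apply shifted_K. }
  assert (Lp0 : lev p0 = h0 + mu ^ n * del).
  { pose proof (LTi j xd) as E1. fold p0 in E1. rewrite Lxd in E1. unfold cd in E1.
    assert (P : (mu ^ N) ^ j <> 0) by apply pow_nonzero, mu_pow_ne0.
    assert (E2 : (mu ^ N) ^ j * (lev p0 - h0) = (mu ^ N) ^ j * (mu ^ n * del)) by lra.
    apply Rmult_eq_reg_l in E2; auto. lra. }
  set (L := fun w => S2 (iter j T (S1 w))).
  (* An arc of the invariant level, on which the contraction principle applies. *)
  set (J := fun w => lev w = cs /\ dist w y <= e1).
  assert (HJ1 : forall w, J w -> lev (S1 w) = lev p0 /\ dist (S1 w) p0 < r).
  { intros w [Lw Dw]. rewrite LS1, Lw, Lp0. split; [unfold cs; ring|].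
    specialize (C1 w ltac:(lra)). specialize (Horb 0%nat ltac:(lia)). simpl in Horb.
    pose proof (dist_tri (S1 w) (S1 y) z0). pose proof (dist_tri (S1 w) z0 p0).
    rewrite (dist_sym z0 p0) in *. lra. }
  assert (Horb' : forall l, (l <= j)%nat -> dist (iter l T p0) z0 < r)
    by (intros l Hl; specialize (Horb l Hl); lra).
  assert (HJ2 : forall w, J w -> dist (iter j T (S1 w)) x < e3).
  { intros w Hw. destruct (HJ1 w Hw) as [E1 E2].
    pose proof (Htrack j p0 Horb' (S1 w) p0 E1 eq_refl E2 ltac:(rewrite dist_refl; auto)) as E3.
    rewrite Hp0 in E3. pose proof (dist_tri (iter j T (S1 w)) xd x).
    assert (C * q ^ j * dist (S1 w) p0 <= C * r * q ^ j).
    { replace (C * r * q ^ j) with (C * q ^ j * r) by ring. apply Rmult_le_compat_l; [apply Rmult_le_pos; lra|lra]. }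
    lra. }
  assert (HJ3 : forall w, J w -> lev (L w) = cs /\ dist (L w) y <= e1 / 2).
  { intros w Hw. split.
    - unfold L. rewrite LS2, LT. destruct (HJ1 w Hw) as [E1 _]. rewrite E1, Lp0.
      replace (h0 + (mu ^ N) ^ j * (h0 + mu ^ n * del - h0) - lev x) with (cd - lev x) by (unfold cd; ring).
      rewrite Ecd. auto.
    - apply Rlt_le, C3. specialize (HJ2 w Hw). lra. }
  assert (HLc : forall w w', J w -> J w' -> dist (L w) (L w') <= / 2 * dist w w').
  { intros w w' Hw Hw'. destruct (HJ1 w Hw) as [E1 E2]. destruct (HJ1 w' Hw') as [E1' E2'].
    pose proof (Htrack j p0 Horb' (S1 w) (S1 w') E1 E1' E2 E2') as E3.
    pose proof (Lipn w w' ltac:(destruct Hw; lra) ltac:(destruct Hw'; lra)) as E4.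
    pose proof (HJ2 w Hw). pose proof (HJ2 w' Hw'). unfold L.
    eapply Rle_trans; [apply Lipi; lra|].
    apply Rle_trans with (Li * (C * q ^ j * (Ln * dist w w'))).
    - apply Rmult_le_compat_l; [lra|]. eapply Rle_trans; [apply E3|].
      apply Rmult_le_compat_l; [apply Rmult_le_pos; lra|auto].
    - replace (Li * (C * q ^ j * (Ln * dist w w'))) with (Li * (C * Ln) * q ^ j * dist w w') by ring.
      apply Rmult_le_compat_r; [apply dist_pos|lra]. }
  destruct (banach J L) as [z [[Lz Dz] Fz]].
  - exists (leafpt' cs (B y)). split; [apply lev_leafpt|]. apply Rlt_le, Ca.
    + unfold in_cone. rewrite dot_sub, B_leafpt, Rminus_diag, Rabs_R0.
      rpos (A (vsub (leafpt' cs (B y)) y)). nra.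
    + rewrite lev_leafpt. unfold cs. replace (lev y + del - lev y) with del by ring. lra.
  - intros w Hcl. split.
    + apply NNPP. intros Hne. destruct (lev_cont w (Rabs (cs - lev w))) as [d [Hd Hc]].
      { apply Rabs_pos_lt. lra. }
      destruct (Hcl d Hd) as [w' [[Lw' _] Dw']]. specialize (Hc w' Dw'). rewrite Lw' in Hc. lra.
    + apply Rnot_lt_le. intros Lt. destruct (Hcl (dist w y - e1)) as [w' [[_ P3] P4]]; [lra|].
      pose proof (dist_tri w w' y). rewrite (dist_sym w w') in *. lra.
  - intros w Hw. destruct (HJ3 w Hw). split; auto. lra.
  - exact HLc.
  - assert (Jz : J z) by (split; auto). destruct (HJ3 z Jz) as [_ Dz2]. rewrite Fz in Dz2.
    destruct (loop_form n k1 N kz j i k2 Lk1 Lkz Lk2) as [kk [Lkk Hkk]].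
    fold S1 S2 T in Hkk.
    assert (HL : forall w, shifted (n + (N * j + i)) kk w = L w)
      by (intros w; unfold shifted; rewrite <- Hkk; auto).
    exists z. split; [|pose proof (dist_tri z y x0); lra].
    apply (contracting_is_saddle (n + (N * j + i)) kk z (e1 / 2)); auto.
    + unfold j. nia.
    + rewrite HL. auto.
    + lra.
    + intros w Lw Dw. rewrite HL.
      assert (Jw : J w). { split; [lra|]. pose proof (dist_tri w z y). lra. }
      rewrite <- Fz at 1. auto.
Qed.

(** * Dense orbit *)

(** Nested balls as in the Baire theorem: by [transitive_F] each ball contains a smaller one which
    some iterate carries, modulo the lattice, into the next target. *)
Lemma F_dense_orbit : dense_orbit M G.
Proof.
  destruct countable_targets as [v [t [Ht Hv]]].
  (* States are pairs of a centre and a radius. Positivity of the radius is a premise so that the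
     step is total on bare pairs. *)
  pose (ok := fun j (s s' : vec * R) => 0 < snd s -> 0 < snd s' <= snd s / 2 /\
    (forall z, dist z (fst s') <= snd s' -> dist z (fst s) <= snd s) /\
    exists n k, lattice k /\ forall z, dist z (fst s') <= snd s' ->
      dist (vsub (iter n F z) k) (v j) < t j).
  assert (Hstep : forall j s, exists s', ok j s s').
  { intros j [c r]. destruct (Rlt_or_le 0 r) as [Hr|Hr]; [|exists (c, r); intros H; simpl in H; lra].
    destruct (transitive_F c (r / 2) (v j)) as [n [u [Hu En]]]; [lra|].
    apply eqT_ex in En. destruct En as [k [Lk En]].
    destruct (Fn_cont n u (t j) (Ht j)) as [d [Hd Hc]].
    exists (u, Rmin (d / 2) (r / 2)). intros _. simpl.
    pose proof (Rmin_l (d / 2) (r / 2)). pose proof (Rmin_r (d / 2) (r / 2)).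
    assert (0 < Rmin (d / 2) (r / 2)) by (apply Rmin_pos; lra).
    split; [lra|]. split.
    - intros z Hz. pose proof (dist_tri z u c). lra.
    - exists n, k. split; auto. intros z Hz. specialize (Hc z ltac:(lra)). rewrite En in Hc.
      rewrite <- (dist_subr _ _ k) in Hc.
      replace (vsub (vadd (v j) k) k) with (v j) in Hc by vring. auto. }
  pose (step := fun j s => proj1_sig (constructive_indefinite_description _ (Hstep j s))).
  assert (Hs : forall j s, ok j s (step j s))
    by (intros j s; exact (proj2_sig (constructive_indefinite_description _ (Hstep j s)))).
  pose (s := fix s j := match j with O => (zero, 1) | S i => step i (s i) end).
  assert (Hpos : forall j, 0 < snd (s j)).
  { induction j; simpl; [lra|]. apply (Hs j (s j) IHj). }
  assert (Hok : forall j, ok j (s j) (s (S j))) by (intros j; apply Hs).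
  assert (Hr : forall j, snd (s j) <= (/ 2) ^ j).
  { induction j; [simpl; lra|]. destruct (Hok j (Hpos j)) as [H1 _]. simpl pow. lra. }
  assert (Hnest : forall i j z, dist z (fst (s (j + i)%nat)) <= snd (s (j + i)%nat) ->
            dist z (fst (s j)) <= snd (s j)).
  { induction i; intros j z Hz; [rewrite Nat.add_0_r in Hz; auto|].
    apply (proj1 (proj2 (Hok j (Hpos j)))). apply IHi.
    replace (S j + i)%nat with (j + S i)%nat by lia. auto. }
  destruct (geom_cauchy (fun j => fst (s j)) 1) as [l [Hl _]].
  { intros j. destruct (Hok j (Hpos j)) as [_ [H2 _]].
    specialize (H2 (fst (s (S j)))). rewrite dist_refl in H2.
    specialize (H2 (Rlt_le _ _ (Hpos (S j)))). pose proof (Hr j). lra. }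
  assert (Hin : forall j, dist l (fst (s j)) <= snd (s j)).
  { intros j. apply Rnot_lt_le. intros L.
    destruct (Hl (dist l (fst (s j)) - snd (s j))) as [N HN]; [lra|].
    specialize (HN (j + N)%nat ltac:(lia)). cbv beta in HN.
    pose proof (Hnest N j (fst (s (j + N)%nat))) as H1. rewrite dist_refl in H1.
    specialize (H1 (Rlt_le _ _ (Hpos _))).
    pose proof (dist_tri l (fst (s (j + N)%nat)) (fst (s j))).
    rewrite (dist_sym l (fst (s (j + N)%nat))) in *. lra. }
  exists l. intros x eps He. destruct (Hv x (eps / 2)) as [j [Hj1 Hj2]]; [lra|].
  destruct (Hok j (Hpos j)) as [_ [_ [n [k [Lk Hn]]]]].
  exists n. apply dist_nearT with k; auto. specialize (Hn l (Hin (S j))).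
  pose proof (dist_tri (vsub (iter n F l) k) (v j) x). lra.
Qed.

Lemma multi_chaotic P Q : is_saddle M G DG P -> is_repeller M G DG Q -> multi_chaotic_T2 M G DG.
Proof.
  intros HP HQ.
  assert (HS : dense_set (is_saddle M G DG))
    by (apply dense_set_of_dist, (saddles_dense P HP)).
  split; [|split; auto; apply dense_set_of_dist, (repellers_dense Q HQ)].
  split; [split; [|apply F_dense_orbit]|].
  - intros y. destruct (F_surj y) as [x Hx]. exists x. rewrite Hx. apply eqT_refl.
  - intros x eps He. destruct (HS x eps He) as [z [[n [Hn [Hz _]]] Hd]]. exists z.
    split; auto. exists n. auto.
Qed.

End Curve.
End Torus.

(** * The eigendirections of [M] *)

Definition cross (u v : vec) : R := fst u * snd v - snd u * fst v.

Lemma dot_mtrans Q L v : dot L (mv Q v) = dot (mv (mtrans Q) L) v.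
Proof. unfold mtrans. vring. Qed.

(** For either coordinate [f], parallelism gives [f u] times [v] equal to [f v] times [u]; applying
    [Q] with [a <> b] forces every [f u] to vanish. *)
Lemma eigenvectors_parallel Q a b u v : mv Q u = vscale a u -> mv Q v = vscale b v ->
  cross u v = 0 -> u <> zero -> v <> zero -> a = b.
Proof.
  intros Hu Hv Hc Hu0 Hv0. apply NNPP. intros Hab.
  assert (H : forall f, f u = 0 \/ v = zero \/ vscale (f u) v <> vscale (f v) u).
  { intros f. destruct (Req_dec (f u) 0) as [|Hf]; auto. right.
    destruct (classic (v = zero)) as [|Hz]; auto. right. intros E.
    pose proof (f_equal (mv Q) E) as E1. rewrite !mv_scale, Hu, Hv in E1.
    replace (vscale (f v) (vscale a u)) with (vscale a (vscale (f v) u)) in E1 by vring.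
    rewrite <- E in E1. apply Hz.
    pose proof (f_equal fst E1) as X. pose proof (f_equal snd E1) as Y.
    unfold vscale in X, Y; simpl in X, Y.
    assert (X1 : (b - a) * (f u * fst v) = 0) by lra. assert (Y1 : (b - a) * (f u * snd v) = 0) by lra.
    apply Rmult_integral in X1, Y1. destruct X1 as [X1|X1]; [lra|]. destruct Y1 as [Y1|Y1]; [lra|].
    apply Rmult_integral in X1, Y1. apply injective_projections; simpl; tauto. }
  unfold cross in Hc. apply Hu0. apply injective_projections; simpl.
  - destruct (H fst) as [E|[E|E]]; [auto|tauto|]. elim E.
    unfold vscale. apply injective_projections; simpl; lra.
  - destruct (H snd) as [E|[E|E]]; [auto|tauto|]. elim E.
    unfold vscale. apply injective_projections; simpl; lra.
Qed.

Lemma orthogonal_parallel L u v : L <> zero -> dot u L = 0 -> dot v L = 0 -> cross u v = 0.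
Proof.
  intros HL Hu Hv. unfold dot in *. unfold cross.
  assert (E1 : fst L * (fst u * snd v - snd u * fst v) = 0).
  { replace (fst L * (fst u * snd v - snd u * fst v)) with
      (snd v * (fst u * fst L + snd u * snd L) - snd u * (fst v * fst L + snd v * snd L)) by ring.
    rewrite Hu, Hv. ring. }
  assert (E2 : snd L * (fst u * snd v - snd u * fst v) = 0).
  { replace (snd L * (fst u * snd v - snd u * fst v)) with
      (fst u * (fst v * fst L + snd v * snd L) - fst v * (fst u * fst L + snd u * snd L)) by ring.
    rewrite Hu, Hv. ring. }
  apply Rmult_integral in E1, E2. destruct E1 as [E1|E1]; auto. destruct E2 as [E2|E2]; auto.
  elim HL. apply injective_projections; auto.
Qed.

Lemma vnorm_gt0 v : v <> zero -> 0 < vnorm v.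
Proof. intros H. pose proof (n1_gt0 v H). pose proof (n1_le_vnorm v). lra. Qed.

Lemma eigenvalues_det Q a b : is_eigenvalue Q a -> is_eigenvalue Q b -> a <> b -> mdet Q = a * b.
Proof.
  intros [u [Hu Eu]] [v [Hv Ev]] Hab.
  pose proof (eigenvalue_char Q a u Hu Eu) as E1. pose proof (eigenvalue_char Q b v Hv Ev) as E2.
  assert (E3 : (a - b) * (a + b - mtr Q) = 0) by lra.
  apply Rmult_integral in E3. destruct E3 as [E3|E3]; [lra|].
  replace (mtr Q) with (a + b) in E1 by lra. lra.
Qed.

Theorem theorem1 (M : mat) (G : vec -> vec) (DG : vec -> mat) (m : Z)
  (* F(z) = (M z + G(z)) mod 1, M integer, G continuous Z^2-periodic, F of class C^1 *)
  (HMint : is_int_mat M)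
  (HGper : Zperiodic G)
  (HGder : has_derivative G DG)
  (HDGcont : mat_continuous DG)
  (* DF(z) invertible for all z *)
  (Hinv : forall z, mdet (DF M DG z) <> 0)
  (* (E_M) *)
  (HEM : is_eigenvalue M 1 /\ is_eigenvalue M (IZR m) /\ (Z.abs m > 1)%Z)
  (* (E_PR) *)
  (HEPR : (exists P, is_saddle M G DG P) /\ (exists Q, is_repeller M G DG Q))
  (* (E_cone) *)
  (HEcone : exists (vR vL : vec) (K alpha : R),
      vR <> (0, 0) /\ mv M vR = vscale (IZR m) vR /\
      vL <> (0, 0) /\ mv (mtrans M) vL = vscale (IZR m) vL /\
      cone_system M DG (vscale (/ vnorm vR) vR) vL K alpha)
  (* (E_QuasiP) *)
  (HEQ : exists (p : nat) (gamma : R -> vec) (rho : R),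
      (1 <= p)%nat /\ quasiperiodic_curve M G p gamma rho) :
  multi_chaotic_T2 M G DG.

Proof.
  destruct HEM as [H1 [Hm Habs]].
  destruct HEPR as [[P HP] [Q HQ]].
  destruct HEcone as [vR [vL [K [alpha [HvR [EvR [HvL [EvL [HK [Halpha Hcone]]]]]]]]]].
  destruct HEQ as [p [gamma [rho [Hp Hq]]]].
  assert (Hm2 : 2 <= Rabs (IZR m)) by (rewrite <- abs_IZR; apply IZR_le; lia).
  assert (Hm1 : IZR m <> 1) by (intros E; rewrite E, Rabs_R1 in Hm2; lra).
  set (w := vscale (/ vnorm vR) vR) in *.
  pose proof (vnorm_gt0 vR HvR) as PvR. pose proof (vnorm_gt0 vL HvL) as PvL.
  assert (Ew : mv M w = vscale (IZR m) w) by (unfold w; rewrite mv_scale, EvR; vring).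
  assert (Hw0 : w <> zero).
  { intros E. apply HvR. apply n1_eq0. pose proof (f_equal n1 E) as E1. unfold w in E1.
    rewrite n1_scale, n1_zero in E1. apply Rmult_integral in E1. destruct E1 as [E1|E1]; auto.
    rewrite Rabs_inv, Rabs_pos_eq in E1 by lra. pose proof (Rinv_0_lt_compat _ PvR). lra. }
  assert (HLM : forall v, dot vL (mv M v) = IZR m * dot vL v).
  { intros v. rewrite dot_mtrans, EvL. vring. }
  (* [vL] annihilates the eigenvector [e] of eigenvalue 1, since [m <> 1]. If it also annihilated
     [w], the two would be parallel. *)
  assert (HwL : dot w vL <> 0).
  { intros E. destruct H1 as [e [He Ee]].
    apply Hm1. apply (eigenvectors_parallel M (IZR m) 1 w e); auto.
    apply (orthogonal_parallel vL); auto.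
    pose proof (HLM e) as E1. rewrite Ee, dot_scale in E1.
    assert (E2 : (IZR m - 1) * dot vL e = 0) by lra. apply Rmult_integral in E2.
    destruct E2 as [E2|E2]; [lra|]. rewrite <- E2. vring. }
  clearbody w. set (pA := vscale (/ dot w vL) vL).
  (* [W] is the line spanned by [vL] turned by a right angle. The [W] component of [v] has signed
     length [cross w v] times [|vL| / (w . vL)], which is this functional. *)
  set (pB := vscale (vnorm vL / dot w vL) (- snd w, fst w)).
  assert (HA : forall v, cone_a w vL v = dot pA v).
  { intros v. unfold cone_a, pA, Rdiv. vring. }
  assert (HB : forall v, vnorm (cone_b w vL v) = Rabs (dot pB v)).
  { intros v. replace (cone_b w vL v) with (vscale (cross w v / dot w vL) (- snd vL, fst vL)).
    - rewrite vnorm_scale. replace (vnorm (- snd vL, fst vL)) with (vnorm vL)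
        by (unfold vnorm; simpl; f_equal; ring).
      rewrite <- (Rabs_pos_eq (vnorm vL)) at 1 by lra. rewrite <- Rabs_mult. f_equal.
      unfold pB, cross. unfold dot at 2. unfold vscale; simpl. unfold Rdiv. ring.
    - unfold cone_b, cone_a, vsub, vscale, cross. unfold dot in *.
      apply injective_projections; simpl; field; intros E0; apply HwL; lra. }
  apply (multi_chaotic M G DG (IZR m) K alpha pA pB) with (p := p) (gamma := gamma) (rho := rho)
    (P := P) (Q := Q); auto.
  - rewrite (eigenvalues_det M 1 (IZR m)); auto.
    intros E. apply Rmult_integral in E. destruct E as [E|E]; [lra|]. rewrite E, Rabs_R0 in Hm2. lra.
  - intros v. unfold pA.
    replace (dot (vscale (/ dot w vL) vL) (mv M v)) with (/ dot w vL * dot vL (mv M v)) by vring.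
    rewrite HLM. vring.
  - replace (fst pA * snd pB - snd pA * fst pB) with (vnorm vL / dot w vL).
    + intros E. apply Rmult_integral in E. destruct E as [E|E]; [lra|].
      apply Rinv_neq_0_compat in E; auto.
    + unfold pA, pB, vscale, dot in *; simpl. field. intros E0. apply HwL. lra.
  - intros z v Hv Hc. destruct (Hcone z) as [Hz _].
    specialize (Hz v Hv). rewrite HB, HA in Hz. specialize (Hz Hc). cbv zeta in Hz.
    rewrite HB, !HA in Hz. destruct Hz. split; auto.
  - intros z v Hv Hc. destruct (Hcone z) as [_ Hz]. specialize (Hz v Hv).
    rewrite HB, HA in Hz. auto.
Qed.
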